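(* In the $\beta$-model, let $r$ be a fixed positive integer and assume $b_n^3/c_n=o\big(n^{1/6}/\log n\big)$. (a) Under the specified null $H_0:\beta_i=\beta_i^0$, $i=1,\dots,r$ (true $\boldsymbol\beta$ satisfying it), with $\hat{\boldsymbol\beta}^0$ the maximizer of $\ell$ over $\{\boldsymbol\gamma\in\mathbb R^n:\gamma_i=\beta_i^0,\ i=1,\dots,r\}$, the statistic $2\{\ell(\hat{\boldsymbol\beta})-\ell(\hat{\boldsymbol\beta}^0)\}$ converges in distribution to $\chi^2_r$ as $n\to\infty$. (b) If $r\ge2$, under the homogeneous null $H_0:\beta_1=\cdots=\beta_r$ (true $\boldsymbol\beta$ satisfying it), with $\hat{\boldsymbol\beta}^0$ the maximizer of $\ell$ over $\{\boldsymbol\gamma\in\mathbb R^n:\gamma_1=\cdots=\gamma_r\}$, $2\{\ell(\hat{\boldsymbol\beta})-\ell(\hat{\boldsymbol\beta}^0)\}$ converges in distribution to $\chi^2_{r-1}$ as $n\to\infty$. (In both cases the MLEs exist with probability tending to one.)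
   Context: All quantities may depend on $n$; asymptotics are as $n\to\infty$. $\beta$-model: for $\boldsymbol\beta=(\beta_1,\dots,\beta_n)^\top\in\mathbb R^n$, the symmetric adjacency matrix $A=(a_{ij})$ of an undirected graph on nodes $\{1,\dots,n\}$ has $a_{ii}=0$, $a_{ji}=a_{ij}$, and $a_{ij}$ ($1\le i<j\le n$) mutually independent Bernoulli with $P(a_{ij}=1)=\mu(\beta_i+\beta_j)$, where $\mu(x)=e^x/(1+e^x)$. Degrees: $d_i=\sum_{j\ne i}a_{ij}$. Log-likelihood: $\ell(\boldsymbol\gamma)=\sum_{i=1}^n\gamma_id_i-\sum_{1\le i<j\le n}\log(1+e^{\gamma_i+\gamma_j})$; $\hat{\boldsymbol\beta}$ is its maximizer over $\mathbb R^n$. $b_n=\max_{i\ne j}(1+e^{\beta_i+\beta_j})^2/e^{\beta_i+\beta_j}$, $c_n=\min_{i\ne j}(1+e^{\beta_i+\beta_j})^2/e^{\beta_i+\beta_j}$ at the true $\boldsymbol\beta$. $\chi^2_k$ denotes the chi-square distribution with $k$ degrees of freedom. *)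

(* Defs.v *)
From HB Require Import structures.
From mathcomp Require Import all_boot all_order all_algebra.
From mathcomp Require Import all_classical all_reals all_analysis.
Set Implicit Arguments. Unset Strict Implicit. Unset Printing Implicit Defensive.
Import Order.TTheory GRing.Theory Num.Theory.
Import numFieldNormedType.Exports.
Local Open Scope classical_set_scope.
Local Open Scope ring_scope.

(* An edge configuration on nodes 'I_n: only the entries (i,j) with i < j are
   meaningful (they are the a_ij, i<j); the others are forced to be false by
   the probability weight below. *)
Definition graph (n : nat) := {ffun 'I_n * 'I_n -> bool}.

Definition adj (n : nat) (A : graph n) (i j : 'I_n) : bool :=
  if (i < j)%N then A (i, j) else if (j < i)%N then A (j, i) else false.

Definition mu (R : realType) (x : R) : R := expR x / (1 + expR x).

Definition bm_weight (R : realType) (n : nat) (beta : 'I_n -> R) (A : graph n) : R :=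
  \prod_(p : 'I_n * 'I_n)
    (if (p.1 < p.2)%N then
       (if A p then mu (beta p.1 + beta p.2) else 1 - mu (beta p.1 + beta p.2))
     else (if A p then 0 else 1)).

Definition bm_prob (R : realType) (n : nat) (beta : 'I_n -> R)
  (E : graph n -> Prop) : R :=
  \sum_(A : graph n | `[< E A >]) bm_weight beta A.

Definition degree (R : realType) (n : nat) (A : graph n) (i : 'I_n) : R :=
  \sum_(j < n | j != i) ((adj A i j : nat)%:R).

Definition loglik (R : realType) (n : nat) (A : graph n) (g : 'I_n -> R) : R :=
  \sum_(i < n) g i * degree R A i
  - \sum_(i < n) \sum_(j < n | (i < j)%N) ln (1 + expR (g i + g j)).

Definition is_maximizer (R : realType) (n : nat) (A : graph n)
  (S : set ('I_n -> R)) (g : 'I_n -> R) : Prop :=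
  S g /\ forall h, S h -> loglik A h <= loglik A g.

(* b_n and c_n (meaningful for n >= 2) *)
Definition bterm (R : realType) (x : R) : R := (1 + expR x) ^+ 2 / expR x.

Definition b_n (R : realType) (n : nat) (beta : 'I_n -> R) : R :=
  \big[Num.max/0]_(i < n) \big[Num.max/0]_(j < n | j != i) bterm (beta i + beta j).

(* min over i != j; starting from b_n, which is one of the values when n >= 2 *)
Definition c_n (R : realType) (n : nat) (beta : 'I_n -> R) : R :=
  \big[Num.min/b_n beta]_(i < n) \big[Num.min/b_n beta]_(j < n | j != i)
     bterm (beta i + beta j).

(* chi-square distribution with k degrees of freedom: its density is
   proportional to t^(k/2-1) e^(-t/2) on t > 0; CDF obtained by normalizing *)
Definition chi2_kernel (R : realType) (k : nat) (t : R) : R :=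
  t `^ (k%:R / 2 - 1) * expR (- t / 2).

Definition chi2_cdf (R : realType) (k : nat) (x : R) : R :=
  if x <= 0 then 0 else
  fine (\int[@lebesgue_measure R]_(t in `]0, x]) (chi2_kernel k t)%:E) /
  fine (\int[@lebesgue_measure R]_(t in `]0, +oo[) (chi2_kernel k t)%:E).

(* Main.v *)
Require Import Defs.
From HB Require Import structures.
From mathcomp Require Import all_boot all_order all_algebra.
From mathcomp Require Import all_classical all_reals all_analysis.
From mathcomp Require Import measurable_realfun ring lra.
Import Order.TTheory GRing.Theory Num.Theory.
Import numFieldNormedType.Exports.
Local Open Scope classical_set_scope.
Local Open Scope ring_scope.
Set Implicit Arguments. Unset Strict Implicit. Unset Printing Implicit Defensive.

(* Let L(x) = loglik (beta + x) - loglik beta.  All sums run over edges, and the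
   information form <x, y> = sum_e v_e x_e y_e, with x_e = x_i + x_j for e = {i, j},
   is at least (n - 2) / b_n times the squared norm.

   Maximizers: a maximizer of the concave L over the constraint space N intersected with
   a fixed box satisfies a variational inequality; tested against a coordinatewise soft
   threshold of the maximizer itself (which stays in N), it forces
   |x|_oo <= C b_n max_i |d_i - E d_i| / n.  So the maximizer is interior, hence global.

   Likelihood ratio: let h_1, ..., h_k be an orthonormal basis of the complement of N.
   The score at the constrained maximizer x0 vanishes on N, and around x0 the Hessian of L
   is the information form up to factors e^(+- o(1)).  Hence twice the log-likelihood ratio
   is (1 + o(1)) sum_a s_a^2, where s_a is the score at x0 in the direction h_a.  As h_a is
   orthogonal to x0, s_a differs from Z_a, the score at beta in the direction h_a, only by a
   second-order term; h_a is essentially supported on the first r coordinates, so this term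
   is negligible, although the second-order terms of L itself are not.

   Limit law: Cov(Z) is exactly the identity.  The Bernoulli identity
   E[(a - p) g(a)] = p (1 - p) (g(1) - g(0)) gives, for F(lam) = E exp(- lam |Z|^2), the
   approximate equation - (1 + 2 lam) F' = k F, so F(lam) tends to (1 + 2 lam)^(-k/2), the
   Laplace transform of the chi-square law, and indicators are approximated by polynomials
   in exp(- lam t). *)

(** * The chi-square law *)

(** With probability at least 1 - 2/n, for large n, the maximizers lie within [tau], of order b
    sqrt(log n / n), of the true parameter in sup norm. The obstacle is that a cubic Taylor
    remainder of L, summed over n^2 edges, is bounded only by n^2 tau^3, which may diverge. So
    Hessians are only compared multiplicatively, which works because the logistic variance is
    log-Lipschitz, and the score is linearized in just k directions. There the remainder is n tau^2
    |h_a|_1 with |h_a|_1 of order b^(3/2) / sqrt n, hence at most of order b^4 log n / sqrt n. As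
    c_n <= b_n, the rate hypothesis gives b_n^2 log n = o(n^(1/6)), which makes this and all other
    errors vanish. The basis h_a is orthonormal for the information at the true parameter, not at an
    estimate, so it is deterministic: each Z_a is a sum of independent edge terms, and flipping one
    edge moves the vector Z by at most sqrt(4 k b / (n - 2)), which sets the size of the error in
    the equation for F. *)

Section ChiSquare.
Context {R : realType}.
Notation leb := (@lebesgue_measure R).
Implicit Types (k : nat) (x t c : R).

Lemma bigcup_itv_cy c : 0 < c ->
  \bigcup_n `[c / n.+1%:R, +oo[%classic = `]0, +oo[%classic :> set R.
Proof.
move=> c0; apply/seteqP; split => [x [n _]|x] /=; rewrite !in_itv/= !andbT.
  by apply: lt_le_trans; rewrite divr_gt0.
move=> x0; exists (Num.truncn (c / x)) => //=; rewrite in_itv/= andbT.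
rewrite ler_pdivrMr// mulrC -ler_pdivrMr//.
by rewrite ltW// truncnS_gt.
Qed.

(** The left ends are [c / n.+1] with [c] free, so that x -> c x carries the exhaustion for scale 1
    onto the exhaustion for scale [c]. *)
Lemma cvg_integral_itv_cy (f : R -> R) c : 0 < c ->
  measurable_fun `](0:R), +oo[ f -> (forall x, 0 < x -> 0 <= f x) ->
  (\int[leb]_(x in `[(c / n.+1%:R)%R, +oo[) (f x)%:E)%E @[n --> \oo]
    --> (\int[leb]_(x in `]0%R, +oo[) (f x)%:E)%E.
Proof.
move=> c0 mf f0; rewrite -(bigcup_itv_cy c0).
have sub n : `[c / n.+1%:R, +oo[ `<=` `](0:R), +oo[.
  by move=> x /=; rewrite !in_itv/= !andbT; apply: lt_le_trans; rewrite divr_gt0.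
apply: ge0_nondecreasing_set_cvg_integral => //.
- move=> n m nm; apply/subsetPset => x /=; rewrite !in_itv/= !andbT.
  apply: le_trans; rewrite ler_pM2l// lef_pV2 ?posrE//.
  by rewrite ler_nat.
- move=> n; apply/measurable_EFinP; exact: measurable_funS (sub n) mf.
- move=> n x /sub /=; rewrite in_itv/= andbT lee_fin; exact: f0.
Qed.

(** The substitution is done on [[a, +oo[] and passed to the limit by monotone convergence, because
    [f] may blow up at 0, as the kernel does for k = 1. *)
Lemma ge0_integral_dilation (f : R -> R) c : 0 < c ->
  (forall x, 0 < x -> {for x, continuous f}) -> (forall x, 0 < x -> 0 <= f x) ->
  (\int[leb]_(x in `]0%R, +oo[) (c * f (c * x)%R)%:E =
   \int[leb]_(x in `]0%R, +oo[) (f x)%:E)%E.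
Proof.
move=> c0 cf f0.
have mf : measurable_fun `](0:R), +oo[ f.
  apply: open_continuous_measurable_fun => // x.
  by rewrite inE/= in_itv/= andbT => /cf.
have cfc x : 0 < x -> {for x, continuous (fun x => c * f (c * x))}.
  move=> x0; apply: continuousM; first exact: cst_continuous.
  apply: continuous_comp; last by apply: cf; rewrite mulr_gt0.
  by apply: cvgM; [exact: cvg_cst|exact: cvg_id].
have mfc : measurable_fun `](0:R), +oo[ (fun x => c * f (c * x)).
  apply: open_continuous_measurable_fun => // x.
  by rewrite inE/= in_itv/= andbT => /cfc.
have f0c x : 0 < x -> 0 <= c * f (c * x).
  by move=> x0; rewrite mulr_ge0 ?(ltW c0)// f0// mulr_gt0.
have C1 := @cvg_integral_itv_cy _ _ ltr01 mfc f0c.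
have C2 := @cvg_integral_itv_cy _ _ c0 mf f0.
apply: (cvg_unique (@ereal_hausdorff R) C1).
apply: cvg_trans C2; apply: near_eq_cvg; near=> n.
set a := 1 / _; rewrite /= (_ : c / _ = c * a); last by rewrite /a div1r.
have a0 : 0 < a by rewrite divr_gt0.
have dE : derive1 (fun x : R => c * x) = (fun=> c).
  apply/funext => x; rewrite derive1E.
  by rewrite deriveM// derive_cst derive_id scaler0 addr0 /GRing.scale/= mulr1.
rewrite (@increasing_ge0_integration_by_substitutiony R (fun x => c * x) f a).
- by rewrite dE; apply: eq_integral => x _ /=; rewrite mulrC.
- by move=> x y _ _ xy; rewrite ltr_pM2l.
- by rewrite dE => x _; exact: cst_continuous.
- by rewrite dE; exact: is_cvg_cst.
- by rewrite dE; exact: is_cvg_cst.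
- split.
    by move=> x _; apply: derivableM.
  apply: cvg_at_right_filter.
  by apply: cvgM; [exact: cvg_cst|exact: cvg_id].
- by apply: gt0_cvgMry => //; exact: cvg_id.
- apply: continuous_in_subspaceT => x; rewrite inE/= in_itv/= andbT => ax.
  by apply: cf; apply: lt_le_trans ax; rewrite mulr_gt0.
- move=> x; rewrite in_itv/= andbT => ax; apply: f0.
  by apply: lt_trans ax; rewrite mulr_gt0.
Unshelve. all: by end_near. Qed.

Lemma powR_continuous (a x : R) : 0 < x -> {for x, continuous (@powR R ^~ a)}.
Proof.
move=> x0; apply/differentiable_continuous/derivable1_diffP.
by apply: derivable_powR; rewrite in_itv/= x0.
Qed.

Lemma chi2_kernel_ge0 k t : 0 <= chi2_kernel k t.
Proof. by rewrite mulr_ge0 ?powR_ge0 ?expR_ge0. Qed.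

Lemma expR_scale_continuous c x : {for x, continuous (fun t => expR (c * t))}.
Proof.
apply: continuous_comp; last exact: continuous_expR.
by apply: cvgM; [exact: cvg_cst|exact: cvg_id].
Qed.

Lemma chi2_kernel_continuous k x : 0 < x -> {for x, continuous (chi2_kernel k)}.
Proof.
move=> x0; apply: cvgM; first exact: powR_continuous.
have := @expR_scale_continuous (- 2^-1) x.
rewrite (_ : (fun t => _) = (fun t => expR (- t / 2)))//.
by apply/funext => t; congr expR; rewrite mulrC mulrN mulNr.
Qed.

Lemma measurable_chi2_kernel k : measurable_fun `](0:R), +oo[ (chi2_kernel k).
Proof.
apply: open_continuous_measurable_fun => // x.
by rewrite inE/= in_itv/= andbT => /chi2_kernel_continuous; apply.
Qed.

(** Exponential tilting of a gamma density is a dilation by c = 1 + 2 lam: the powers c^(-k/2), c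
    and c^(k/2 - 1) cancel. *)
Lemma chi2_kernelM_expR k lam t : 0 <= lam -> 0 < t ->
  chi2_kernel k t * expR (- (lam * t)) =
  (1 + 2 * lam) `^ (- (k%:R / 2)) *
    ((1 + 2 * lam) * chi2_kernel k ((1 + 2 * lam) * t)).
Proof.
move=> lam0 t0; set c := 1 + 2 * lam.
have c0 : 0 < c by rewrite /c; lra.
rewrite /chi2_kernel -mulrA -expRD powRM ?ltW//.
rewrite [c `^ (_ - _)]powRB; last by rewrite (gt_eqF c0) implybT.
rewrite (powRr1 (ltW c0)) powRN.
have := powR_gt0 (k%:R / 2) c0; set d := _ `^ (k%:R / 2) => d0.
rewrite (_ : - t / 2 - lam * t = - (c * t) / 2); last by rewrite /c; field.
by field; rewrite !gt_eqF.
Qed.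

Lemma chi2_laplace_ereal k lam : 0 <= lam ->
  (\int[leb]_(t in `]0%R, +oo[) (chi2_kernel k t * expR (- (lam * t)))%:E =
   ((1 + 2 * lam) `^ (- (k%:R / 2)))%:E *
   \int[leb]_(t in `]0%R, +oo[) (chi2_kernel k t)%:E)%E.
Proof.
move=> lam0; have c0 : 0 < 1 + 2 * lam by lra.
rewrite -(ge0_integral_dilation c0); last 2 first.
- by move=> x; exact: chi2_kernel_continuous.
- by move=> x _; exact: chi2_kernel_ge0.
rewrite -ge0_integralZl//.
- apply: eq_integral => t; rewrite inE/= in_itv/= andbT => t0.
  by rewrite chi2_kernelM_expR// EFinM.
- apply/measurable_EFinP; apply: open_continuous_measurable_fun => // x.
  rewrite inE/= in_itv/= andbT => x0.
  apply: cvgM; first exact: cvg_cst.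
  apply: continuous_comp; last by apply: chi2_kernel_continuous; rewrite mulr_gt0.
  by apply: cvgM; [exact: cvg_cst|exact: cvg_id].
- by move=> x _; rewrite lee_fin mulr_ge0 ?chi2_kernel_ge0 ?ltW.
- by rewrite lee_fin powR_ge0.
Qed.

Lemma powR_half_integral_le n :
  (\int[leb]_(t in `[(1 / n.+2%:R)%R, 1%R]) (t `^ (- 2^-1))%:E <= 2%:E)%E.
Proof.
set a : R := 1 / _.
have a0 : 0 < a by rewrite divr_gt0.
have a1 : a < 1 by rewrite /a ltr_pdivrMr// mul1r ltr1n.
rewrite (@continuous_FTC2 R _ (fun t => 2 * t `^ (2^-1)))//.
- by rewrite powR1 -EFinB lee_fin mulr1 gerBl mulr_ge0// powR_ge0.
- apply: continuous_in_subspaceT => x; rewrite inE/= in_itv/= => /andP[ax _].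
  by apply: powR_continuous; apply: lt_le_trans ax.
- have D x : 0 < x -> derivable (fun t : R => 2 * t `^ (2^-1)) x 1.
    move=> x0; apply: derivableM => //.
    by apply: derivable_powR; rewrite in_itv/= x0.
  have C x : 0 < x -> {for x, continuous (fun t : R => 2 * t `^ (2^-1))}.
    move=> /D Dx; exact/differentiable_continuous/derivable1_diffP.
  split.
  + by move=> x; rewrite in_itv/= => /andP[ax _]; apply: D; apply: lt_trans ax.
  + by apply: cvg_at_right_filter; apply: C.
  + by apply: cvg_at_left_filter; apply: C.
- move=> x; rewrite in_itv/= => /andP[ax _].
  have x0 : 0 < x by apply: lt_trans ax.
  have H := is_derive1_powR (2^-1) x0.
  rewrite derive1E deriveM//.
  rewrite derive_cst scaler0 addr0 derive_val /GRing.scale/=.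
  by rewrite mulrA mulfV// mul1r; congr (_ `^ _); lra.
Qed.

(** From t^k / (4^k k!) <= e^(t/4). The rate 1/4 is half that of the kernel, which leaves an
    integrable e^(-t/4). *)
Lemma powR_le_expR_quarter k t : (0 < k)%N -> 1 <= t ->
  t `^ (k%:R / 2 - 1) <= 4 ^+ k * k`!%:R * expR (t / 4).
Proof.
case: k => // k _ t1; have t0 : 0 <= t by lra.
have := @expR_ge1Dxn R (t / 4) k; rewrite divr_ge0// => /(_ isT) H.
apply: (@le_trans _ _ (t ^+ k.+1)).
  rewrite -powR_mulrn//; apply: ler_powR => //.
  have : (0:R) <= k.+1%:R by []. lra.
have F : 0 < (k.+1)`!%:R :> R by rewrite ltr0n fact_gt0.
have : (t / 4) ^+ k.+1 / (k.+1)`!%:R <= expR (t / 4) by lra.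
rewrite ler_pdivrMr// expr_div_n ler_pdivrMr ?exprn_gt0// => /le_trans; apply.
by rewrite le_eqVlt; apply/orP; left; apply/eqP; ring.
Qed.

Lemma chi2_kernel_le_expR k t : (0 < k)%N -> 1 <= t ->
  chi2_kernel k t <= 4 ^+ k * k`!%:R * expR (- 4^-1 * t).
Proof.
move=> k0 /(powR_le_expR_quarter k0) H.
rewrite /chi2_kernel (_ : - 4^-1 * t = t / 4 + - t / 2); last by field.
by rewrite expRD mulrA ler_wpM2r// expR_ge0.
Qed.

Lemma chi2_kernel_le_powR k t : (0 < k)%N -> 0 < t <= 1 ->
  chi2_kernel k t <= t `^ (- 2^-1).
Proof.
move=> k0 /andP[t0 t1]; apply: (@le_trans _ _ (t `^ (k%:R / 2 - 1))).
  by rewrite ler_piMr ?powR_ge0// -[leRHS]expR0 ler_expR; lra.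
apply: ger_powR; first by rewrite t0.
have : (1:R) <= k%:R by rewrite ler1n.
lra.
Qed.

Lemma integral_expR_quarter_le :
  (\int[leb]_(t in `[1%R, +oo[) (expR (- (4^-1) * t))%:E <= 4%:E)%E.
Proof.
have dF x : is_derive x 1 (fun t : R => - 4 * expR (- (4^-1) * t)) (expR (- (4^-1) * x)).
  by apply: is_derive_eq; rewrite /GRing.scale/=; field.
rewrite (@ge0_continuous_FTC2y R _ (fun t : R => - 4 * expR (- (4^-1) * t)) 1 0).
- rewrite sub0e -EFinN lee_fin mulNr opprK ler_piMr// -expR0 ler_expR; lra.
- by move=> x _; exact: expR_ge0.
- by apply: continuous_subspaceT => x; exact: expR_scale_continuous.
- rewrite -[X in _ --> X](mulr0 (- 4)); apply: cvgM; first exact: cvg_cst.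
  under eq_fun do rewrite mulNr.
  apply: (@cvg_comp _ _ _ (fun x : R => 4^-1 * x) (fun x : R => expR (- x))).
    by apply: gt0_cvgMry => //; exact: cvg_id.
  exact: cvgr_expR.
- by move=> x _; case: (dF x).
- apply: cvg_at_right_filter; apply: cvgM; first exact: cvg_cst.
  exact: expR_scale_continuous.
- by move=> x _; rewrite derive1E; case: (dF x).
Qed.

(** Split at 1: near 0 the kernel is below t^(-1/2), of integral at most 2, and beyond 1 it is below
    C e^(-t/4), of integral at most 4 C. *)
Lemma chi2_mass_lty k : (0 < k)%N ->
  (\int[leb]_(t in `]0%R, +oo[) (chi2_kernel k t)%:E < +oo)%E.
Proof.
move=> k0; pose C : R := 4 ^+ k * k`!%:R.
have C0 : 0 <= C by rewrite mulr_ge0// exprn_ge0.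
have mk (a : R) : 0 < a -> measurable_fun `[a, +oo[ (chi2_kernel k).
  move=> a0; apply: measurable_funS (measurable_chi2_kernel k) => // x /=.
  by rewrite !in_itv/= !andbT; exact: lt_le_trans.
apply: (@le_lt_trans _ _ (2 + C * 4)%:E); last exact: ltry.
have := @cvg_integral_itv_cy _ _ ltr01 (measurable_chi2_kernel k)
  (fun x _ => chi2_kernel_ge0 k x).
move=> H; rewrite -(cvg_lim _ H)//; apply: lime_le; first by apply/cvg_ex; eexists; exact: H.
near=> n; set a : R := 1 / n.+1%:R.
have a0 : 0 < a by rewrite divr_gt0.
(* Writing [n] as a successor makes the left end 1 / (n' + 2), strictly below 1. *)
have [n' nE] : exists n', n = n'.+1.
  have : (0 < n)%N by near: n; exists 1.
  by move=> n0; exists n.-1; rewrite prednK.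
have a1 : a < 1 by rewrite /a nE ltr_pdivrMr// mul1r ltr1n.
have -> : `[a, +oo[%classic = (`[a, 1] `|` `]1, +oo[)%classic :> set R.
  by rewrite -itv_bndbnd_setU// !bnd_simp// ltW.
have sub1 : `[a, 1] `<=` `[a, +oo[ by move=> x /=; rewrite !in_itv/= => /andP[->].
have sub2 : `]1, +oo[ `<=` `[a, +oo[.
  by move=> x /=; rewrite !in_itv/= !andbT => /ltW; apply/le_trans/ltW.
have EUM : measurable_fun (`[a, 1] `|` `]1, +oo[) (EFin \o chi2_kernel k).
  apply/measurable_EFinP; apply: measurable_funS (mk a a0) => //.
  by move=> x [/sub1|/sub2].
rewrite ge0_integral_setU//.
- rewrite EFinD; apply: leeD.
  + have := powR_half_integral_le n'; rewrite -nE -/a; apply: le_trans.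
    apply: ge0_le_integral => //.
    * by move=> x _; rewrite lee_fin chi2_kernel_ge0.
    * by apply: measurable_funS EUM => //; first exact: measurableU.
    * by apply/measurable_EFinP; apply: measurable_funTS; exact: measurable_powR.
    * move=> x /=; rewrite in_itv/= => /andP[ax x1]; rewrite lee_fin.
      by apply: chi2_kernel_le_powR => //; rewrite x1 andbT; apply: lt_le_trans ax.
  + apply: (@le_trans _ _ (C%:E * \int[leb]_(t in `[1%R, +oo[) (expR (- (4^-1) * t))%:E)%E).
      have mE : measurable_fun [set: R] (fun t : R => expR (- (4^-1) * t)).
        apply: measurableT_comp => //; exact: measurable_funM.
      have mCE D : measurable D ->
          measurable_fun D (EFin \o (fun t : R => C * expR (- (4^-1) * t))).
        by move=> mD; apply/measurable_EFinP; apply: measurable_funTS; exact: measurable_funM.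
      rewrite -ge0_integralZl//; last first.
        by apply/measurable_EFinP; exact: measurable_funTS.
      apply: (@le_trans _ _ (\int[leb]_(t in `]1%R, +oo[) (C%:E * (expR (- (4^-1) * t))%:E))%E).
        apply: ge0_le_integral => //.
        * by move=> x _; rewrite lee_fin chi2_kernel_ge0.
        * by apply: measurable_funS EUM => //; first exact: measurableU.
        * exact: mCE.
        * move=> x /=; rewrite in_itv/= andbT => x1; rewrite lee_fin.
          exact: chi2_kernel_le_expR (ltW x1).
      apply: ge0_subset_integral => //.
      * exact: mCE.
      * by move=> x _; rewrite lee_fin mulr_ge0// expR_ge0.
      * by move=> x /=; rewrite !in_itv/= !andbT => /ltW.
    rewrite [leRHS]EFinM; apply: lee_wpmul2l; first by rewrite lee_fin.
    exact: integral_expR_quarter_le.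
- by move=> x _; rewrite lee_fin chi2_kernel_ge0.
- apply/disj_setPS => x /= []; rewrite !in_itv/= andbT => /andP[_ x1] x1'.
  by move: (le_lt_trans x1 x1'); rewrite ltxx.
Unshelve. all: by end_near. Qed.

Lemma measurableT_chi2_kernel k : measurable_fun [set: R] (chi2_kernel k).
Proof.
apply: measurable_funM; first exact: measurable_powR.
by apply: measurableT_comp => //; apply: measurable_funM.
Qed.

Lemma integrable_chi2_kernel k : (0 < k)%N ->
  leb.-integrable `](0:R), +oo[ (EFin \o chi2_kernel k).
Proof.
move=> k0; apply/integrableP; split.
  by apply/measurable_EFinP; exact: measurable_chi2_kernel.
under eq_integral do rewrite /= ger0_norm ?chi2_kernel_ge0//.
exact: chi2_mass_lty.
Qed.

Definition chi2_mass k : R := \int[leb]_(t in `]0, +oo[) chi2_kernel k t.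

Lemma chi2_mass_gt0 k : (0 < k)%N -> 0 < chi2_mass k.
Proof.
move=> k0; have F : (\int[leb]_(t in `]0%R, +oo[) (chi2_kernel k t)%:E)%E \is a fin_num.
  by apply: integrable_fin_num (integrable_chi2_kernel k0).
(* On [1, 2] the power is at least 1/t >= 1/2, whatever [k], and the exponential is at least
   e^(-1). *)
rewrite -lte_fin fineK//; set c : R := 2^-1 * expR (- 1).
have c0 : 0 < c by rewrite mulr_gt0 ?expR_gt0.
apply: (@lt_le_trans _ _ (\int[leb]_(t in `[1%R, 2%R]) (cst c%:E t))%E).
  rewrite integral_cst//= lebesgue_measure_itv/= lte_fin ltr1n/=.
  by rewrite -EFinB -EFinM lte_fin mulr_gt0// subr_gt0 ltr1n.
apply: (@le_trans _ _ (\int[leb]_(t in `[1%R, 2%R]) (chi2_kernel k t)%:E)%E).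
  apply: ge0_le_integral => //.
  - by move=> x _; rewrite lee_fin ltW.
  - by apply/measurable_EFinP; apply: measurable_funTS; exact: measurableT_chi2_kernel.
  - move=> x /=; rewrite in_itv/= lee_fin => /andP[x1 x2].
    have x0 : 0 < x by apply: lt_le_trans x1.
    apply: ler_pM; rewrite ?expR_ge0//.
    + apply: (@le_trans _ _ (x `^ (-1))).
        by rewrite (powR_inv1 (ltW x0)) lef_pV2 ?posrE.
      apply: ler_powR => //; have : (0:R) <= k%:R by [].
      lra.
    + by rewrite ler_expR; lra.
apply: ge0_subset_integral => //.
- by apply/measurable_EFinP; exact: measurable_chi2_kernel.
- by move=> x _; rewrite lee_fin chi2_kernel_ge0.
- by move=> x /=; rewrite !in_itv/= andbT => /andP[x1 _]; apply: lt_le_trans x1.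
Qed.

(** Closing the interval at 0 turns the numerator into a parameterized integral, whose continuity
    gives [chi2_cdf_right] and [chi2_cdf_left]. *)
Lemma chi2_cdfE k x : 0 <= x ->
  chi2_cdf k x = (\int[leb]_(t in `[0, x]) chi2_kernel k t) / chi2_mass k.
Proof.
rewrite /chi2_cdf le_eqVlt => /predU1P[<-|x0].
  by rewrite lexx set_itv1 Rintegral_set1 mul0r.
rewrite leNgt x0/= /Rintegral integral_itv_obnd_cbnd//.
by apply/measurable_EFinP; apply: measurable_funTS; exact: measurableT_chi2_kernel.
Qed.

Lemma integrable_chi2_kernel_cc k (b : R) : (0 < k)%N -> 0 <= b ->
  leb.-integrable `[0, b] (EFin \o chi2_kernel k).
Proof.
move=> k0 b0; have mk (A : set R) : measurable A -> measurable_fun A (EFin \o chi2_kernel k).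
  move=> mA; apply/measurable_EFinP; apply: measurable_funTS.
  exact: measurableT_chi2_kernel.
apply/integrableP; split; first exact: mk.
under eq_integral do rewrite /= ger0_norm ?chi2_kernel_ge0//.
rewrite -integral_itv_obnd_cbnd; last exact: mk.
apply: le_lt_trans (chi2_mass_lty k0).
apply: ge0_subset_integral => //; first exact: mk.
by move=> x _; rewrite lee_fin chi2_kernel_ge0.
by move=> x /=; rewrite !in_itv/= andbT => /andP[].
Qed.

Lemma chi2_cdf_right k x (e : R) : (0 < k)%N -> 0 <= x -> 0 < e ->
  exists2 z, x < z & chi2_cdf k z <= chi2_cdf k x + e.
Proof.
move=> k0 x0 e0; have M0 := chi2_mass_gt0 k0.
have b0 : 0 < x + 1 by lra.
have /(continuous_within_itvP _ b0)[C1 C2 _] :=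
  parameterized_integral_continuous (ltW b0) (integrable_chi2_kernel_cc k0 (ltW b0)).
have C : parameterized_integral leb 0 t (chi2_kernel k) @[t --> x^'+] -->
         parameterized_integral leb 0 x (chi2_kernel k).
  move: x0; rewrite le_eqVlt => /predU1P[<-//|x0].
  by apply: cvg_at_right_filter; apply: C1; rewrite in_itv/= x0/=; lra.
have /cvgrPdist_le/(_ _ (mulr_gt0 e0 M0)) C' := C.
near x^'+ => z; exists z; first by near: z; exact: nbhs_right_gt.
have xz : x < z by near: z; exact: nbhs_right_gt.
rewrite !chi2_cdfE//; last by lra.
rewrite -lerBlDl -mulrBl ler_pdivrMr//.
apply: le_trans (ler_norm _) _; rewrite distrC.
by near: z; exact: C'.
Unshelve. all: by end_near. Qed.

Lemma chi2_cdf_left k x (e : R) : (0 < k)%N -> 0 < x -> 0 < e ->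
  exists2 y, 0 < y < x & chi2_cdf k x - e <= chi2_cdf k y.
Proof.
move=> k0 x0 e0; have M0 := chi2_mass_gt0 k0.
have b0 : 0 < x + 1 by lra.
have /(continuous_within_itvP _ b0)[C1 C2 _] :=
  parameterized_integral_continuous (ltW b0) (integrable_chi2_kernel_cc k0 (ltW b0)).
have C : parameterized_integral leb 0 t (chi2_kernel k) @[t --> x^'-] -->
         parameterized_integral leb 0 x (chi2_kernel k).
  by apply: cvg_at_left_filter; apply: C1; rewrite in_itv/= x0/=; lra.
have /cvgrPdist_le/(_ _ (mulr_gt0 e0 M0)) C' := C.
near x^'- => y.
have y0 : 0 < y by near: y; exact: nbhs_left_gt.
have yx : y < x by near: y; exact: nbhs_left_lt.
exists y; first by rewrite y0 yx.
rewrite !chi2_cdfE ?(ltW x0) ?(ltW y0)// lerBlDr -lerBlDl -mulrBl ler_pdivrMr//.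
apply: le_trans (ler_norm _) _.
by near: y; exact: C'.
Unshelve. all: by end_near. Qed.

Lemma bernoulli_inequality (a : R) m : 0 <= a <= 1 -> 1 - m%:R * a <= (1 - a) ^+ m.
Proof.
move=> /andP[a0 a1]; elim: m => [|m IH]; first by rewrite mul0r subr0 expr0.
rewrite exprS; apply: le_trans (_ : (1 - a) * (1 - m%:R * a) <= _).
  rewrite -natr1 mulrDl mul1r.
  have : 0 <= m%:R * a * a by rewrite !mulr_ge0.
  lra.
by rewrite ler_wpM2l// subr_ge0.
Qed.

Lemma expr_1B_le (a : R) m : 0 <= a <= 1 -> (1 - a) ^+ m * (1 + m%:R * a) <= 1.
Proof.
move=> /andP[a0 a1]; have ma0 : 0 <= m%:R * a by rewrite mulr_ge0.
apply: le_trans (_ : expR (- (m%:R * a)) * expR (m%:R * a) <= 1); last first.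
  by rewrite -expRD addNr expR0.
apply: ler_pM; rewrite ?exprn_ge0 ?subr_ge0 ?addr_ge0// ?expR_ge1Dx//.
rewrite -mulrN expRM_natl lerXn2r ?nnegrE ?subr_ge0 ?expR_ge0//.
exact: expR_ge1Dx.
Qed.

(* [1 - (1 - Y^N)^(2^N)] is a polynomial in Y close to the indicator of Y > 1/2;
   the threshold is moved to (y + z) / 2 by the choice of lam in Y = e^(- lam t). *)
Lemma poly_expR_step (y z e : R) : 0 < y -> y < z -> 0 < e ->
  exists2 lam : R, 0 <= lam & exists p : {poly R}, forall t, 0 <= t ->
    [/\ 0 <= p.[expR (- (lam * t))] <= 1,
        t <= y -> 1 - e <= p.[expR (- (lam * t))] &
        z < t -> p.[expR (- (lam * t))] <= e].
Proof.
move=> y0 yz e0; set x := (y + z) / 2; have x0 : 0 < x by rewrite /x; lra.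
have yx : y < x by rewrite /x; lra.
have xz : x < z by rewrite /x; lra.
have l2 : 0 < ln 2 :> R by rewrite ln_gt0// ltr1n.
set lam := ln 2 / x; have lam0 : 0 < lam by rewrite divr_gt0.
have lamx : lam * x = ln 2 by rewrite /lam divfK// gt_eqF.
set rho := expR (lam * (y - x)); set sig := expR (lam * (x - z)).
have small s : 0 < s < 1 -> \forall n \near \oo, s ^+ n <= e.
  move=> /andP[s0 s1].
  have /cvgrPdist_le/(_ _ e0) : s ^+ n @[n --> \oo] --> (0 : R).
    by apply: cvg_expr; rewrite ger0_norm ?ltW.
  apply: filterS => n; rewrite sub0r normrN ger0_norm// exprn_ge0 ?ltW//.
have [N [rN sN]] : exists N, rho ^+ N <= e /\ sig ^+ N <= e.
  near \oo => N; exists N; split; near: N; apply: small; rewrite expR_gt0/=.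
    by rewrite -expR0 ltr_expR nmulr_llt0 ?subr_lt0.
  by rewrite -expR0 ltr_expR nmulr_llt0 ?subr_lt0.
exists lam; first exact: ltW.
exists (1 - (1 - 'X^N) ^+ (2 ^ N)) => t t0.
set Y := expR _; have Y0 : 0 <= Y by exact: expR_ge0.
have Y1 : Y <= 1 by rewrite -expR0 ler_expR oppr_le0 mulr_ge0// ltW.
have YN : 0 <= Y ^+ N <= 1 by rewrite exprn_ge0//= exprn_ile1.
rewrite !hornerE.
have Q0 : 0 <= (1 - Y ^+ N) ^+ (2 ^ N).
  by rewrite exprn_ge0// subr_ge0; case/andP: YN.
have Q1 : (1 - Y ^+ N) ^+ (2 ^ N) <= 1.
  by apply: exprn_ile1; [rewrite subr_ge0|rewrite gerBl]; case/andP: YN.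
have E2 : 2 = expR (ln 2) :> R by rewrite lnK// posrE.
have EN : (2 ^ N)%:R * Y ^+ N = (2 * Y) ^+ N by rewrite natrX exprMn.
have E2Y : 2 * Y = expR (lam * (x - t)).
  by rewrite {1}E2 -expRD; congr expR; rewrite mulrBr lamx.
split.
- by rewrite subr_ge0 Q1/= gerBl.
- move=> ty; rewrite lerB//.
  apply: le_trans rN.
  have := expr_1B_le (2 ^ N) YN; rewrite EN E2Y => H.
  have rE : rho ^+ N * expR (lam * (x - y)) ^+ N = 1.
    by rewrite -exprMn -expRD -mulrDr [_ + _](_ : _ = 0) ?mulr0 ?expR0 ?expr1n//; ring.
  have P : 0 < expR (lam * (x - y)) ^+ N by rewrite exprn_gt0// expR_gt0.
  rewrite -(ler_pM2r P) rE; apply: le_trans H; rewrite ler_wpM2l//.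
  apply: le_trans (_ : expR (lam * (x - t)) ^+ N <= _); last by rewrite lerDr.
  by rewrite lerXn2r ?nnegrE ?expR_ge0// ler_expR ler_wpM2l ?(ltW lam0)// lerB.
- move=> zt; rewrite lerBlDr addrC -lerBlDr.
  apply: le_trans (bernoulli_inequality (2 ^ N) YN).
  rewrite EN E2Y lerB//; apply: le_trans sN.
  by rewrite lerXn2r ?nnegrE ?expR_ge0// ler_expR ler_wpM2l ?(ltW lam0)// lerB// ltW.
Unshelve. all: by end_near. Qed.

Lemma integrable_chi2_kernelM k (f : R -> R) : (0 < k)%N ->
  measurable_fun `](0:R), +oo[ f -> (forall t, 0 < t -> `|f t| <= 1) ->
  leb.-integrable `](0:R), +oo[ (EFin \o (fun t => f t * chi2_kernel k t)).
Proof.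
move=> k0 mf f1; apply: le_integrable (integrable_chi2_kernel k0) => //.
  by apply/measurable_EFinP; apply: measurable_funM => //; exact: measurable_chi2_kernel.
move=> t /=; rewrite in_itv/= andbT => t0; rewrite lee_fin normrM.
by rewrite ler_piMl// f1.
Qed.

Lemma measurable_horner_expR (p : {poly R}) lam (D : set R) : measurable D ->
  measurable_fun D (fun t => p.[expR (- (lam * t))]).
Proof.
move=> mD; apply: measurable_funTS; apply: continuous_measurable_fun => x.
apply: (@continuous_comp _ _ _ (fun t : R => expR (- (lam * t))) (horner p));
  last exact: continuous_horner.
have := @expR_scale_continuous (- lam) x.
rewrite (_ : (fun t => expR _) = (fun t => expR (- (lam * t))))//.
by apply/funext => t; rewrite mulNr.
Qed.

Lemma chi2_laplace k lam : (0 < k)%N -> 0 <= lam ->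
  \int[leb]_(t in `]0, +oo[) (expR (- (lam * t)) * chi2_kernel k t) =
  (1 + 2 * lam) `^ (- (k%:R / 2)) * chi2_mass k.
Proof.
move=> k0 lam0; rewrite /Rintegral; under eq_integral do rewrite mulrC.
rewrite chi2_laplace_ereal// fineM// ?fin_num_fine//.
by apply: integrable_fin_num (integrable_chi2_kernel k0).
Qed.

(** The i-th power of e^(-lam t) is the Laplace kernel at i lam, so a polynomial in it integrates to
    a combination of known Laplace values. *)
Lemma chi2_horner k lam (p : {poly R}) : (0 < k)%N -> 0 <= lam ->
  \int[leb]_(t in `]0, +oo[) (p.[expR (- (lam * t))] * chi2_kernel k t) =
  (\sum_(i < size p) p`_i * (1 + 2 * (i%:R * lam)) `^ (- (k%:R / 2))) * chi2_mass k.
Proof.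
move=> k0 lam0.
pose g (i : nat) t := expR (- (i%:R * lam * t)) * chi2_kernel k t.
have ilam0 (i : nat) : 0 <= i%:R * lam by rewrite mulr_ge0.
have ig i : leb.-integrable `](0:R), +oo[ (EFin \o g i).
  apply: integrable_chi2_kernelM => //.
    apply: (eq_measurable_fun (fun t : R => 'X.[expR (- (i%:R * lam * t))])).
      by move=> t _; rewrite hornerX.
    exact: measurable_horner_expR.
  move=> t t0; rewrite ger0_norm ?expR_ge0// -[leRHS]expR0 ler_expR oppr_le0.
  by rewrite mulr_ge0// ltW.
have iZ (i : 'I_(size p)) : leb.-integrable `](0:R), +oo[ (EFin \o (fun t => p`_i * g i t)).
  exact: integrableZl (ig i).
rewrite {1}/Rintegral.
have -> : (\int[leb]_(t in `]0%R, +oo[) (p.[expR (- (lam * t))] * chi2_kernel k t)%:E =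
    \int[leb]_(t in `]0%R, +oo[) (\sum_(i < size p) (p`_i * g i t)%:E))%E.
  apply: eq_integral => t _; rewrite sumEFin horner_coef mulr_suml; congr EFin.
  apply: eq_bigr => i _; by rewrite /g -expRM_natl mulrN !mulrA.
rewrite integral_sum//.
have -> : (\sum_(i < size p) \int[leb]_(t in `]0%R, +oo[) (p`_i * g i t)%:E =
   (\sum_(i < size p) p`_i * ((1 + 2 * (i%:R * lam)) `^ (- (k%:R / 2)) * chi2_mass k))%:E)%E.
  rewrite -sumEFin; apply: eq_bigr => i _.
  rewrite -chi2_laplace// -RintegralZl//; last exact: ig.
  rewrite /Rintegral fineK//; exact: integrable_fin_num (iZ i).
by rewrite /= mulr_suml; apply: eq_bigr => i _; exact: mulrA.
Qed.

Lemma chi2_cdf_poly_bounds k lam (p : {poly R}) (y z e : R) : (0 < k)%N ->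
  0 < y -> y < z -> 0 < e ->
  (forall t, 0 <= t ->
    [/\ 0 <= p.[expR (- (lam * t))] <= 1,
        t <= y -> 1 - e <= p.[expR (- (lam * t))] &
        z < t -> p.[expR (- (lam * t))] <= e]) ->
  chi2_cdf k y - e <=
    (\int[leb]_(t in `]0, +oo[) (p.[expR (- (lam * t))] * chi2_kernel k t)) / chi2_mass k
  <= chi2_cdf k z + e.
Proof.
move=> k0 y0 yz e0 Hp; have M0 := chi2_mass_gt0 k0.
set I := Rintegral _ _ _.
have ik D : measurable D -> D `<=` `](0:R), +oo[ ->
    leb.-integrable D (EFin \o chi2_kernel k).
  by move=> mD sD; apply: integrableS (integrable_chi2_kernel k0).
have iq : leb.-integrable `](0:R), +oo[
    (EFin \o (fun t => p.[expR (- (lam * t))] * chi2_kernel k t)).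
  apply: integrable_chi2_kernelM => //; first exact: measurable_horner_expR.
  by move=> t /ltW /Hp[/andP[p0 p1] _ _]; rewrite ger0_norm.
have iqD D : measurable D -> D `<=` `](0:R), +oo[ ->
    leb.-integrable D (EFin \o (fun t => p.[expR (- (lam * t))] * chi2_kernel k t)).
  by move=> mD sD; apply: integrableS iq.
have spl (f : R -> R) c : 0 < c -> leb.-integrable `](0:R), +oo[ (EFin \o f) ->
    \int[leb]_(t in `]0, +oo[) f t =
    \int[leb]_(t in `]0, c]) f t + \int[leb]_(t in `]c, +oo[) f t.
  move=> c0 If.
  have E : `](0:R), +oo[%classic = (`]0, c] `|` `]c, +oo[)%classic.
    by rewrite -itv_bndbnd_setU// !bnd_simp// ltW.
  rewrite E in If *; rewrite Rintegral_setU//.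
  apply/disj_setPS => t /= []; rewrite !in_itv/= andbT => /andP[_ t1] t1'.
  by move: (le_lt_trans t1 t1'); rewrite ltxx.
have s1 c : `]0, c] `<=` `](0:R), +oo[.
  by move=> t /=; rewrite !in_itv/= andbT => /andP[].
have s2 c : 0 < c -> `]c, +oo[ `<=` `](0:R), +oo[.
  by move=> c0 t /=; rewrite !in_itv/= !andbT; exact: lt_trans.
have cdf c : 0 < c ->
    chi2_cdf k c = \int[leb]_(t in `]0, c]) chi2_kernel k t / chi2_mass k.
  by move=> c0; rewrite /chi2_cdf leNgt c0.
have z0 : 0 < z by lra.
have massE c : 0 < c -> chi2_mass k =
    \int[leb]_(t in `]0, c]) chi2_kernel k t + \int[leb]_(t in `]c, +oo[) chi2_kernel k t.
  by move=> c0; rewrite /chi2_mass (spl _ c c0)//; exact: integrable_chi2_kernel.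
have ge0 D : 0 <= \int[leb]_(t in D) chi2_kernel k t.
  by apply: Rintegral_ge0 => t _; exact: chi2_kernel_ge0.
apply/andP; split.
- rewrite lerBlDr cdf// ler_pdivrMr// mulrDl divfK ?gt_eqF//.
  rewrite /I (spl _ y y0)//.
  have : (1 - e) * \int[leb]_(t in `]0, y]) chi2_kernel k t <=
      \int[leb]_(t in `]0, y]) (p.[expR (- (lam * t))] * chi2_kernel k t).
    rewrite -RintegralZl//; last exact: ik.
    apply: le_Rintegral => //.
    + exact: (integrableZl _ (1 - e) (ik _ _ _)).
    + exact: iqD.
    + move=> t /=; rewrite in_itv/= => /andP[t0 ty].
      have [_ /(_ ty) H _] := Hp t (ltW t0).
      by rewrite ler_wpM2r// chi2_kernel_ge0.
  have : 0 <= \int[leb]_(t in `]y, +oo[) (p.[expR (- (lam * t))] * chi2_kernel k t).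
    apply: Rintegral_ge0 => t /=; rewrite in_itv/= andbT => ty.
    have [/andP[H _] _ _] := Hp t (ltW (lt_trans y0 ty)).
    by rewrite mulr_ge0// chi2_kernel_ge0.
  have := mulr_ge0 (ltW e0) (ge0 `]y, +oo[%classic).
  rewrite (massE y y0) mulrBl mul1r mulrDr.
  by do ![move: (Rintegral _ _ _) => ?]; lra.
- rewrite ler_pdivrMr// mulrDl cdf// divfK ?gt_eqF//.
  rewrite /I (spl _ z z0)//.
  have : \int[leb]_(t in `]0, z]) (p.[expR (- (lam * t))] * chi2_kernel k t) <=
         \int[leb]_(t in `]0, z]) chi2_kernel k t.
    apply: le_Rintegral => //; [exact: iqD|exact: ik|].
    move=> t /=; rewrite in_itv/= => /andP[t0 ty].
    have [/andP[_ H] _ _] := Hp t (ltW t0).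
    by rewrite ler_piMl// chi2_kernel_ge0.
  have : \int[leb]_(t in `]z, +oo[) (p.[expR (- (lam * t))] * chi2_kernel k t) <=
         e * \int[leb]_(t in `]z, +oo[) chi2_kernel k t.
    rewrite -RintegralZl//; last by apply: ik => //; exact: s2.
    apply: le_Rintegral => //.
    + by apply: iqD => //; exact: s2.
    + exact: (integrableZl _ e (ik _ _ (s2 _ z0))).
    + move=> t /=; rewrite in_itv/= andbT => ty.
      have [_ _ /(_ ty) H] := Hp t (ltW (lt_trans z0 ty)).
      by rewrite ler_wpM2r// chi2_kernel_ge0.
  have := mulr_ge0 (ltW e0) (ge0 `]0, z]%classic).
  rewrite (massE z z0) mulrDr.
  by do ![move: (Rintegral _ _ _) => ?]; lra.
Qed.

Lemma cvgr_sum (T : Type) (F : set_system T) (FF : Filter F) (J : Type) (r : seq J)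
    (P : pred J) (f : J -> T -> R) (l : J -> R) :
  (forall j, P j -> f j x @[x --> F] --> l j) ->
  \sum_(j <- r | P j) f j x @[x --> F] --> \sum_(j <- r | P j) l j.
Proof.
move=> fl; elim: r => [|j r IH].
  by rewrite big_nil; under eq_fun do rewrite big_nil; exact: cvg_cst.
rewrite big_cons; under eq_fun do rewrite big_cons.
by case: ifP => // Pj; apply: cvgD => //; exact: fl.
Qed.

(** Convergence of Laplace transforms passes to polynomials in e^(-lam t), some of which are nearly
    indicators. Their transition zone lies in [y, z], hence the two thresholds; continuity of the
    chi-square CDF merges them later. *)
Lemma laplace_chi2_portmanteau k (I : nat -> finType) (w Y : forall n, I n -> R) :
  (0 < k)%N -> (forall n i, 0 <= w n i) -> (forall n, \sum_i w n i = 1) ->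
  (forall n i, 0 <= Y n i) ->
  (forall lam, 0 <= lam -> (\sum_i w n i * expR (- (lam * Y n i))) @[n --> \oo] -->
     ((1 + 2 * lam) `^ (- (k%:R / 2)) : R)) ->
  forall y z e : R, 0 < y -> y < z -> 0 < e -> \forall n \near \oo,
    \sum_(i | Y n i <= y) w n i <= chi2_cdf k z + e /\
    chi2_cdf k y - e <= \sum_(i | Y n i <= z) w n i.
Proof.
move=> k0 w0 w1 Y0 L y z e y0 yz e0.
(* One third each for the polynomial against the chi-square law, for the polynomial under the
   weights [w], and for the convergence in [n]. *)
have e3 : 0 < e / 3 by rewrite divr_gt0.
have [lam lam0 [p Hp]] := poly_expR_step y0 yz e3.
have M0 := chi2_mass_gt0 k0.
have /andP[B1 B2] := chi2_cdf_poly_bounds k0 y0 yz e3 Hp.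
pose Ep n := \sum_i w n i * p.[expR (- (lam * Y n i))].
have CE : Ep n @[n --> \oo] -->
    (\sum_(i < size p) p`_i * (1 + 2 * (i%:R * lam)) `^ (- (k%:R / 2)) : R).
  have -> : Ep = (fun n => \sum_(j < size p) p`_j *
      \sum_i w n i * expR (- (j%:R * lam * Y n i))).
    apply/funext => n; under eq_bigr do rewrite mulr_sumr.
    rewrite exchange_big/=; apply: eq_bigr => i _.
    rewrite horner_coef mulr_sumr; apply: eq_bigr => j _.
    by rewrite mulrCA -expRM_natl mulrN [in LHS](mulrA j%:R).
  apply: cvgr_sum => j _; apply: cvgM; first exact: cvg_cst.
  by apply: L; rewrite mulr_ge0.
move: B1 B2; rewrite chi2_horner// mulfK ?gt_eqF// => B1 B2.
near=> n.
have near_n : `|(\sum_(i < size p) p`_i * (1 + 2 * (i%:R * lam)) `^ (- (k%:R / 2)) : R)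
    - Ep n| <= e / 3.
  by near: n; move/cvgrPdist_le : CE; apply.
move: near_n B1 B2; set P := \sum_(i < size p) _.
rewrite ler_norml => /andP[N1 N2] B1 B2.
have ie : \sum_i w n i * (e / 3) = e / 3 by rewrite -mulr_suml w1 mul1r.
have split_sum c (f : I n -> R) : \sum_i f i =
  \sum_(i | Y n i <= c) f i + \sum_(i | ~~ (Y n i <= c)) f i.
  exact: (bigID (fun i => Y n i <= c)).
split.
- have : \sum_(i | Y n i <= y) w n i - e / 3 <= Ep n; last by lra.
  rewrite -ie -sumrN (split_sum y (fun i => - (w n i * _))) /Ep (split_sum y).
  rewrite addrA -big_split/=; apply: lerD; apply: ler_sum => i Hi.
    have [_ /(_ Hi) H _] := Hp _ (Y0 n i).
    by rewrite -[X in X - _]mulr1 -mulrBr ler_wpM2l.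
  have [/andP[H _] _ _] := Hp _ (Y0 n i).
  by apply: (@le_trans _ _ 0); [rewrite oppr_le0 mulr_ge0// ltW|rewrite mulr_ge0].
- have : Ep n <= \sum_(i | Y n i <= z) w n i + e / 3; last by lra.
  rewrite -ie (split_sum z (fun i => w n i * (e/3))) /Ep (split_sum z).
  rewrite addrA -big_split/=; apply: lerD; apply: ler_sum => i Hi.
    have [/andP[_ H] _ _] := Hp _ (Y0 n i).
    apply: (@le_trans _ _ (w n i)); first by rewrite ler_piMr.
    by rewrite lerDl mulr_ge0// ltW.
  have [_ _ H] := Hp _ (Y0 n i).
  by rewrite ler_wpM2l// H// ltNge.
Unshelve. all: by end_near. Qed.
End ChiSquare.

(** * The log-partition function *)

Section LogisticCalculus.
Context {R : realType}.
Implicit Types s t c K e : R.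

Definition logpart s : R := ln (1 + expR s).
(** The variance of an edge, which is also the derivative of [mu]; as an inverse of [bterm] it is at
    once bounded below by the inverse of [b_n]. *)
Definition edgevar s : R := (bterm s)^-1.
(** The Bregman divergence of the log-partition function: the contribution of one edge to the gap
    between the log-likelihood and its tangent. *)
Definition bregman s t : R := logpart (s + t) - logpart s - mu s * t.

Lemma bterm_gt0 s : 0 < bterm s.
Proof. by rewrite divr_gt0 ?exprn_gt0 ?addr_gt0 ?expR_gt0. Qed.

Lemma bterm_ge4 s : 4 <= bterm s.
Proof.
rewrite /bterm ler_pdivlMr ?expR_gt0// -subr_ge0.
by rewrite (_ : _ - _ = (1 - expR s) ^+ 2) ?sqr_ge0//; ring.
Qed.

Lemma edgevar_gt0 s : 0 < edgevar s.
Proof. by rewrite invr_gt0 bterm_gt0. Qed.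

Lemma edgevar_le s : edgevar s <= 4^-1.
Proof. by rewrite lef_pV2 ?posrE ?bterm_gt0// bterm_ge4. Qed.

Lemma edgevarE s : edgevar s = mu s * (1 - mu s).
Proof.
have E := expR_gt0 s; have E1 : 0 < 1 + expR s by rewrite addr_gt0.
by rewrite /edgevar /bterm /mu; field; rewrite !gt_eqF.
Qed.

Lemma mu_gt0 s : 0 < mu s.
Proof. by rewrite divr_gt0 ?addr_gt0 ?expR_gt0. Qed.

Lemma mu_lt1 s : mu s < 1.
Proof. by rewrite ltr_pdivrMr ?addr_gt0 ?expR_gt0// mul1r ltrDr. Qed.

(** The logarithmic derivative of [edgevar] is 1 - 2 mu, of modulus at most 1. This makes Hessians
    at nearby points comparable up to a factor, however small the variance. *)
Lemma edgevar_ler s t : edgevar (s + t) <= expR `|t| * edgevar s.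
Proof.
rewrite /edgevar /bterm !invf_div expRD.
have a0 := expR_gt0 s; have b0 := expR_gt0 t.
have a1 : 0 < 1 + expR s by rewrite addr_gt0.
have ab1 : 0 < 1 + expR s * expR t by rewrite addr_gt0// mulr_gt0.
suff key : expR t * (1 + expR s) ^+ 2 <= expR `|t| * (1 + expR s * expR t) ^+ 2.
  rewrite ler_pdivrMr ?exprn_gt0// -(ler_pM2r (exprn_gt0 2 a1)).
  rewrite [leRHS](_ : _ = expR s * (expR `|t| * (1 + expR s * expR t) ^+ 2)).
    by rewrite -mulrA ler_pM2l.
  by field; rewrite gt_eqF.
have [t0|t0] := leP 0 t.
  rewrite ger0_norm// ler_pM2l// lerXn2r ?nnegrE ?(ltW a1) ?(ltW ab1)//.
  have t1 : 1 <= expR t by rewrite -expR0 ler_expR.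
  by rewrite lerD2l ler_peMr// ltW.
have tE : expR t * expR (- t) = 1 by rewrite -expRD subrr expR0.
rewrite ltr0_norm// -(ler_pM2l b0) [leLHS]mulrA [leRHS]mulrA tE mul1r -expr2 -exprMn.
rewrite lerXn2r ?nnegrE ?mulr_ge0 ?(ltW a1) ?(ltW ab1) ?(ltW b0)//.
have t1 : expR t < 1 by rewrite -expR0 ltr_expR.
by rewrite mulrDr mulr1 mulrC lerD2r ltW.
Qed.

Lemma edgevar_ball s0 s e : `|s - s0| <= e ->
  expR (- e) * edgevar s0 <= edgevar s <= expR e * edgevar s0.
Proof.
move=> H; apply/andP; split; last first.
  have := edgevar_ler s0 (s - s0); rewrite addrC subrK => /le_trans; apply.
  by rewrite ler_wpM2r ?ler_expR// ltW ?edgevar_gt0.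
have := edgevar_ler s (s0 - s); rewrite addrC subrK => H1.
rewrite expRN ler_pdivrMl ?expR_gt0//; apply: le_trans H1 _.
by rewrite ler_wpM2r ?ler_expR 1?distrC// ltW ?edgevar_gt0.
Qed.

Lemma is_derive_logpart s : is_derive s 1 logpart (mu s).
Proof.
have E1 : 0 < 1 + expR s by rewrite addr_gt0 ?expR_gt0.
have := is_derive1_ln E1 => dln.
have : is_derive s (1:R) (fun s => 1 + expR s) (expR s).
  by apply: is_derive_eq; rewrite add0r mul1r.
move=> de; have := @is_derive1_comp R (@ln R) (fun s => 1 + expR s) s _ _ dln de.
by rewrite mulrC.
Qed.

Lemma is_derive_mu s : is_derive s 1 (@mu R) (edgevar s).
Proof.
have E1 : 0 < 1 + expR s by rewrite addr_gt0 ?expR_gt0.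
have : is_derive s (1:R) (fun s => 1 + expR s) (expR s).
  by apply: is_derive_eq; rewrite add0r mul1r.
move=> de; have dV := @is_deriveV R (fun s => 1 + expR s) s _ _ (negbT (gt_eqF E1)) de.
have := is_deriveM (is_derive_expR s) dV.
move=> H; apply: (is_derive_eq H); rewrite /GRing.scale/= /edgevar /bterm.
by field; rewrite !gt_eqF ?expR_gt0.
Qed.

Lemma is_derive_affine (f df : R -> R) s t c :
  is_derive (s + c * t) 1 f (df (s + c * t)) ->
  is_derive c 1 (fun x => f (s + x * t)) (df (s + c * t) * t).
Proof.
move=> H; apply: (@is_derive1_comp R f (fun x => s + x * t)).
by apply: is_derive_eq; rewrite /GRing.scale/=; ring.
Qed.

Lemma derive_segment_continuous (f df : R -> R) (A : set R) :
  (forall x : R, is_derive x 1 f (df x)) -> {within A, continuous f}.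
Proof.
move=> D; apply: continuous_subspaceT => x.
by apply/differentiable_continuous/derivable1_diffP; case: (D x).
Qed.

Lemma mu_MVT s t : exists2 c, 0 <= c <= 1 & mu (s + t) - mu s = edgevar (s + c * t) * t.
Proof.
have D c := is_derive_affine (df := edgevar) (t := t) (s := s) (is_derive_mu (s + c * t)).
have [c] := @MVT R _ _ 0 1 ltr01 (fun x _ => D x) (@derive_segment_continuous _ _ _ D).
rewrite in_itv/= => /andP[/ltW c0 /ltW c1].
by rewrite mul1r mul0r addr0 subr0 mulr1 => E; exists c; rewrite ?c0.
Qed.

(** Two mean value steps. Subtracting K t^2 / 2 with [K] free reduces upper and lower bounds on
    [bregman] to the sign of [edgevar - K]; of the unknown factor [c] only the sign matters. *)
Lemma bregman_MVT s t K : exists2 c, 0 <= c <= 1 & exists2 d, 0 <= d <= 1 &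
  bregman s t - K * t ^+ 2 / 2 = c * (edgevar (s + d * t) - K) * t ^+ 2.
Proof.
pose f x := logpart (s + x * t) - mu s * (x * t) - K * (x * t) ^+ 2 / 2.
have Df (x : R) : is_derive x 1 f (mu (s + x * t) * t - mu s * t - K * x * t ^+ 2).
  have D := is_derive_affine (df := @mu R) (t := t) (s := s) (is_derive_logpart (s + x * t)).
  apply: is_derive_eq; rewrite /GRing.scale/=; by field.
have [c] := @MVT R _ _ 0 1 ltr01 (fun x _ => Df x) (@derive_segment_continuous _ _ _ Df).
rewrite in_itv/= => /andP[/ltW c0 /ltW c1] E.
have [d /andP[d0 d1] Ed] := mu_MVT s (c * t).
exists c; first by rewrite c0. exists (d * c).
  by rewrite mulr_ge0//= mulr_ile1.
transitivity (f 1 - f 0); first by rewrite /f /bregman !mul1r !mul0r addr0; ring.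
by rewrite E -mulrBl Ed [d * (c * t)]mulrA; ring.
Qed.

Lemma convex_ball (s0 s t e c : R) : 0 <= c <= 1 -> `|s - s0| <= e -> `|s + t - s0| <= e ->
  `|s + c * t - s0| <= e.
Proof.
move=> /andP[c0 c1]; rewrite !ler_norml => /andP[a1 a2] /andP[b1 b2].
apply/andP; split; nra.
Qed.

Lemma mu_ball s0 s t e : `|s - s0| <= e -> `|s + t - s0| <= e ->
  exists2 c, expR (- e) * edgevar s0 <= c <= expR e * edgevar s0 &
    mu (s + t) - mu s = c * t.
Proof.
move=> H1 H2; have [c c01 ->] := mu_MVT s t.
by exists (edgevar (s + c * t)) => //; apply: edgevar_ball; exact: convex_ball.
Qed.

Lemma bregman_ball s0 s t e : `|s - s0| <= e -> `|s + t - s0| <= e ->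
  expR (- e) * edgevar s0 * t ^+ 2 / 2 <= bregman s t <= expR e * edgevar s0 * t ^+ 2 / 2.
Proof.
move=> H1 H2; have B d : 0 <= d <= 1 ->
    expR (- e) * edgevar s0 <= edgevar (s + d * t) <= expR e * edgevar s0.
  by move=> d01; apply: edgevar_ball; exact: convex_ball.
apply/andP; split.
  have [c /andP[c0 _] [d /B/andP[d1 _] E]] := bregman_MVT s t (expR (- e) * edgevar s0).
  by rewrite -subr_ge0 E mulr_ge0 ?sqr_ge0// mulr_ge0// subr_ge0.
have [c /andP[c0 _] [d /B/andP[_ d1] E]] := bregman_MVT s t (expR e * edgevar s0).
by rewrite -subr_le0 E mulr_le0_ge0 ?sqr_ge0// mulr_ge0_le0// subr_le0.
Qed.

Lemma bregman_ge0 s t : 0 <= bregman s t.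
Proof.
have [c /andP[c0 _] [d _ E]] := bregman_MVT s t 0.
by move: E; rewrite !mul0r !subr0 => ->; rewrite mulr_ge0 ?sqr_ge0// mulr_ge0// ltW ?edgevar_gt0.
Qed.

Lemma bregman_le s t : bregman s t <= t ^+ 2 / 8.
Proof.
have [c /andP[c0 _] [d _ E]] := bregman_MVT s t (4^-1).
rewrite (_ : t ^+ 2 / 8 = 4^-1 * t ^+ 2 / 2); last by field.
by rewrite -subr_le0 E mulr_le0_ge0 ?sqr_ge0// mulr_ge0_le0// subr_le0 edgevar_le.
Qed.

Lemma expR_sub1_le e : 0 <= e <= 2^-1 -> expR e - 1 <= 2 * e.
Proof.
move=> /andP[e0 e1]; have := expR_ge1Dx (- e); rewrite expRN => H.
have E := expR_gt0 e.
have : (1 - e) * expR e <= 1 by rewrite -ler_pdivlMr// div1r.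
nra.
Qed.

(** The slope of [mu] on the segment is within a factor e^(|t|) of [edgevar s], which is at most
    1/4, and e^(|t|) - 1 <= 2 |t|. *)
Lemma mu_taylor s t : `|t| <= 2^-1 -> `|mu (s + t) - mu s - edgevar s * t| <= t ^+ 2 / 2.
Proof.
move=> t1; have H1 : `|s - s| <= `|t| by rewrite subrr normr0.
have H2 : `|s + t - s| <= `|t| by rewrite addrAC subrr add0r.
have [c /andP[c1 c2] ->] := mu_ball H1 H2.
rewrite -mulrBl normrM -real_normK ?num_real// expr2 mulrAC ler_wpM2r//.
have tb : 0 <= `|t| <= 2^-1 by rewrite normr_ge0.
have B1 := expR_sub1_le tb; have B2 := expR_ge1Dx (- `|t|).
have v0 := edgevar_gt0 s; have v4 := edgevar_le s.
rewrite ler_norml; apply/andP; split; nra.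
Qed.

End LogisticCalculus.

(** * Edge sums and the score *)

Section EdgeSums.
Context {R : realType} {n : nat}.
Implicit Types (x y z g beta : 'I_n -> R) (A : graph n) (p : 'I_n * 'I_n).

Definition edge p : bool := (p.1 < p.2)%N.
Definition ends x p : R := x p.1 + x p.2.

Lemma sum_edge_sym (G : 'I_n -> 'I_n -> R) : (forall i j, G i j = G j i) ->
  (\sum_(p | edge p) G p.1 p.2) * 2 = \sum_i \sum_(j | j != i) G i j.
Proof.
move=> Gs.
have E : \sum_(p | edge p) G p.1 p.2 = \sum_(i < n) \sum_(j < n | (i < j)%N) G i j.
  by rewrite pair_big_dep/=; apply: eq_bigl => -[i j].
have E' : \sum_(p | edge p) G p.1 p.2 = \sum_(i < n) \sum_(j < n | (j < i)%N) G i j.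
  rewrite E (exchange_big_dep xpredT)//=; apply: eq_bigr => i _.
  by apply: eq_bigr => j _; rewrite Gs.
rewrite mulr_natr mulr2n {1}E E' -big_split/=; apply: eq_bigr => i _.
rewrite [RHS](bigID (fun j : 'I_n => (i < j)%N))/=; congr (_ + _).
  by apply: eq_bigl => j; rewrite -val_eqE/=; case: ltngtP.
by apply: eq_bigl => j; rewrite -val_eqE/=; case: ltngtP.
Qed.

(** Regrouping by endpoints: a linear form on edges becomes one on nodes, which is how degrees and
    residuals appear. *)
Lemma sum_edge_ends (c : 'I_n -> 'I_n -> R) x : (forall i j, c i j = c j i) ->
  \sum_(p | edge p) c p.1 p.2 * ends x p = \sum_i x i * \sum_(j | j != i) c i j.
Proof.
move=> cs; apply: (@mulIf R 2) => //.
rewrite (sum_edge_sym (G := fun i j => c i j * (x i + x j))); last first.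
  by move=> i j; rewrite cs addrC.
rewrite mulr_natr mulr2n.
have E1 : \sum_i x i * (\sum_(j | j != i) c i j) = \sum_i \sum_(j | j != i) c i j * x i.
  by apply: eq_bigr => i _; rewrite mulrC mulr_suml.
have E2 : \sum_i x i * (\sum_(j | j != i) c i j) = \sum_i \sum_(j | j != i) c i j * x j.
  rewrite E1 (exchange_big_dep xpredT)//=; apply: eq_bigr => i _.
  by apply: eq_big => [j|j _]; rewrite 1?eq_sym// cs.
rewrite {1}E1 E2 -big_split/=; apply: eq_bigr => i _.
by rewrite -big_split/=; apply: eq_bigr => j _; rewrite mulrDr.
Qed.

(** The signless Laplacian of the complete graph is (n - 2) I + J, with J the all-ones matrix; this
    is the origin of the n - 2 in later bounds. *)
Lemma sum_edge_endsM x y : \sum_(p | edge p) ends x p * ends y p =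
  (n%:R - 2) * (\sum_i x i * y i) + (\sum_i x i) * (\sum_i y i).
Proof.
rewrite (eq_bigr (fun p => (x p.1 + x p.2) * ends y p))//.
rewrite (sum_edge_ends (c := fun i j => x i + x j)); last by move=> i j; rewrite addrC.
have E i : \sum_(j | j != i) (x i + x j) = n%:R * x i + \sum_j x j - 2 * x i.
  have : \sum_j (x i + x j) = (x i + x i) + \sum_(j | j != i) (x i + x j).
    by rewrite (bigD1 i).
  by rewrite big_split/= sumr_const card_ord -[x i *+ n]mulr_natl => ->; ring.
under eq_bigr do rewrite E.
rewrite mulr_sumr mulr_sumr -big_split/=; apply: eq_bigr => i _; ring.
Qed.

(** The derivative of [loglik A] at [g] in the direction [z]. *)
Definition score A g z : R := \sum_(p | edge p) ((A p)%:R - mu (ends g p)) * ends z p.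
Definition residual A beta (i : 'I_n) : R :=
  \sum_(j | j != i) ((adj A i j)%:R - mu (beta i + beta j)).

Lemma adj_sym A i j : adj A i j = adj A j i.
Proof. by rewrite /adj; case: ltngtP. Qed.

Lemma score_residual A beta z : score A beta z = \sum_i z i * residual A beta i.
Proof.
rewrite -(sum_edge_ends (c := fun i j => (adj A i j)%:R - mu (beta i + beta j))).
  apply: eq_bigr => -[i j]; rewrite /edge/= => ij.
  by rewrite /adj /ends/= ij.
by move=> i j; rewrite adj_sym [beta i + _]addrC.
Qed.

Lemma loglikE A g :
  loglik A g = \sum_(p | edge p) ((A p)%:R * ends g p - logpart (ends g p)).
Proof.
rewrite /loglik sumrB; congr (_ - _); last first.
  by rewrite pair_big_dep/=; apply: eq_bigl => -[i j].
rewrite /degree -(sum_edge_ends (c := fun i j => (adj A i j : nat)%:R)).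
  by apply: eq_bigr => -[i j]; rewrite /edge/= => ij; rewrite /adj/= ij.
by move=> i j; rewrite adj_sym.
Qed.

Lemma endsD x y p : ends (fun i => x i + y i) p = ends x p + ends y p.
Proof. by rewrite /ends; ring. Qed.

Lemma endsZ a x p : ends (fun i => a * x i) p = a * ends x p.
Proof. by rewrite /ends; ring. Qed.

Lemma loglik_expand A g z : loglik A (fun i => g i + z i) =
  loglik A g + score A g z - \sum_(p | edge p) bregman (ends g p) (ends z p).
Proof.
rewrite !loglikE /score -big_split/= -sumrB; apply: eq_bigr => p _.
by rewrite endsD /bregman; ring.
Qed.

Lemma scoreZ A g a z : score A g (fun i => a * z i) = a * score A g z.
Proof. by rewrite /score mulr_sumr; apply: eq_bigr => p _; rewrite endsZ; ring. Qed.

Lemma scoreD A g y z : score A g (fun i => y i + z i) = score A g y + score A g z.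
Proof. by rewrite /score -big_split/=; apply: eq_bigr => p _; rewrite endsD; ring. Qed.

Lemma eq_score A g y z : y =1 z -> score A g y = score A g z.
Proof. by move=> E; apply: eq_bigr => p _; rewrite /ends !E. Qed.

Lemma sqr_sum_norm_le x : (\sum_i `|x i|) ^+ 2 <= n%:R * \sum_i x i ^+ 2.
Proof.
have H : 0 <= \sum_i \sum_j (`|x i| - `|x j|) ^+ 2.
  by apply: sumr_ge0 => i _; apply: sumr_ge0 => j _; exact: sqr_ge0.
suff E : \sum_i \sum_j (`|x i| - `|x j|) ^+ 2 =
    2 * (n%:R * \sum_i x i ^+ 2 - (\sum_i `|x i|) ^+ 2).
  by move: H; rewrite E pmulr_rge0// subr_ge0.
set Q := \sum_i x i ^+ 2; set S := \sum_i `|x i|.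
have E1 i : \sum_j (`|x i| - `|x j|) ^+ 2 = n%:R * x i ^+ 2 - 2 * `|x i| * S + Q.
  under eq_bigr do rewrite sqrrB !real_normK ?num_real//.
  rewrite !big_split/= sumr_const card_ord sumrN; congr (_ - _ + _).
    by rewrite mulr_natl.
  by rewrite mulr_sumr; apply: eq_bigr => j _; rewrite mulr2n; ring.
under eq_bigr do rewrite E1.
rewrite !big_split/= sumrN -mulr_sumr sumr_const card_ord -/Q -mulr_suml -mulr_sumr -/S.
by rewrite -mulr_natl; ring.
Qed.

End EdgeSums.

(** * Constrained maximizers *)

Section ConstrainedMaximizer.
Context {R : realType} {n : nat}.
Implicit Types (x y z g beta : 'I_n -> R) (A : graph n).

(** One format for both nulls. Any map fixing 0 can be applied coordinatewise inside such a space,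
    which a general linear subspace would not allow; thresholding depends on this. *)
Definition tied (E : rel 'I_n) (F : pred 'I_n) : set ('I_n -> R) :=
  [set x | (forall i j, E i j -> x i = x j) /\ (forall i, F i -> x i = 0)].

Lemma tied_comp E F (phi : R -> R) x : phi 0 = 0 -> tied E F x -> tied E F (phi \o x).
Proof.
move=> phi0 [xE xF]; split => [i j /xE|i /xF] /= ->//.
Qed.

Lemma tied_lin E F a x y : tied E F x -> tied E F y -> tied E F (fun i => x i + a * y i).
Proof.
move=> [xE xF] [yE yF]; split => [i j ij|i Fi].
  by rewrite (xE _ _ ij) (yE _ _ ij).
by rewrite xF// yF// mulr0 addr0.
Qed.

Lemma closed_tied E F : closed [set v : 'rV[R]_n | tied E F (v ord0)].
Proof.
have cc i : continuous (fun v : 'rV[R]_n => v ord0 i) by exact: coord_continuous.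
have -> : [set v : 'rV[R]_n | tied E F (v ord0)] =
    (\bigcap_(p in [set p | E p.1 p.2])
       (fun v : 'rV[R]_n => v ord0 p.1 - v ord0 p.2) @^-1` [set t | t = 0]) `&`
    (\bigcap_(i in [set i | F i]) (fun v : 'rV[R]_n => v ord0 i) @^-1` [set t | t = 0]).
  apply/seteqP; split => v /= [vE vF]; split.
  - by move=> [i j] /=; rewrite /preimage/= => /vE ->; rewrite subrr.
  - by move=> i /=; exact: vF.
  - by move=> i j /(vE (i, j)) /= /eqP; rewrite subr_eq0 => /eqP.
  - by move=> i /vF.
apply: closedI; apply: closed_bigI; [move=> [i j] _ /=|move=> i _ /=].
  have c : continuous (fun v : 'rV[R]_n => v ord0 i - v ord0 j).
    by move=> v; apply: (@continuousB _ _ _ _ _ _ (cc i v) (cc j v)).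
  by move/continuous_closedP : c; apply; exact: closed_eq.
by move/continuous_closedP : (cc i); apply; exact: closed_eq.
Qed.

Lemma logpart_continuous : continuous (@logpart R).
Proof.
move=> s; apply/differentiable_continuous/derivable1_diffP.
by case: (is_derive_logpart s).
Qed.

Lemma loglik_continuous A beta :
  continuous (fun v : 'rV[R]_n => loglik A (fun i => beta i + v ord0 i)).
Proof.
have -> : (fun v : 'rV[R]_n => loglik A (fun i => beta i + v ord0 i)) =
  (fun v : 'rV[R]_n => \sum_(p | edge p) ((A p)%:R * ends (fun i => beta i + v ord0 i) p
     - logpart (ends (fun i => beta i + v ord0 i) p))).
  by apply/funext => v; rewrite loglikE.
have cc i : continuous (fun v : 'rV[R]_n => v ord0 i) by exact: coord_continuous.
move=> v; apply: (@cvgr_sum R _ _ (nbhs_filter v)) => p _.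
have ci i : {for v, continuous (fun w : 'rV[R]_n => beta i + w ord0 i)}.
  by apply: continuousD; [exact: cst_continuous|exact: cc].
have c : {for v, continuous (fun w : 'rV[R]_n => ends (fun i => beta i + w ord0 i) p)}.
  by apply: continuousD; exact: ci.
apply: (@continuousB _ _ _ _ _ v); first by apply: continuousM => //; exact: cst_continuous.
by apply: (continuous_comp c); exact: logpart_continuous.
Qed.

(** Existence by compactness. The radius 1/2 keeps edge sums within 1 of their true value, so that
    edge variances change there by a factor at most e. *)
Lemma box_maximizer A beta E F : exists x, [/\ tied E F x, forall i, `|x i| <= 2^-1 &
  forall y, tied E F y -> (forall i, `|y i| <= 2^-1) ->
    loglik A (fun i => beta i + y i) <= loglik A (fun i => beta i + x i)].
Proof.
pose K := [set v : 'rV[R]_n | forall i, `[- 2^-1, 2^-1]%classic (v ord0 i)] `&`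
          [set v : 'rV[R]_n | tied E F (v ord0)].
have cK : compact K.
  apply: compact_closedI; last exact: closed_tied.
  have cbox := @rV_compact R n (fun=> `[(- 2^-1 : R), 2^-1]%classic)
    (fun i => @segment_compact R _ _).
  exact cbox.
have KE (v : 'rV[R]_n) : K v <-> (forall i, `|v ord0 i| <= 2^-1) /\ tied E F (v ord0).
  by split=> -[H ?]; split => // i; have := H i; rewrite /= in_itv/= -ler_norml.
have K0 : K !=set0.
  exists 0; apply/KE; split => [i|]; first by rewrite mxE normr0.
  by split => [i j|i] _; rewrite !mxE.
have cf : {within K, continuous (fun v : 'rV[R]_n => loglik A (fun i => beta i + v ord0 i))}.
  by apply: continuous_subspaceT; exact: loglik_continuous.
have [v /set_mem/KE[v1 v2] vmax] := compact_EVT_max K0 cK cf.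
exists (v ord0); split => // y yN yb.
have -> : (fun i => beta i + y i) = (fun i => beta i + (\row_i y i : 'rV[R]_n) ord0 i).
  by apply/funext => i; rewrite mxE.
apply: vmax; apply/mem_set/KE; split => [i|]; first by rewrite mxE.
by have -> : (\row_i y i : 'rV[R]_n) ord0 = y by apply/funext => i; rewrite mxE.
Qed.

End ConstrainedMaximizer.

Section ConstrainedMLE.
Context {R : realType} {n : nat} (A : graph n) (beta : 'I_n -> R).
Variables (E : rel 'I_n) (F : pred 'I_n).
Implicit Types (x y z g : 'I_n -> R).

(** A move by t towards [y] gains at least t times the score minus t^2 Q, as Bregman terms are at
    most quadratic; a maximizer leaves no room for a positive score. *)
Lemma score_box_le0 x y :
  tied E F x -> (forall i, `|x i| <= 2^-1) ->
  tied E F y -> (forall i, `|y i| <= 2^-1) ->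
  (forall y, tied E F y -> (forall i, `|y i| <= 2^-1) ->
    loglik A (fun i => beta i + y i) <= loglik A (fun i => beta i + x i)) ->
  score A (fun i => beta i + x i) (fun i => y i - x i) <= 0.
Proof.
move=> Nx xb Ny yb xmax; set g := fun i => _; set w := fun i => _.
pose Q := \sum_(p | edge p) ends w p ^+ 2 / 8.
have Q0 : 0 <= Q by apply: sumr_ge0 => p _; rewrite divr_ge0 ?sqr_ge0.
have key t : 0 < t <= 1 -> score A g w <= t * Q.
  move=> /andP[t0 t1].
  have H : loglik A (fun i => g i + t * w i) <= loglik A g.
    have -> : (fun i => g i + t * w i) = (fun i => beta i + (x i + t * w i)).
      by apply/funext => i; rewrite addrA.
    apply: xmax.
      have -> : (fun i => x i + t * w i) = (fun i => (1 - t) * x i + t * y i).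
        by apply/funext => i; rewrite /w; ring.
      apply: tied_lin => //; apply: (@tied_comp R n E F (fun s => (1 - t) * s)) => //.
      by rewrite mulr0.
    move=> i; have := xb i; have := yb i; rewrite /w !ler_norml => /andP[? ?] /andP[? ?].
    by apply/andP; split; nra.
  move: H; rewrite loglik_expand scoreZ -addrA gerDl subr_le0 => H.
  have : \sum_(p | edge p) bregman (ends g p) (ends (fun i => t * w i) p) <= t ^+ 2 * Q.
    rewrite mulr_sumr; apply: ler_sum => p _; rewrite endsZ.
    by apply: le_trans (bregman_le _ _) _; rewrite exprMn [leRHS]mulrA.
  by move/(le_trans H); rewrite expr2 -mulrA ler_pM2l.
rewrite leNgt; apply/negP => s0.
have Q1 : 0 < Q + 1 by rewrite ltr_wpDl.
set s := score A g w in s0 key.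
(* A step so short that t Q is at most s / 2; using Q + 1 avoids a division by 0. *)
have t0 : 0 < Num.min 1 (s / (2 * (Q + 1))).
  by rewrite lt_min ltr01/= divr_gt0// mulr_gt0.
have := key _; move=> /(_ (Num.min 1 (s / (2 * (Q + 1)))))/=.
rewrite t0 ge_min lexx/= => /(_ isT) H.
have : Num.min 1 (s / (2 * (Q + 1))) * Q <= s / 2.
  apply: (@le_trans _ _ (s / (2 * (Q + 1)) * Q)).
    by rewrite ler_wpM2r// ge_min lexx orbT.
  rewrite invfM mulrA -mulrA ler_piMr ?divr_ge0 ?(ltW s0)//.
  by rewrite mulrC ler_pdivrMr// mul1r lerDl.
lra.
Qed.

Variables (b Xi : R).
Hypothesis b_gt0 : 0 < b.
Hypothesis n_ge3 : (2 < n)%N.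
Hypothesis edgevar_ge : forall p, edge p -> b^-1 <= edgevar (ends beta p).
Hypothesis Xi_gt0 : 0 < Xi.
Hypothesis residual_le : forall i, `|residual A beta i| <= Xi.

(** For SR the l1 norm of the thresholded vector, the variational inequality gives kap (n - 2) tau
    SR <= (1 + 3) Xi SR: 1 from the residuals, 3 from the product of sums. The factor 5 contradicts
    this unless SR = 0; the factor e undoes the variance loss in [kap]. *)
Definition sup_radius : R := 5 * expR 1 * b * Xi / (n%:R - 2).

Let kap : R := expR (- 1) / b.

Let kap_gt0 : 0 < kap. Proof. by rewrite divr_gt0// expR_gt0. Qed.

Let n2_ge1 : 1 <= n%:R - 2 :> R.
Proof. by rewrite lerBrDr -(natrD R 1 2) ler_nat. Qed.

(* Tested against [rho \o x], the variational inequality bounds a sum over edges of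
   [c_e (x_i + x_j) (rho x_i + rho x_j)] with [c_e >= kap], whose terms are nonnegative. *)
Lemma coercive_bound x (rho : R -> R) :
  tied E F x -> (forall i, `|x i| <= 2^-1) ->
  (forall y, tied E F y -> (forall i, `|y i| <= 2^-1) ->
    loglik A (fun i => beta i + y i) <= loglik A (fun i => beta i + x i)) ->
  rho 0 = 0 -> (forall t, `|t - rho t| <= `|t|) ->
  (forall t u, 0 <= (t + u) * (rho t + rho u)) ->
  kap * ((n%:R - 2) * (\sum_i x i * rho (x i)) + (\sum_i x i) * (\sum_i rho (x i)))
    <= Xi * \sum_i `|rho (x i)|.
Proof.
move=> Nx xb xmax rho0 rhob rhom.
have S : 0 <= score A (fun i => beta i + x i) (rho \o x).
  have Ny : tied E F (fun i => x i - rho (x i)).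
    by apply: (@tied_comp R n E F (fun s => s - rho s)) => //; rewrite rho0 subr0.
  have yb i : `|x i - rho (x i)| <= 2^-1 by apply: le_trans (rhob _) (xb i).
  have := score_box_le0 Nx xb Ny yb xmax.
  rewrite (@eq_score _ _ _ _ _ (fun i => -1 * rho (x i))); last by move=> i; ring.
  by rewrite scoreZ mulN1r oppr_le0.
have -> : (n%:R - 2) * (\sum_i x i * rho (x i)) + (\sum_i x i) * (\sum_i rho (x i)) =
    \sum_(p | edge p) ends x p * ends (rho \o x) p by rewrite sum_edge_endsM.
apply: (@le_trans _ _ (score A beta (rho \o x))); last first.
  rewrite score_residual mulr_sumr; apply: ler_sum => i _.
  by apply: le_trans (ler_norm _) _; rewrite normrM mulrC ler_wpM2r.
rewrite -subr_ge0; apply: le_trans S _.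
rewrite /score mulr_sumr -sumrB; apply: ler_sum => p ep.
rewrite endsD; have xe : `|ends x p| <= 1.
  by apply: le_trans (ler_normD _ _) _; have := xb p.1; have := xb p.2; lra.
have H1 : `|ends beta p - ends beta p| <= 1 by rewrite subrr normr0.
have H2 : `|ends beta p + ends x p - ends beta p| <= 1 by rewrite addrAC subrr add0r.
have [c /andP[c1 _] cE] := mu_ball H1 H2.
have kc : kap <= c.
  by apply: le_trans c1; rewrite ler_wpM2l ?expR_ge0// edgevar_ge.
have := rhom (x p.1) (x p.2); rewrite -/(ends x p) -/(ends (rho \o x) p) => P.
rewrite (_ : mu _ = mu (ends beta p) + c * ends x p); last by rewrite -cE; ring.
have : 0 <= (c - kap) * (ends x p * ends (rho \o x) p) by rewrite mulr_ge0// subr_ge0.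
nra.
Qed.

(** Test with [rho = id], that is against the competitor 0, then Cauchy-Schwarz with n <= 3 (n - 2).
    This l1 bound later controls the product of sums, which has no sign after thresholding. *)
Lemma sum_norm_bound x :
  tied E F x -> (forall i, `|x i| <= 2^-1) ->
  (forall y, tied E F y -> (forall i, `|y i| <= 2^-1) ->
    loglik A (fun i => beta i + y i) <= loglik A (fun i => beta i + x i)) ->
  kap * \sum_i `|x i| <= 3 * Xi.
Proof.
move=> Nx xb xmax; set S := \sum_i `|x i|.
have S0 : 0 <= S by apply: sumr_ge0.
have H : kap * ((n%:R - 2) * (\sum_i x i * x i) + (\sum_i x i) * (\sum_i x i)) <= Xi * S.
  apply: (@coercive_bound x id) => //.
  - by move=> t; rewrite subrr normr0.
  - by move=> t u; rewrite -expr2 sqr_ge0.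
have CS := sqr_sum_norm_le x; rewrite -/S in CS.
have E2 : \sum_i x i * x i = \sum_i x i ^+ 2 by [].
rewrite E2 -expr2 in H; set Q := \sum_i x i ^+ 2 in CS H.
have T0 := sqr_ge0 (\sum_i x i).
have [S00|Spos] := eqVneq S 0; first by rewrite S00 mulr0 mulr_ge0 // ltW.
have {}Spos : 0 < S by rewrite lt_neqAle eq_sym Spos.
have n0 : 0 < n%:R :> R by rewrite ltr0n; apply: leq_trans n_ge3.
have n3 : n%:R <= 3 * (n%:R - 2) :> R.
  have : 3%:R <= n%:R :> R by rewrite ler_nat.
  lra.
rewrite -(ler_pM2r Spos) -(ler_pM2r (mulr_gt0 n0 ltr01)) mulr1.
have Q0 : 0 <= Q by apply: sumr_ge0 => i _; exact: sqr_ge0.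
have H' : kap * ((n%:R - 2) * Q) <= Xi * S.
  apply: le_trans H; rewrite ler_pM2l// lerDl//.
have A1 : kap * S * S * n%:R <= kap * (n%:R * Q) * n%:R.
  by rewrite ler_wpM2r ?(ltW n0)// -mulrA -expr2 ler_pM2l.
have A2 : kap * (n%:R * Q) * n%:R <= 3 * (kap * ((n%:R - 2) * Q)) * n%:R.
  rewrite ler_wpM2r ?(ltW n0)// [leRHS]mulrCA ler_pM2l// mulrA ler_wpM2r//.
apply: le_trans A1 _; apply: le_trans A2 _.
by rewrite ler_wpM2r ?(ltW n0)// -[leRHS]mulrA ler_pM2l.
Qed.

(** The subtracted term is [t] clipped to [- tau, tau], so the competitor [x - soft tau x] is the
    clipped maximizer. *)
Definition soft (tau t : R) : R := t - Num.max (- tau) (Num.min tau t).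

Lemma box_maximizer_sup x :
  tied E F x -> (forall i, `|x i| <= 2^-1) ->
  (forall y, tied E F y -> (forall i, `|y i| <= 2^-1) ->
    loglik A (fun i => beta i + y i) <= loglik A (fun i => beta i + x i)) ->
  forall i, `|x i| <= sup_radius.
Proof.
move=> Nx xb xmax; set tau := sup_radius.
have tau0 : 0 < tau.
  by rewrite divr_gt0 ?mulr_gt0 ?expR_gt0//; exact: lt_le_trans n2_ge1.
have tauE : kap * ((n%:R - 2) * tau) = 5 * Xi.
  rewrite /tau /sup_radius /kap expRN; field.
  by rewrite !gt_eqF ?expR_gt0//; exact: lt_le_trans n2_ge1.
have softE t : [\/ (t < - tau /\ soft tau t = t + tau), (tau < t /\ soft tau t = t - tau)
     | (- tau <= t <= tau /\ soft tau t = 0)].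
  rewrite /soft; have [tt|tt] := ltP tau t.
    by apply: Or32; split => //; rewrite max_r//; lra.
  have [tt'|tt'] := ltP t (- tau).
    by apply: Or31; split => //; rewrite opprK.
  by apply: Or33; split; [apply/andP; split|rewrite subrr].
have H := coercive_bound (rho := soft tau) Nx xb xmax.
have {}H : kap * ((n%:R - 2) * (\sum_i x i * soft tau (x i)) +
    (\sum_i x i) * (\sum_i soft tau (x i))) <= Xi * \sum_i `|soft tau (x i)|.
  apply: H.
  - by case: (softE 0) => -[H ->]//; lra.
  - move=> t; case: (softE t) => -[H ->]; rewrite ?subr0//.
      have t0 : t < 0 by lra.
      by rewrite (ltr0_norm t0) ler_norml; apply/andP; split; lra.
    have t0 : 0 < t by lra.
    by rewrite (gtr0_norm t0) ler_norml; apply/andP; split; lra.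
  - move=> t u; have sq := sqr_ge0 (t + u).
    case: (softE t) => -[H1 ->]; case: (softE u) => -[H2 ->];
      rewrite ?addr0 ?add0r ?mulr0//; move: H1 H2;
      try (by move=> H1 H2; nra); try (by move=> /andP[? ?] H2; nra);
      by move=> H2 /andP[? ?]; nra.
set SR := \sum_i `|soft tau (x i)| in H.
have SR0 : 0 <= SR by apply: sumr_ge0.
(* Where the thresholded value is nonzero, [x i] has its sign and modulus above [tau]. *)
have P1 : tau * SR <= \sum_i x i * soft tau (x i).
  rewrite mulr_sumr; apply: ler_sum => i _.
  case: (softE (x i)) => -[H1 ->]; last by rewrite normr0 !mulr0.
    by rewrite ltr0_norm; nra.
  by rewrite gtr0_norm; nra.
have P2 : - (3 * Xi * SR) <= kap * ((\sum_i x i) * (\sum_i soft tau (x i))).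
  rewrite lerNl -mulrN; apply: le_trans (ler_norm _) _.
  rewrite normrM (gtr0_norm kap_gt0) normrN normrM mulrA.
  apply: ler_pM => //; [by apply: mulr_ge0 => //; exact: ltW| |exact: ler_norm_sum].
  have SB := sum_norm_bound Nx xb xmax; apply: le_trans SB; rewrite ler_pM2l//.
  exact: ler_norm_sum.
have SR00 : SR = 0.
  apply/eqP; rewrite eq_le SR0 andbT -(ler_pM2l Xi_gt0) mulr0.
  have : kap * ((n%:R - 2) * (tau * SR)) <= kap * ((n%:R - 2) * \sum_i x i * soft tau (x i)).
    by rewrite ler_pM2l// ler_wpM2l// (le_trans ler01).
  by rewrite [(n%:R - 2) * (tau * SR)]mulrA mulrA tauE; nra.
move=> i; have /eqP : `|soft tau (x i)| = 0.
  apply/eqP; rewrite eq_le normr_ge0 andbT -SR00 /SR (bigD1 i)//= lerDl.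
  exact: sumr_ge0.
rewrite normr_eq0 => /eqP; rewrite ler_norml.
by case: (softE (x i)) => -[H1 ->]; lra.
Qed.

(** The box maximizer is then interior, so both [z] and its opposite are admissible directions and
    the variational inequality becomes an equality. *)
Lemma constrained_mle : sup_radius < 2^-1 ->
  exists x, [/\ tied E F x, forall i, `|x i| <= sup_radius &
    forall z, tied E F z -> score A (fun i => beta i + x i) z = 0].
Proof.
move=> tau2; have [x [Nx xb xmax]] := box_maximizer A beta E F.
have xs := box_maximizer_sup Nx xb xmax.
exists x; split => // z Nz.
suff H z' : tied E F z' -> score A (fun i => beta i + x i) z' <= 0.
  apply/eqP; rewrite eq_le H//=.
  have /H : tied E F (fun i => -1 * z i).
    by apply: (@tied_comp R n E F (fun s => -1 * s)) => //; rewrite mulr0.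
  by rewrite scoreZ mulN1r oppr_le0.
move=> Nz'; pose M := \sum_i `|z' i|.
have M0 : 0 <= M by apply: sumr_ge0.
pose t := (2^-1 - sup_radius) / (M + 1).
have t0 : 0 < t by rewrite divr_gt0 ?subr_gt0// ltr_wpDl.
have Ny : tied E F (fun i => x i + t * z' i) by exact: tied_lin.
have yb i : `|x i + t * z' i| <= 2^-1.
  apply: le_trans (ler_normD _ _) _; rewrite normrM (gtr0_norm t0).
  have zi : `|z' i| <= M + 1.
    by rewrite /M (bigD1 i)//= -addrA lerDl addr_ge0// sumr_ge0.
  have : t * `|z' i| <= 2^-1 - sup_radius.
    by rewrite mulrAC ler_pdivrMr ?ltr_wpDl// ler_wpM2l// subr_ge0 ltW.
  by have := xs i; lra.
have := score_box_le0 Nx xb Ny yb xmax.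
rewrite (@eq_score _ _ _ _ _ (fun i => t * z' i)); last by move=> i; ring.
by rewrite scoreZ pmulr_rle0.
Qed.

End ConstrainedMLE.

Section GlobalMaximum.
Context {R : realType} {n : nat} (A : graph n).
Implicit Types (g h : 'I_n -> R).

(** Concavity: without a first-order term, only a nonnegative Bregman sum is subtracted. *)
Lemma score0_max g h : score A g (fun i => h i - g i) = 0 -> loglik A h <= loglik A g.
Proof.
move=> S0; have -> : h = (fun i => g i + (h i - g i)).
  by apply/funext => i; rewrite addrC subrK.
rewrite loglik_expand S0 addr0 gerBl; apply: sumr_ge0 => p _; exact: bregman_ge0.
Qed.

End GlobalMaximum.

(** * Orthonormal contrasts *)

Section OrthonormalComplement.
Context {R : realType} {n : nat}.
Implicit Types (x y z u : 'I_n -> R) (f h : nat -> 'I_n -> R).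
Variable V : ('I_n -> R) -> ('I_n -> R) -> R.
Hypothesis V_sym : forall x y, V x y = V y x.
Hypothesis V_lin : forall a x y z, V (fun i => x i + a * y i) z = V x z + a * V y z.
Hypothesis V_pos : forall x, x <> (fun=> 0) -> 0 < V x x.
Hypothesis V_riesz : forall x, exists g, forall y, V g y = \sum_i x i * y i.

Definition dot x y : R := \sum_i x i * y i.
Definition nullsp f k : set ('I_n -> R) := [set x | forall a, (a < k)%N -> dot (f a) x = 0].
Definition orthoproj h k z : 'I_n -> R := fun i => z i - \sum_(a < k) V (h a) z * h a i.

Lemma dot_lin a x y z : dot z (fun i => x i + a * y i) = dot z x + a * dot z y.
Proof.
by rewrite /dot mulr_sumr -big_split/=; apply: eq_bigr => i _; ring.
Qed.

Lemma V0l y : V (fun=> 0) y = 0.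
Proof.
have := V_lin 1 (fun=> 0) (fun=> 0) y; rewrite (_ : (fun i => _ : R) = (fun=> 0)).
  by rewrite mul1r -{1}[V _ y]addr0 => /addrI.
by apply/funext => i; rewrite mulr0 addr0.
Qed.

Lemma V_sumr k (c : 'I_k -> R) (h : 'I_k -> 'I_n -> R) x y :
  V (fun i => x i + \sum_a c a * h a i) y = V x y + \sum_a c a * V (h a) y.
Proof.
elim: k c h x => [|k IH] c h x.
  by rewrite big_ord0 addr0; congr V; apply/funext => i; rewrite big_ord0 addr0.
rewrite big_ord_recl/= addrA.
have := IH (fun a => c (lift ord0 a)) (fun a => h (lift ord0 a))
  (fun i => x i + c ord0 * h ord0 i).
rewrite V_lin => <-; congr V; apply/funext => i.
by rewrite big_ord_recl/= addrA.
Qed.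

Lemma V_orthoprojl h k z y : V (orthoproj h k z) y = V z y - \sum_(a < k) V (h a) z * V (h a) y.
Proof.
have -> : orthoproj h k z = (fun i => z i + \sum_(a < k) - V (h a) z * h a i).
  apply/funext => i; rewrite /orthoproj -sumrN; congr (_ + _).
  by apply: eq_bigr => a _; rewrite mulNr.
by rewrite V_sumr -sumrN; congr (_ + _); apply: eq_bigr => a _; rewrite mulNr.
Qed.

Lemma orthoprojS h k z : orthoproj h k.+1 z = (fun i => orthoproj h k z i + - V (h k) z * h k i).
Proof.
apply/funext => i; rewrite /orthoproj big_ord_recr/= mulNr opprD; ring.
Qed.

Lemma eq_orthoproj h h' k z : (forall a, (a < k)%N -> h a = h' a) ->
  orthoproj h k z = orthoproj h' k z.
Proof.
move=> E; apply/funext => i; congr (_ - _).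
by apply: eq_bigr => a _; rewrite E.
Qed.

(** Gram-Schmidt on the Riesz representers of the functionals [dot (f a)]. The hypothesis is their
    linear independence in a form suited to induction: each is nonzero somewhere on the common
    kernel of its predecessors. *)
Lemma orthonormal_complement f k :
  (forall a, (a < k)%N -> exists2 z, nullsp f a z & dot (f a) z != 0) ->
  exists h, [/\ (forall a b, (a < k)%N -> (b < k)%N -> V (h a) (h b) = (a == b)%:R),
    (forall a y, (a < k)%N -> nullsp f k y -> V (h a) y = 0) &
    (forall z, nullsp f k (orthoproj h k z))].
Proof.
elim: k => [_|k IH Hz]; first by exists (fun _ _ => 0); split => // z a.
have [|h [h1 h2 h3]] := IH; first by move=> a ak; apply: Hz; rewrite ltnW.
have [g gE] := V_riesz (f k).
pose u := orthoproj h k g.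
have uN : nullsp f k u by exact: h3.
(* The part subtracted from [g] is orthogonal to [nullsp f k], so [u] still represents [f k]
   there. *)
have uE y : nullsp f k y -> V u y = dot (f k) y.
  move=> Ny; rewrite V_orthoprojl gE [X in _ - X]big1 ?subr0// => a _.
  by rewrite (h2 a y)// mulr0.
have [z zN zk] := Hz k (leqnn _).
have uu : 0 < V u u.
  by apply: V_pos => u0; move: zk; rewrite -uE// u0 V0l eqxx.
set nu := Num.sqrt (V u u); have nu0 : 0 < nu by rewrite sqrtr_gt0.
have nu2 : nu * nu = V u u by rewrite -expr2 sqr_sqrtr// ltW.
pose e i := nu^-1 * u i.
have eV y : V e y = nu^-1 * V u y.
  have -> : e = (fun i => (fun=> 0) i + nu^-1 * u i).
    by apply/funext => i; rewrite add0r.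
  by rewrite V_lin V0l add0r.
have eN : nullsp f k e.
  move=> a ak; have -> : e = (fun i => (fun=> 0) i + nu^-1 * u i).
    by apply/funext => i; rewrite add0r.
  rewrite dot_lin uN// mulr0 addr0 /dot big1// => i _; exact: mulr0.
pose h' a := if (a < k)%N then h a else e.
have h'lt a : (a < k)%N -> h' a = h a by rewrite /h' => ->.
have h'k : h' k = e by rewrite /h' ltnn.
have ee : V e e = 1.
  by rewrite eV V_sym eV -nu2; field; rewrite gt_eqF.
have NS y : nullsp f k.+1 y -> nullsp f k y by move=> H a ak; apply: H; rewrite ltnW.
have cases a : (a < k.+1)%N -> (a < k)%N \/ a = k.
  by rewrite ltnS leq_eqVlt => /predU1P[->|]; [right|left].
exists h'; split.
- move=> a b /cases[ak|->] /cases[bk|->].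
  + by rewrite !h'lt// h1.
  + by rewrite h'lt// h'k h2// ltn_eqF.
  + by rewrite (h'lt b)// h'k V_sym h2// eq_sym ltn_eqF.
  + by rewrite h'k ee eqxx.
- move=> a y /cases[ak|->] Ny; first by rewrite h'lt// h2//; exact: NS.
  by rewrite h'k eV uE ?Ny ?mulr0//; exact: NS.
- move=> x; rewrite orthoprojS (eq_orthoproj x h'lt) h'k => a /cases[ak|->].
    by rewrite dot_lin h3// eN// mulr0 addr0.
  rewrite -uE; last by move=> b bk; rewrite dot_lin h3// eN// mulr0 addr0.
  rewrite V_sym V_lin V_orthoprojl big1; last first.
    by move=> b _; rewrite (h2 b u)// mulr0.
  by rewrite subr0 (V_sym x u) !eV -nu2; field; rewrite gt_eqF.
Qed.

Lemma bessel h k z : (forall a b, (a < k)%N -> (b < k)%N -> V (h a) (h b) = (a == b)%:R) ->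
  \sum_(a < k) V (h a) z ^+ 2 <= V z z.
Proof.
move=> ho; have VN : 0 <= V (orthoproj h k z) (orthoproj h k z).
  by have [->|/V_pos/ltW//] := pselect (orthoproj h k z = fun=> 0); rewrite V0l.
move: VN; rewrite V_orthoprojl (V_sym z (orthoproj _ _ _)) V_orthoprojl.
rewrite (_ : \sum_(a < k) V (h a) z * V (h a) (orthoproj h k z) = 0) ?subr0 ?subr_ge0.
  by move/le_trans; apply; rewrite le_eqVlt eqxx.
apply: big1 => a _; rewrite [V (h a) (orthoproj _ _ _)]V_sym V_orthoprojl.
rewrite (bigD1 a)//= ho// eqxx mulr1 big1 ?addr0; last first.
  by move=> b ba; rewrite ho// val_eqE (negbTE ba) mulr0.
by rewrite [V z _]V_sym subrr mulr0.
Qed.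

End OrthonormalComplement.

(** * The Fisher information form and the size of its contrasts *)

Section InformationForm.
Context {R : realType} {n : nat} (beta : 'I_n -> R).
Implicit Types (x y z h : 'I_n -> R).

(** The Fisher information at [beta]: minus the Hessian of the log-likelihood, and also the
    covariance of the scores in the directions [x] and [y]. *)
Definition info x y : R := \sum_(p | edge p) edgevar (ends beta p) * (ends x p * ends y p).

Lemma info_sym x y : info x y = info y x.
Proof. by apply: eq_bigr => p _; rewrite [ends x p * _]mulrC. Qed.

Lemma info_lin a x y z : info (fun i => x i + a * y i) z = info x z + a * info y z.
Proof.
rewrite /info mulr_sumr -big_split/=; apply: eq_bigr => p _.
by rewrite endsD endsZ; ring.
Qed.

Variable b : R.
Hypothesis b_gt0 : 0 < b.
Hypothesis n_ge3 : (2 < n)%N.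
Hypothesis edgevar_ge : forall p, edge p -> b^-1 <= edgevar (ends beta p).

Let n2_ge1 : 1 <= n%:R - 2 :> R.
Proof. by rewrite lerBrDr -(natrD R 1 2) ler_nat. Qed.

Let n2_gt0 : 0 < n%:R - 2 :> R. Proof. exact: lt_le_trans n2_ge1. Qed.

Lemma info_ge x : b^-1 * (n%:R - 2) * (\sum_i x i ^+ 2) <= info x x.
Proof.
apply: (@le_trans _ _ (\sum_(p | edge p) b^-1 * (ends x p * ends x p))); last first.
  by apply: ler_sum => p ep; rewrite ler_wpM2r ?edgevar_ge// -expr2 sqr_ge0.
rewrite -mulr_sumr sum_edge_endsM -mulrA ler_pM2l ?invr_gt0// lerDl.
by rewrite -expr2 sqr_ge0.
Qed.

Lemma info_sup x i : x i ^+ 2 <= b / (n%:R - 2) * info x x.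
Proof.
rewrite mulrAC ler_pdivlMr// mulrC -ler_pdivrMl// mulrA; apply: le_trans (info_ge x).
rewrite ler_wpM2l ?mulr_ge0 ?invr_ge0 ?(ltW b_gt0) ?(ltW n2_gt0)// (bigD1 i)//= lerDl.
by apply: sumr_ge0 => j _; exact: sqr_ge0.
Qed.

Lemma info_pos x : x <> (fun=> 0) -> 0 < info x x.
Proof.
move=> x0; rewrite ltNge; apply/negP => H; apply: x0; apply/funext => i.
have := info_sup x i => /le_trans/(_ (_ : _ <= 0)) => K.
have : x i ^+ 2 <= 0 by apply: K; rewrite mulr_ge0_le0// divr_ge0 ?ltW.
by rewrite le_eqVlt ltNge sqr_ge0 orbF sqrf_eq0 => /eqP.
Qed.

Let w i j : R := edgevar (beta i + beta j).

Lemma infoE x y : info x y = \sum_j (\sum_(k | k != j) w j k * (x j + x k)) * y j.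
Proof.
rewrite /info (eq_bigr (fun p => (w p.1 p.2 * (x p.1 + x p.2)) * ends y p)); last first.
  by move=> p _; rewrite mulrA.
rewrite (sum_edge_ends (c := fun i j => w i j * (x i + x j))); last first.
  by move=> i j; rewrite /w [beta i + _]addrC [x i + _]addrC.
by apply: eq_bigr => j _; rewrite mulrC.
Qed.

(** Positive definiteness makes the kernel of the Gram matrix [M] trivial, hence [M] invertible. *)
Lemma info_riesz x : exists g, forall y, info g y = \sum_i x i * y i.
Proof.
pose M : 'M[R]_n := \matrix_(k, j) (if k == j then \sum_(l | l != j) w j l else w j k).
have ME (v : 'rV[R]_n) j : (v *m M) ord0 j =
    \sum_(k | k != j) w j k * (v ord0 j + v ord0 k).
  rewrite mxE (bigD1 j)//= mxE eqxx mulr_sumr -big_split/=.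
  by apply: eq_bigr => k kj; rewrite mxE (negbTE kj); ring.
have iM (v : 'rV[R]_n) y : info (v ord0) y = \sum_j (v *m M) ord0 j * y j.
  by rewrite infoE; apply: eq_bigr => j _; rewrite ME.
have Mu : M \in unitmx.
  rewrite -row_free_unit -kermx_eq0; apply/rowV0P => v /sub_kermxP vM.
  have v0 : v ord0 = (fun=> 0).
    apply: contrapT => /info_pos; rewrite iM vM big1 ?ltxx// => j _.
    by rewrite mxE mul0r.
  by apply/rowP => j; rewrite v0 mxE.
exists ((\row_i x i *m invmx M) ord0) => y.
by rewrite iM mulmxKV//; apply: eq_bigr => i _; rewrite mxE.
Qed.

(* Splitting [h] into its first [r] coordinates [h1] and the rest [h2], orthogonality to
   [h2] gives [<h2, h2> = - <h1, h2> <= |h1|_1 |h2|_1 / 4], against [<h2, h2>] of order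
   [|h2|_1 ^ 2 / b]. *)
Lemma l1_bound r h : info h h = 1 ->
  (forall y, (forall i : 'I_n, (i < r)%N -> y i = 0) -> info h y = 0) ->
  \sum_i `|h i| <= (1 + b) * r%:R * Num.sqrt (b / (n%:R - 2)).
Proof.
move=> hh hN; set m := Num.sqrt _.
have m0 : 0 <= m by exact: sqrtr_ge0.
have hm i : `|h i| <= m.
  rewrite -(@ler_pXn2r _ 2) ?nnegrE//.
  rewrite sqr_sqrtr ?divr_ge0 ?(ltW b_gt0) ?(ltW n2_gt0)// real_normK ?num_real//.
  by have := info_sup h i; rewrite hh mulr1.
pose h1 (i : 'I_n) := if (i < r)%N then h i else 0.
pose h2 (i : 'I_n) := if (i < r)%N then 0 else h i.
pose S1 := \sum_i `|h1 i|; pose S2 := \sum_i `|h2 i|.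
have S20 : 0 <= S2 by apply: sumr_ge0.
have S10 : 0 <= S1 by apply: sumr_ge0.
have -> : \sum_i `|h i| = S1 + S2.
  rewrite -big_split/=; apply: eq_bigr => i _; rewrite /h1 /h2.
  by case: ifP => _; rewrite normr0 ?addr0 ?add0r.
have S1b : S1 <= r%:R * m.
  rewrite /S1 (bigID (fun i : 'I_n => (i < r)%N))/= [X in _ + X]big1 ?addr0; last first.
    by move=> i /negbTE; rewrite /h1 => ->; rewrite normr0.
  apply: (@le_trans _ _ (\sum_(i < n | (i < r)%N) m)).
    by apply: ler_sum => i ir; rewrite /h1 ir.
  rewrite sumr_const -[X in X <= _]mulr_natl ler_wpM2r// ler_nat.
  rewrite cardE -(size_map val) -[X in (_ <= X)%N](size_iota 0 r).
  apply: uniq_leq_size; first by rewrite (map_inj_uniq val_inj) enum_uniq.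
  by move=> a /mapP[i]; rewrite mem_enum => ir ->; rewrite mem_iota.
have hE : h = (fun i => h1 i + 1 * h2 i).
  by apply/funext => i; rewrite /h1 /h2 mul1r; case: ifP; rewrite ?addr0 ?add0r.
have V2 : info h2 h2 <= 4^-1 * (S1 * S2).
  have : info h h2 = 0 by apply: hN => i ir; rewrite /h2 ir.
  rewrite {1}hE info_lin mul1r => /eqP; rewrite addrC addr_eq0 => /eqP ->.
  apply: le_trans (ler_norm _) _; rewrite normrN.
  apply: le_trans (ler_norm_sum _ _ _) _.
  have -> : S1 * S2 = \sum_(p | edge p) ends (fun i => `|h1 i|) p * ends (fun i => `|h2 i|) p.
    rewrite sum_edge_endsM [X in _ * X + _]big1 ?mulr0 ?add0r// => i _.
    by rewrite /h1 /h2; case: ifP; rewrite normr0 ?mulr0 ?mul0r.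
  rewrite mulr_sumr; apply: ler_sum => p _; rewrite !normrM.
  rewrite (gtr0_norm (edgevar_gt0 _)); apply: ler_pM; rewrite ?mulr_ge0 ?edgevar_le//.
    exact/ltW/edgevar_gt0.
  by apply: ler_pM => //; exact: ler_normD.
have V2' := info_ge h2; have CS := sqr_sum_norm_le h2; rewrite -/S2 in CS.
have S2b : S2 <= b * S1.
  have n0 : 0 < n%:R :> R by rewrite ltr0n; apply: leq_trans n_ge3.
  have n3 : n%:R <= 3 * (n%:R - 2) :> R.
    have : 3%:R <= n%:R :> R by rewrite ler_nat.
    lra.
  have [->|S2n] := eqVneq S2 0; first by rewrite mulr_ge0// ltW.
  have S2p : 0 < S2 by rewrite lt_neqAle eq_sym S2n.
  have H := le_trans V2' V2; rewrite -mulrA ler_pdivrMl// in H.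
  set Q := \sum_i h2 i ^+ 2 in CS H.
  rewrite -(ler_pM2r S2p) -expr2; apply: le_trans CS _.
  have Q0 : 0 <= Q by apply: sumr_ge0 => i _; exact: sqr_ge0.
  apply: (@le_trans _ _ (3 * ((n%:R - 2) * Q))).
    by rewrite mulrA ler_wpM2r.
  have P0 : 0 <= b * S1 * S2 by rewrite !mulr_ge0// ltW.
  have -> : b * S1 * S2 = b * (S1 * S2) by rewrite mulrA.
  move: H P0; rewrite -!mulrA; set q := (_ - _) * Q; set P := b * (S1 * S2).
  by rewrite [b * (4^-1 * _)](_ : _ = 4^-1 * P) /P; [lra|ring].
rewrite -mulrA; apply: (@le_trans _ _ ((1 + b) * S1)); first by lra.
by rewrite ler_pM2l// addr_gt0.
Qed.

End InformationForm.

(** * The likelihood ratio *)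

Section LikelihoodRatio.
Context {R : realType} {n : nat} (A : graph n) (beta : 'I_n -> R).
Implicit Types (x y z : 'I_n -> R) (h : nat -> 'I_n -> R).
Variables (N : set ('I_n -> R)) (k : nat) (h : nat -> 'I_n -> R) (x0 x1 : 'I_n -> R).
Variables (tau : R).
Notation V := (info beta).
Hypothesis V_pos : forall x, x <> (fun=> 0) -> 0 < V x x.
Hypothesis h_on : forall a b, (a < k)%N -> (b < k)%N -> V (h a) (h b) = (a == b)%:R.
Hypothesis h_perp : forall a y, (a < k)%N -> N y -> V (h a) y = 0.
Hypothesis h_proj : forall z, N (orthoproj V h k z).
Hypothesis N_x0 : N x0.
Hypothesis score_x0 : forall z, N z -> score A (fun i => beta i + x0 i) z = 0.
Hypothesis score_x1 : forall z, score A (fun i => beta i + x1 i) z = 0.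
Hypothesis x0_le : forall i, `|x0 i| <= tau.
Hypothesis x1_le : forall i, `|x1 i| <= tau.

Let s (a : 'I_k) : R := score A (fun i => beta i + x0 i) (h a).
Let g0 := fun i => beta i + x0 i.

Lemma ends_le z t p : (forall i, `|z i| <= t) -> `|ends z p| <= 2 * t.
Proof.
by move=> zt; apply: le_trans (ler_normD _ _) _; rewrite mulr_natl mulr2n lerD.
Qed.

Lemma score_sum (c : 'I_k -> R) y :
  score A g0 (fun i => y i + \sum_a c a * h a i) = score A g0 y + \sum_a c a * s a.
Proof.
rewrite scoreD; congr (_ + _).
rewrite /s /score; under [RHS]eq_bigr do rewrite mulr_sumr.
rewrite exchange_big/=; apply: eq_bigr => p _.
rewrite (_ : ends (fun i => \sum_a c a * h a i) p = \sum_a c a * ends (h a) p).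
  by rewrite mulr_sumr; apply: eq_bigr => a _; ring.
by rewrite /ends -big_split/=; apply: eq_bigr => a _; ring.
Qed.

(** The score at [x0] vanishes on [N], so it sees only the components of [z] along the [h a]: a
    functional on n coordinates reduces to k numbers. *)
Lemma score_x0E z : score A g0 z = \sum_(a < k) V (h a) z * s a.
Proof.
have := score_x0 (h_proj z).
have -> : orthoproj V h k z = (fun i => z i + \sum_(a < k) - V (h a) z * h a i).
  apply/funext => i; rewrite /orthoproj -sumrN; congr (_ + _).
  by apply: eq_bigr => a _; rewrite mulNr.
rewrite score_sum => /eqP; rewrite addr_eq0 => /eqP ->; rewrite -sumrN.
by apply: eq_bigr => a _; rewrite mulNr opprK.
Qed.

(** With z = x1 - x0 and v_a = V(h_a, z), the gain is at most sum v_a s_a - e^(-2 tau) V(z, z) / 2.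
    Bessel replaces V(z, z) by sum v_a^2, and completing each square leaves e^(2 tau) s_a^2 / 2. *)
Lemma loglik_ratio_le :
  2 * (loglik A (fun i => beta i + x1 i) - loglik A g0) <= expR (2 * tau) * \sum_a s a ^+ 2.
Proof.
pose z i := x1 i - x0 i.
have -> : (fun i => beta i + x1 i) = (fun i => g0 i + z i).
  by apply/funext => i; rewrite /g0 /z; ring.
rewrite loglik_expand score_x0E.
set e := 2 * tau.
have B : expR (- e) * V z z / 2 <= \sum_(p | edge p) bregman (ends g0 p) (ends z p).
  rewrite -mulrA mulr_suml mulr_sumr; apply: ler_sum => p _.
  have H1 : `|ends g0 p - ends beta p| <= e.
    by rewrite /g0 endsD addrAC subrr add0r; exact: ends_le.
  have H2 : `|ends g0 p + ends z p - ends beta p| <= e.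
    rewrite (_ : _ - _ = ends x1 p); first exact: ends_le.
    by rewrite /g0 /z /ends; ring.
  have /andP[H _] := bregman_ball H1 H2; apply: le_trans H.
  by rewrite le_eqVlt; apply/orP; left; apply/eqP; rewrite expr2; ring.
have Bs := bessel (@info_sym R n beta) (@info_lin R n beta) V_pos z h_on.
have E0 := expR_gt0 e; have E0' := expR_gt0 (- e).
have EE : expR e * expR (- e) = 1 by rewrite -expRD subrr expR0.
have P : \sum_(a < k) V (h a) z * s a <=
    \sum_(a < k) (expR e * s a ^+ 2 / 2 + expR (- e) * V (h a) z ^+ 2 / 2).
  apply: ler_sum => a _; set v := V _ _; set t := s a.
  have := sqr_ge0 (expR e * t - v).
  rewrite -(pmulr_rge0 _ E0') => Q.
  have : expR (- e) * (expR e * t - v) ^+ 2 =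
     (expR e * expR (- e)) * (expR e * t ^+ 2) - 2 * (expR e * expR (- e)) * (v * t)
      + expR (- e) * v ^+ 2 by ring.
  by rewrite EE => QE; rewrite QE in Q; lra.
rewrite big_split/= in P.
have Bs' : expR (- e) * (\sum_(a < k) V (h a) z ^+ 2) <= expR (- e) * V z z.
  by rewrite ler_pM2l.
have Q1 : \sum_(a < k) expR e * s a ^+ 2 / 2 = expR e * (\sum_a s a ^+ 2) / 2.
  by rewrite -mulrA mulr_suml mulr_sumr; apply: eq_bigr => a _; rewrite mulrA.
have Q2 : \sum_(a < k) expR (- e) * V (h a) z ^+ 2 / 2 =
    expR (- e) * (\sum_(a < k) V (h a) z ^+ 2) / 2.
  by rewrite -mulrA mulr_suml mulr_sumr; apply: eq_bigr => a _; rewrite mulrA.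
rewrite Q1 Q2 in P; lra.
Qed.

(** The competitor x0 + sum s_a h_a maximizes the quadratic model. Its gain is at least (1 - e^(2
    (tau + om)) / 2) sum s_a^2, where [om] bounds the step so that the Hessian comparison
    applies. *)
Lemma loglik_ratio_ge om :
  (forall i, `|\sum_(a < k) s a * h a i| <= om) ->
  (2 - expR (2 * (tau + om))) * \sum_a s a ^+ 2 <=
  2 * (loglik A (fun i => beta i + x1 i) - loglik A g0).
Proof.
move=> zo; pose z i := \sum_(a < k) s a * h a i.
have M : loglik A (fun i => g0 i + z i) <= loglik A (fun i => beta i + x1 i).
  by apply: score0_max; exact: score_x1.
set e := 2 * (tau + om); set SS := \sum_a s a ^+ 2.
have zE : z = (fun i => (fun=> 0) i + \sum_(a < k) s a * h a i).
  by apply/funext => i; rewrite add0r.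
have Sz : score A g0 z = SS.
  rewrite zE score_sum /score big1 ?add0r; last by move=> p _; rewrite /ends addr0 mulr0.
  by apply: eq_bigr => a _; rewrite expr2.
have Vzh (a : 'I_k) : V z (h a) = s a.
  rewrite zE (V_sumr (@info_lin R n beta) _ (fun a : 'I_k => h a)).
  rewrite (V0l (@info_lin R n beta)) add0r (bigD1 a)//= h_on// eqxx mulr1 big1 ?addr0//.
  by move=> b ba; rewrite h_on// val_eqE (negbTE ba) mulr0.
have Vz : V z z = SS.
  rewrite {1}zE (V_sumr (@info_lin R n beta) _ (fun a : 'I_k => h a)).
  rewrite (V0l (@info_lin R n beta)) add0r; apply: eq_bigr => a _.
  by rewrite info_sym Vzh expr2.
have B : \sum_(p | edge p) bregman (ends g0 p) (ends z p) <= expR e * V z z / 2.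
  rewrite -mulrA mulr_suml mulr_sumr; apply: ler_sum => p _.
  have om0 : `|ends z p| <= 2 * om by exact: ends_le.
  have ta0 : `|ends x0 p| <= 2 * tau by exact: ends_le.
  have H1 : `|ends g0 p - ends beta p| <= e.
    rewrite /g0 endsD addrAC subrr add0r; apply: le_trans ta0 _.
    have := le_trans (normr_ge0 _) om0; rewrite /e; lra.
  have H2 : `|ends g0 p + ends z p - ends beta p| <= e.
    rewrite (_ : _ - _ = ends x0 p + ends z p); last by rewrite /g0 /ends; ring.
    by apply: le_trans (ler_normD _ _) _; rewrite /e; lra.
  have /andP[_ H] := bregman_ball H1 H2; apply: le_trans H _.
  by rewrite le_eqVlt; apply/orP; left; apply/eqP; rewrite expr2; ring.
move: M; rewrite loglik_expand Sz; rewrite Vz in B; nra.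
Qed.

(** [h a] is orthogonal to [x0], so the linear term of the change vanishes. The Taylor remainder is
    at most (2 tau)^2 / 2 per edge, and a node lies on fewer than n edges; tau <= 1/4 keeps edge
    sums in the range of [mu_taylor]. *)
Lemma score_perturbation a : (a < k)%N -> tau <= 4^-1 ->
  `|score A g0 (h a) - score A beta (h a)| <= 2 * tau ^+ 2 * n%:R * \sum_i `|h a i|.
Proof.
move=> ak tau4.
have E : score A g0 (h a) - score A beta (h a) =
    - \sum_(p | edge p) (mu (ends beta p + ends x0 p) - mu (ends beta p)
         - edgevar (ends beta p) * ends x0 p) * ends (h a) p.
  have V0 : V (h a) x0 = 0 by exact: h_perp.
  rewrite -[LHS]addr0 -[X in _ + X = _]V0 /score /info -[RHS]sumrN -sumrB -big_split/=.
  by apply: eq_bigr => p _; rewrite endsD; ring.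
rewrite E normrN; apply: le_trans (ler_norm_sum _ _ _) _.
apply: (@le_trans _ _ (\sum_(p | edge p) 2 * tau ^+ 2 * ends (fun i => `|h a i|) p)).
  apply: ler_sum => p _; rewrite normrM.
  have xe := ends_le p x0_le.
  apply: ler_pM => //; last exact: ler_normD.
  apply: le_trans (mu_taylor _ _) _; first by lra.
  have : `|ends x0 p| ^+ 2 <= (2 * tau) ^+ 2.
    by rewrite lerXn2r ?nnegrE//; exact: le_trans xe.
  rewrite real_normK ?num_real// exprMn => H; lra.
rewrite -mulr_sumr -[leRHS]mulrA; apply: ler_wpM2l; first by rewrite mulr_ge0 ?sqr_ge0.
rewrite (eq_bigr (fun p => 1 * ends (fun i => `|h a i|) p)); last by move=> p _; rewrite mul1r.
rewrite (sum_edge_ends (c := fun _ _ => 1))// mulr_sumr; apply: ler_sum => i _.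
rewrite mulrC ler_wpM2r// sumr_const ler_nat.
by rewrite (leq_trans (max_card _))// card_ord.
Qed.

End LikelihoodRatio.

(** * Expectations in the beta-model *)

Section Expectation.
Context {R : realType} {n : nat} (beta : 'I_n -> R).
Implicit Types (A : graph n) (p q : 'I_n * 'I_n) (f phi : graph n -> R).

Definition pair_weight p (c : bool) : R :=
  if (p.1 < p.2)%N then (if c then mu (beta p.1 + beta p.2) else 1 - mu (beta p.1 + beta p.2))
  else (if c then 0 else 1).

Definition expect f : R := \sum_A bm_weight beta A * f A.

Lemma bm_weightE A : bm_weight beta A = \prod_p pair_weight p (A p).
Proof. by []. Qed.

Lemma pair_weight_ge0 p c : 0 <= pair_weight p c.
Proof.
rewrite /pair_weight; case: ifP => _; case: c => //; first exact/ltW/mu_gt0.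
by rewrite subr_ge0 ltW// mu_lt1.
Qed.

Lemma bm_weight_ge0 A : 0 <= bm_weight beta A.
Proof. by apply: prodr_ge0 => p _; exact: pair_weight_ge0. Qed.

Lemma expect_prod (F : 'I_n * 'I_n -> bool -> R) :
  expect (fun A => \prod_p F p (A p)) =
  \prod_p (pair_weight p true * F p true + pair_weight p false * F p false).
Proof.
rewrite /expect (eq_bigr (fun A => \prod_p (pair_weight p (A p) * F p (A p)))).
  rewrite -(bigA_distr_bigA (fun p c => pair_weight p c * F p c)).
  by apply: eq_bigr => p _; rewrite big_bool.
by move=> A _; rewrite bm_weightE -big_split.
Qed.

Lemma pair_weight_sum p : pair_weight p true + pair_weight p false = 1.
Proof. by rewrite /pair_weight; case: ifP => _; rewrite ?add0r// addrC subrK. Qed.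

Lemma bm_weight_sum : \sum_A bm_weight beta A = 1.
Proof.
have <- : expect (fun=> \prod_(p : 'I_n * 'I_n) (1 : R)) = \sum_A bm_weight beta A.
  by apply: eq_bigr => A _; rewrite big1_eq mulr1.
rewrite (expect_prod (fun _ _ => 1)) big1// => p _.
by rewrite !mulr1 pair_weight_sum.
Qed.

Lemma expect_le f g : (forall A, f A <= g A) -> expect f <= expect g.
Proof. by move=> fg; apply: ler_sum => A _; rewrite ler_wpM2l// bm_weight_ge0. Qed.

Lemma expectD f g : expect (fun A => f A + g A) = expect f + expect g.
Proof. by rewrite /expect -big_split/=; apply: eq_bigr => A _; rewrite mulrDr. Qed.

Lemma expectZ c f : expect (fun A => c * f A) = c * expect f.
Proof. by rewrite /expect mulr_sumr; apply: eq_bigr => A _; rewrite mulrCA. Qed.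

Lemma expect_cst c : expect (fun=> c) = c.
Proof. by rewrite /expect -mulr_suml bm_weight_sum mul1r. Qed.

Lemma expect_sum (I : finType) (P : pred I) (F : I -> graph n -> R) :
  expect (fun A => \sum_(i | P i) F i A) = \sum_(i | P i) expect (F i).
Proof.
rewrite /expect exchange_big/=; apply: eq_bigr => A _; exact: mulr_sumr.
Qed.

Lemma eq_expect f g : f =1 g -> expect f = expect g.
Proof. by move=> fg; apply: eq_bigr => A _; rewrite fg. Qed.

Lemma expect_norm_le f c : (forall A, `|f A| <= c) -> `|expect f| <= c.
Proof.
move=> fc; apply: le_trans (ler_norm_sum _ _ _) _.
rewrite -[leRHS]expect_cst; apply: ler_sum => A _.
by rewrite normrM (ger0_norm (bm_weight_ge0 A)) ler_wpM2l// bm_weight_ge0.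
Qed.

Lemma bm_probE (E : graph n -> Prop) :
  bm_prob beta E = expect (fun A => if `[< E A >] then 1 else 0).
Proof.
rewrite /bm_prob big_mkcond/=; apply: eq_bigr => A _.
by case: ifP => _; rewrite ?mulr1 ?mulr0.
Qed.

Lemma le_bm_prob (E E' : graph n -> Prop) : (forall A, E A -> E' A) ->
  bm_prob beta E <= bm_prob beta E'.
Proof.
move=> EE; rewrite !bm_probE; apply: expect_le => A.
case: asboolP => [/EE H|_]; last by case: ifP.
by rewrite ifT//; apply/asboolP.
Qed.

Lemma bm_prob_ge0 E : 0 <= bm_prob beta E.
Proof. by apply: sumr_ge0 => A _; exact: bm_weight_ge0. Qed.

Lemma bm_probC E : bm_prob beta E = 1 - bm_prob beta (fun A => ~ E A).
Proof.
rewrite !bm_probE -[1 in RHS]expect_cst -[- expect _]mulN1r -expectZ -expectD.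
apply: eq_expect => A; rewrite asbool_neg; case: ifP => _ /=.
  by rewrite mulr0 addr0.
by rewrite expect_cst mulr1 subrr.
Qed.

Lemma bm_prob_or (E E' : graph n -> Prop) :
  bm_prob beta (fun A => E A \/ E' A) <= bm_prob beta E + bm_prob beta E'.
Proof.
rewrite !bm_probE -expectD; apply: expect_le => A.
by do 3! case: asboolP => ? //=; rewrite ?addr0 ?add0r ?lerDl//; tauto.
Qed.

Definition upd A q c : graph n := [ffun p => if p == q then c else A p].

Lemma upd_upd A q c d : upd (upd A q c) q d = upd A q d.
Proof. by apply/ffunP => p; rewrite !ffunE; case: eqP. Qed.

(** Pairing the configurations that differ only at [q] isolates the factor of that edge. *)
Lemma sum_upd q f :
  \sum_A f A = \sum_(A : graph n | ~~ A q) (f (upd A q true) + f (upd A q false)).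
Proof.
rewrite (bigID (fun A : graph n => A q))/= big_split/=; congr (_ + _).
  rewrite (reindex_onto (fun A => upd A q true) (fun A => upd A q false))/=.
    apply: eq_bigl => A; rewrite upd_upd ffunE eqxx/=.
    apply/eqP/idP => [<-|Aq]; first by rewrite ffunE eqxx.
    by apply/ffunP => p; rewrite ffunE; case: eqP => // ->; rewrite (negbTE Aq).
  move=> A Aq; rewrite upd_upd; apply/ffunP => p; rewrite ffunE.
  by case: eqP => // ->; rewrite Aq.
apply: eq_bigr => A Aq; congr f; apply/ffunP => p; rewrite ffunE.
by case: eqP => // ->; rewrite (negbTE Aq).
Qed.

Lemma bm_weight_upd A q c :
  bm_weight beta (upd A q c) = pair_weight q c * \prod_(p | p != q) pair_weight p (A p).
Proof.
rewrite bm_weightE (bigD1 q)//= ffunE eqxx; congr (_ * _).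
by apply: eq_bigr => p pq; rewrite ffunE (negbTE pq).
Qed.

Lemma expect_by_parts q phi : edge q ->
  expect (fun A => ((A q)%:R - mu (ends beta q)) * phi A) =
  edgevar (ends beta q) * expect (fun A => phi (upd A q true) - phi (upd A q false)).
Proof.
rewrite /edge => eq; rewrite edgevarE /expect !(sum_upd q) mulr_sumr; apply: eq_bigr => A _.
rewrite !bm_weight_upd !upd_upd !ffunE eqxx /pair_weight eq /ends/=; ring.
Qed.

(** From e^x <= 1 / (1 - x) and (1 - x) (1 + x + 2 x^2) = 1 + x^2 (1 - 2 x) >= 1. *)
Lemma expR_le_quadratic (x : R) : x <= 2^-1 -> expR x <= 1 + x + 2 * x ^+ 2.
Proof.
move=> x2; have := expR_ge1Dx (- x) => H.
have E : expR x * expR (- x) = 1 by rewrite -expRD subrr expR0.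
have E0 := expR_gt0 x.
have : expR x * (1 - x) <= expR x * expR (- x) by rewrite ler_pM2l.
rewrite E.
have P : 0 <= 1 + x + 2 * x ^+ 2 by nra.
have : 1 <= (1 - x) * (1 + x + 2 * x ^+ 2) by nra.
have : 0 < 1 - x by lra.
nra.
Qed.

(** Centring cancels the linear terms, and the quadratic ones add up to 2 m (1 - m) z^2 <= z^2. *)
Lemma bernoulli_mgf (m z : R) : 0 <= m <= 1 -> `|z| <= 2^-1 ->
  m * expR ((1 - m) * z) + (1 - m) * expR ((0 - m) * z) <= expR (z ^+ 2).
Proof.
rewrite ler_norml => /andP[m0 m1] /andP[z1 z2].
have H1 : (1 - m) * z <= 2^-1 by nra.
have H2 : (0 - m) * z <= 2^-1 by nra.
have := expR_le_quadratic H1; have := expR_le_quadratic H2 => A2 A1.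
apply: le_trans (expR_ge1Dx _).
have B1 := ler_wpM2l m0 A1.
have m1' : 0 <= 1 - m by lra.
have B2 := ler_wpM2l m1' A2.
apply: le_trans (lerD B1 B2) _.
rewrite [leLHS](_ : _ = 1 + 2 * (m * (1 - m)) * z ^+ 2); last by ring.
rewrite lerD2l ler_piMl ?sqr_ge0//; have := sqr_ge0 (m - 2^-1); nra.
Qed.

Lemma score_mgf z : (forall p, edge p -> `|ends z p| <= 2^-1) ->
  expect (fun A => expR (score A beta z)) <= expR (\sum_(p | edge p) ends z p ^+ 2).
Proof.
move=> zb.
rewrite (eq_expect (g := fun A => \prod_p
    (if edge p then expR (((A p)%:R - mu (ends beta p)) * ends z p) else 1))); last first.
  by move=> A; rewrite /score expR_sum big_mkcond.
rewrite (expect_prod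
  (fun p c => if edge p then expR ((c%:R - mu (ends beta p)) * ends z p) else 1)).
rewrite expR_sum [leRHS]big_mkcond/=; apply: ler_prod => p _.
apply/andP; split.
  rewrite addr_ge0// mulr_ge0 ?pair_weight_ge0//; case: ifP => // _; exact: expR_ge0.
case: ifP => ep; last by rewrite !mulr1 pair_weight_sum.
move: (ep); rewrite /pair_weight /edge => ->.
apply: bernoulli_mgf; last exact: zb.
by rewrite !ltW ?mu_gt0 ?mu_lt1.
Qed.

(** Chernoff bound with both signs of [s], then a union over the n nodes. A node lies on n - 1
    edges, whence the exponent s^2 n. *)
Lemma residual_tail (s Xi : R) : 0 <= s <= 2^-1 ->
  bm_prob beta (fun A => exists i, Xi < `|residual A beta i|) <=
  2 * n%:R * expR (- (s * Xi) + s ^+ 2 * n%:R).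
Proof.
move=> /andP[s0 s2].
(* The residual at [i] is the score along the i-th coordinate vector, so [score_mgf] applies to [c]
   times that vector. *)
have side (i : 'I_n) (c : R) : c ^+ 2 = s ^+ 2 ->
    expect (fun A => expR (c * residual A beta i)) <= expR (s ^+ 2 * n%:R).
  move=> cs; pose z (j : 'I_n) := if j == i then c else 0.
  have zE (F : 'I_n -> R) : \sum_j z j * F j = c * F i.
    rewrite (bigD1 i)//= /z eqxx big1 ?addr0// => j ji.
    by rewrite (negbTE ji) mul0r.
  have -> : expect (fun A => expR (c * residual A beta i)) =
      expect (fun A => expR (score A beta z)).
    by apply: eq_expect => A; rewrite score_residual zE.
  have cb : `|c| <= 2^-1.
    by rewrite -(@ler_pXn2r _ 2) ?nnegrE// real_normK ?num_real// cs lerXn2r ?nnegrE.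
  apply: le_trans (score_mgf _) _.
    move=> [j l]; rewrite /edge/= /ends/= => jl.
    rewrite /z; have [ji|ji] := eqVneq j i; last first.
      by case: ifP => _; rewrite add0r ?normr0.
    by rewrite ifF ?addr0//; apply/eqP => li; move: jl; rewrite li ji ltnn.
  rewrite ler_expR.
  have -> : \sum_(p | edge p) ends z p ^+ 2 = \sum_(p | edge p) ends z p * ends z p by [].
  rewrite sum_edge_endsM zE.
  have -> : \sum_j z j = c by have := zE (fun=> 1); under eq_bigr do rewrite mulr1; rewrite mulr1.
  rewrite /z eqxx -expr2 cs; have := sqr_ge0 s; lra.
rewrite bm_probE.
apply: (@le_trans _ _ (expect (fun A => \sum_i (expR (- (s * Xi)) *
    (expR (s * residual A beta i) + expR (- s * residual A beta i)))))).
  apply: expect_le => A; case: asboolP => [[i Hi]|_]; last first.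
    by apply: sumr_ge0 => i _; rewrite mulr_ge0 ?addr_ge0 ?expR_ge0.
  rewrite (bigD1 i)//=; apply: ler_wpDr.
    by apply: sumr_ge0 => j _; rewrite mulr_ge0 ?addr_ge0 ?expR_ge0.
  rewrite mulrDr -!expRD.
  have [r0|r0] := leP 0 (residual A beta i).
    rewrite ger0_norm// in Hi; apply: ler_wpDr; first exact: expR_ge0.
    by rewrite -[leLHS]expR0 ler_expR; have := ler_wpM2l s0 (ltW Hi); lra.
  rewrite ltr0_norm// in Hi; apply: ler_wpDl; first exact: expR_ge0.
  by rewrite -[leLHS]expR0 ler_expR; have := ler_wpM2l s0 (ltW Hi); lra.
rewrite expect_sum.
apply: (@le_trans _ _ (\sum_(i < n)
    (expR (- (s * Xi)) * (expR (s ^+ 2 * n%:R) + expR (s ^+ 2 * n%:R))))).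
  apply: ler_sum => i _; rewrite expectZ expectD ler_wpM2l ?expR_ge0// lerD//.
    exact: side.
  by apply: side; rewrite sqrrN.
by rewrite sumr_const card_ord -mulr2n expRD -[leLHS]mulr_natl -[_ *+ 2]mulr_natl; lra.
Qed.

End Expectation.

(** * Stein identity and Laplace transform *)

Section SteinLine.
Context {R : realType}.
Implicit Types (lam t : R).

Lemma derive_lipschitz (f df : R -> R) (K x y : R) :
  (forall t : R, is_derive t 1 f (df t)) -> (forall t, `|df t| <= K) ->
  `|f x - f y| <= K * `|x - y|.
Proof.
move=> D B; wlog xy : x y / x <= y.
  move=> W; have [|/ltW] := leP x y; first exact: W.
  by move=> yx; rewrite (distrC (f x)) (distrC x); exact: W.
have [c _ E] := MVT_segment xy (fun t _ => D t) (@derive_segment_continuous _ _ _ _ D).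
by rewrite (distrC (f x)) (distrC x) E normrM ler_wpM2r.
Qed.

(** [B], [C], [q] stand for Z.u, |u|^2 and |Z|^2, where Z moves by u when an edge is switched on,
    and g(s) = (B + s C) e^(- lam |Z + s u|^2). The difference g(1) - g(0) is g' at some point,
    compared with g'(t) through a bound on g'' uniform in Z. *)
Lemma stein_line lam (B q C c0 t : R) : 0 <= lam -> 0 <= q -> B ^+ 2 <= C * q ->
  0 <= c0 -> C = c0 ^+ 2 -> 0 <= t <= 1 ->
  `|(B + C) * expR (- (lam * (q + 2 * B + C))) - B * expR (- (lam * q))
    - (C - 2 * lam * (B + t * C) ^+ 2) * expR (- (lam * (q + 2 * t * B + t ^+ 2 * C)))|
  <= 8 * (1 + lam) * (C * c0).
Proof.
move=> lam0 q0 CS c00 CE /andP[t0 t1].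
pose Q s := q + 2 * s * B + s ^+ 2 * C; pose Bt s := B + s * C.
pose e s := expR (- (lam * Q s)).
pose g s := Bt s * e s; pose dg s := (C - 2 * lam * Bt s ^+ 2) * e s.
pose ddg s := (- (6 * lam * C * Bt s) + 4 * lam ^+ 2 * Bt s ^+ 3) * e s.
have De (s : R) : is_derive s 1 e (- (2 * lam * Bt s) * e s).
  by apply: is_derive_eq; rewrite /GRing.scale/= /e /Bt; ring.
have Dg (s : R) : is_derive s 1 g (dg s).
  by apply: is_derive_eq; rewrite /GRing.scale/= /dg /Bt; ring.
have Ddg (s : R) : is_derive s 1 dg (ddg s).
  by apply: is_derive_eq; rewrite /GRing.scale/= /ddg /Bt; ring.
have C0 : 0 <= C by rewrite CE sqr_ge0.
have BQ s : Bt s ^+ 2 <= C * Q s by rewrite /Bt /Q; nra.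
have Q0 s : 0 <= Q s.
  have [C00|Cn] := eqVneq C 0.
    have B0 : B = 0 by apply/eqP; rewrite -sqrf_eq0 eq_le sqr_ge0 andbT (le_trans CS)// C00 mul0r.
    by rewrite /Q B0 C00 !mulr0 !addr0.
  have Cp : 0 < C by rewrite lt_neqAle eq_sym Cn.
  by rewrite -(pmulr_rge0 _ Cp); apply: le_trans (BQ s); exact: sqr_ge0.
have Bd s : `|ddg s| <= 8 * (1 + lam) * (C * c0).
  rewrite normrM [X in _ * X]ger0_norm ?expR_ge0//.
  set y := lam * Q s; have y0 : 0 <= y by rewrite mulr_ge0.
  (* Cauchy-Schwarz gives |Bt| <= c0 sqrt Q, and sqrt Q <= (1 + Q) / 2 keeps the bound polynomial in
     Q. *)
  have B1 : `|Bt s| <= c0 * (1 + Q s) / 2.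
    have cQ : 0 <= c0 * (1 + Q s) / 2 by rewrite divr_ge0// mulr_ge0// addr_ge0.
    rewrite -(@ler_pXn2r _ 2) ?nnegrE// real_normK ?num_real//.
    apply: le_trans (BQ s) _; rewrite CE.
    have := sqr_ge0 (1 - Q s); have := sqr_ge0 c0; nra.
  have lB : lam * `|Bt s| <= c0 * (lam + y) / 2.
    apply: le_trans (ler_wpM2l lam0 B1) _.
    by rewrite le_eqVlt; apply/orP; left; apply/eqP; rewrite /y; ring.
  have lB2 : lam * Bt s ^+ 2 <= C * y.
    by apply: le_trans (ler_wpM2l lam0 (BQ s)) _; rewrite /y mulrCA.
  have lB0 : 0 <= lam * Bt s ^+ 2 by rewrite mulr_ge0 ?sqr_ge0.
  have N1 : `|- (6 * lam * C * Bt s) + 4 * lam ^+ 2 * Bt s ^+ 3| <=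
      (lam * `|Bt s|) * (6 * C + 4 * (lam * Bt s ^+ 2)).
    rewrite [X in `|X| <= _](_ : _ = (lam * Bt s) * (- (6 * C) + 4 * (lam * Bt s ^+ 2)));
      last by ring.
    rewrite normrM [`|lam * _|]normrM (ger0_norm lam0).
    apply: ler_wpM2l; first by rewrite mulr_ge0.
    apply: le_trans (ler_normD _ _) _; rewrite normrN ger0_norm ?mulr_ge0//.
    by rewrite lerD2l ger0_norm// mulr_ge0.
  have N2 : (lam * `|Bt s|) * (6 * C + 4 * (lam * Bt s ^+ 2)) <=
      (c0 * (lam + y) / 2) * (6 * C + 4 * (C * y)).
    apply: ler_pM => //; first by rewrite mulr_ge0.
      by rewrite addr_ge0// mulr_ge0.
    by rewrite lerD2l ler_pM2l.
  have E1 := expR_ge1Dx y; have E2 := @expR_ge1Dxn R y 1 y0.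
  have E2' : 1 + y ^+ 2 / 2 <= expR y by rewrite (le_trans _ E2)// lerD2l.
  have cC0 : 0 <= C * c0 by rewrite mulr_ge0.
  (* The exponential absorbs the polynomial growth in y, so the size of Z drops out. *)
  have N3 : (c0 * (lam + y) / 2) * (6 * C + 4 * (C * y)) <= 8 * (1 + lam) * (C * c0) * expR y.
    rewrite [leLHS](_ : _ = (C * c0) * ((lam + y) * (3 + 2 * y))); last by field.
    rewrite [leRHS](_ : _ = (C * c0) * (8 * (1 + lam) * expR y)); last by ring.
    rewrite ler_wpM2l//.
    have : (lam + y) * (3 + 2 * y) <= 4 * (1 + lam) * (1 + y + y ^+ 2 / 2).
      by have := mulr_ge0 lam0 y0; have := mulr_ge0 lam0 (sqr_ge0 y); nra.
    have : 4 * (1 + lam) * (1 + y + y ^+ 2 / 2) <= 4 * (1 + lam) * (2 * expR y).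
      rewrite ler_wpM2l ?mulr_ge0 ?addr_ge0//; have := sqr_ge0 y; lra.
    lra.
  apply: le_trans (ler_wpM2r (expR_ge0 _) (le_trans N1 (le_trans N2 N3))) _.
  by rewrite -[leLHS]mulrA -expRD -/y subrr expR0 mulr1.
have [c] := @MVT R _ _ 0 1 ltr01 (fun x _ => Dg x) (@derive_segment_continuous _ _ _ _ Dg).
rewrite in_itv/= => /andP[c0' c1']; rewrite subr0 mulr1 => E.
have -> : (B + C) * expR (- (lam * (q + 2 * B + C))) - B * expR (- (lam * q)) = dg c.
  rewrite -E /g /e /Bt /Q !mul1r !mul0r !mulr1 !expr1n !mul1r expr0n/= !mulr0 !mul0r !addr0.
  by [].
have -> : (C - 2 * lam * (B + t * C) ^+ 2) *
  expR (- (lam * (q + 2 * t * B + t ^+ 2 * C))) = dg t by [].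
apply: le_trans (derive_lipschitz c t Ddg Bd) _.
rewrite -[leRHS]mulr1 ler_wpM2l//; first by rewrite !mulr_ge0// addr_ge0.
by rewrite ler_norml; apply/andP; split; lra.
Qed.

End SteinLine.

Section Stein.
Context {R : realType} {n : nat} (beta : 'I_n -> R) (k : nat) (h : nat -> 'I_n -> R).
Notation V := (info beta).
Notation expect := (expect beta).
Hypothesis h_on : forall a b, (a < k)%N -> (b < k)%N -> V (h a) (h b) = (a == b)%:R.
Variable zeta : R.
Hypothesis zeta_ge0 : 0 <= zeta.
Hypothesis zeta_ge : forall p, edge p -> \sum_(a < k) ends (h a) p ^+ 2 <= zeta ^+ 2.

Definition zstat (A : graph n) (a : nat) : R := score A beta (h a).
Definition qstat (A : graph n) : R := \sum_(a < k) zstat A a ^+ 2.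

(** With u_p the vector of the [ends (h a) p], [Bp] is u_p.Z and [Cp] is |u_p|^2. *)
Let Bp (A : graph n) p : R := \sum_(a < k) ends (h a) p * zstat A a.
Let Cp p : R := \sum_(a < k) ends (h a) p ^+ 2.

Lemma qstat_ge0 A : 0 <= qstat A.
Proof. by apply: sumr_ge0 => a _; exact: sqr_ge0. Qed.

Lemma score_upd A q c z : edge q ->
  score (upd A q c) beta z = score (upd A q false) beta z + c%:R * ends z q.
Proof.
move=> eq; rewrite /score (bigD1 q)//= [in RHS](bigD1 q)//= !ffunE eqxx.
rewrite (eq_bigr (fun p => ((upd A q false p)%:R - mu (ends beta p)) * ends z p)); last first.
  by move=> p /andP[_ pq]; rewrite !ffunE (negbTE pq).
by rewrite /= mulr0n; ring.
Qed.

Lemma upd_id (A : graph n) q : upd A q (A q) = A.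
Proof. by apply/ffunP => p; rewrite ffunE; case: eqP => // ->. Qed.

Lemma sum_sqr_lin (z u : 'I_k -> R) t : \sum_a (z a + t * u a) ^+ 2 =
  \sum_a z a ^+ 2 + 2 * t * (\sum_a u a * z a) + t ^+ 2 * \sum_a u a ^+ 2.
Proof. by rewrite !mulr_sumr -!big_split/=; apply: eq_bigr => a _; ring. Qed.

Lemma sum_mul_lin (z u : 'I_k -> R) t : \sum_a u a * (z a + t * u a) =
  \sum_a u a * z a + t * \sum_a u a ^+ 2.
Proof. by rewrite !mulr_sumr -!big_split/=; apply: eq_bigr => a _; ring. Qed.

Lemma cauchy_schwarz (z u : 'I_k -> R) :
  (\sum_a u a * z a) ^+ 2 <= (\sum_a u a ^+ 2) * \sum_a z a ^+ 2.
Proof.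
set B := \sum_a u a * z a; set C := \sum_a u a ^+ 2; set Q := \sum_a z a ^+ 2.
have H t : 0 <= Q + 2 * t * B + t ^+ 2 * C.
  by rewrite -sum_sqr_lin; apply: sumr_ge0 => a _; exact: sqr_ge0.
have C0 : 0 <= C by apply: sumr_ge0 => a _; exact: sqr_ge0.
have [C00|Cn] := eqVneq C 0.
  suff -> : B = 0 by rewrite expr0n/= C00 mul0r.
  apply: big1 => a _; suff -> : u a = 0 by rewrite mul0r.
  apply/eqP; rewrite -sqrf_eq0 eq_le sqr_ge0 andbT -C00 /C (bigD1 a)//= lerDl.
  by apply: sumr_ge0 => b _; exact: sqr_ge0.
have Cp' : 0 < C by rewrite lt_neqAle eq_sym Cn.
have E : C * (Q + 2 * (- (B / C)) * B + (- (B / C)) ^+ 2 * C) = C * Q - B ^+ 2 by field.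
by have := H (- (B / C)); rewrite -(pmulr_rge0 _ Cp') E subr_ge0.
Qed.

(** [A] itself is the end [t = A p] of the segment between its two updates, so the derivative can be
    taken at [A]; the sum over edges then closes up into [qstat A]. *)
Lemma stein_edge lam A p : 0 <= lam -> edge p ->
  `|Bp (upd A p true) p * expR (- (lam * qstat (upd A p true)))
   - Bp (upd A p false) p * expR (- (lam * qstat (upd A p false)))
   - (Cp p - 2 * lam * Bp A p ^+ 2) * expR (- (lam * qstat A))| <=
  8 * (1 + lam) * (Cp p * zeta).
Proof.
move=> lam0 ep; pose z (a : 'I_k) := zstat (upd A p false) a; pose u (a : 'I_k) := ends (h a) p.
have zE c (a : 'I_k) : zstat (upd A p c) a = z a + c%:R * u a by rewrite /zstat score_upd.
have BE c : Bp (upd A p c) p = \sum_a u a * z a + c%:R * Cp p.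
  by rewrite -sum_mul_lin; apply: eq_bigr => a _; rewrite zE.
have qE c : qstat (upd A p c) =
    \sum_a z a ^+ 2 + 2 * c%:R * (\sum_a u a * z a) + c%:R ^+ 2 * Cp p.
  by rewrite -sum_sqr_lin; apply: eq_bigr => a _; rewrite zE.
have C0 : 0 <= Cp p by apply: sumr_ge0 => a _; exact: sqr_ge0.
have BA := BE (A p); have qA := qE (A p); rewrite upd_id in BA qA.
rewrite BA qA !BE !qE.
set B := \sum_a u a * z a; set q := \sum_a z a ^+ 2; set t : R := (A p)%:R.
have t01 : 0 <= t <= 1 by rewrite /t; case: (A p); rewrite /= ?lexx ?ler01.
have q0 : 0 <= q by apply: sumr_ge0 => a _; exact: sqr_ge0.
have S := stein_line lam0 q0 (cauchy_schwarz z u) (sqrtr_ge0 (Cp p))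
  (esym (sqr_sqrtr C0)) t01.
rewrite /= !mulr0 !mul0r !addr0 expr0n/= !mul0r !mul1r !mulr1 !addr0 expr1n mul1r.
apply: le_trans S _; rewrite ler_wpM2l ?mulr_ge0 ?addr_ge0// ler_wpM2l//.
rewrite -(@ler_pXn2r _ 2) ?nnegrE ?sqrtr_ge0// sqr_sqrtr//; exact: zeta_ge.
Qed.

(** Orthonormality says that sum_p v_p u_p u_p^T is the identity; this is its trace, and [sum_Bp] is
    its quadratic form at Z. *)
Lemma sum_Cp : \sum_(p | edge p) edgevar (ends beta p) * Cp p = k%:R.
Proof.
rewrite /Cp; under eq_bigr do rewrite mulr_sumr.
rewrite exchange_big/= (eq_bigr (fun=> 1)) ?sumr_const ?card_ord// => a _.
by have := h_on (ltn_ord a) (ltn_ord a); rewrite eqxx.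
Qed.

Lemma sum_Bp A : \sum_(p | edge p) edgevar (ends beta p) * Bp A p ^+ 2 = qstat A.
Proof.
have -> : \sum_(p | edge p) edgevar (ends beta p) * Bp A p ^+ 2 =
    \sum_(a < k) \sum_(b < k) zstat A a * zstat A b * V (h a) (h b).
  under [RHS]eq_bigr do under eq_bigr do rewrite /info mulr_sumr.
  under [RHS]eq_bigr do rewrite exchange_big/=.
  rewrite exchange_big/=; apply: eq_bigr => p _.
  rewrite /Bp expr2 mulr_suml mulr_sumr; apply: eq_bigr => a _.
  by rewrite mulr_sumr mulr_sumr; apply: eq_bigr => b _; ring.
apply: eq_bigr => a _; rewrite (bigD1 a)//= h_on// eqxx mulr1 big1 ?addr0 ?expr2//.
by move=> b ba; rewrite h_on// val_eqE eq_sym (negbTE ba) mulr0.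
Qed.

Definition laplace lam : R := expect (fun A => expR (- (lam * qstat A))).
Definition laplace1 lam : R := expect (fun A => qstat A * expR (- (lam * qstat A))).

(** |Z|^2 is the sum over edges of (a_p - mu_p) u_p.Z. Integrating by parts in each edge and
    replacing differences by derivatives turns E |Z|^2 e^(- lam |Z|^2) into k F + 2 lam F', where F
    is [laplace]. *)
Lemma stein_identity lam : 0 <= lam ->
  `|k%:R * laplace lam - (1 + 2 * lam) * laplace1 lam| <= 8 * (1 + lam) * (k%:R * zeta).
Proof.
move=> lam0; pose e A := expR (- (lam * qstat A)).
have M1 : laplace1 lam = \sum_(p | edge p) edgevar (ends beta p) *
    expect (fun A => Bp (upd A p true) p * e (upd A p true) -
                     Bp (upd A p false) p * e (upd A p false)).
  rewrite /laplace1.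
  rewrite (@eq_expect _ _ _ _ (fun A => \sum_(p | edge p)
      ((A p)%:R - mu (ends beta p)) * (Bp A p * e A))); last first.
    move=> A; rewrite -/(e A) {1}/qstat mulr_suml.
    under eq_bigr do rewrite expr2 {1}/zstat /score mulr_suml mulr_suml.
    rewrite exchange_big/=; apply: eq_bigr => p _.
    by rewrite /Bp mulr_suml mulr_sumr; apply: eq_bigr => a _; rewrite /zstat; ring.
  rewrite expect_sum; apply: eq_bigr => p ep.
  exact: (expect_by_parts beta (fun A => Bp A p * e A) ep).
have M2 : k%:R * laplace lam - 2 * lam * laplace1 lam = \sum_(p | edge p)
    edgevar (ends beta p) * expect (fun A => (Cp p - 2 * lam * Bp A p ^+ 2) * e A).
  under eq_bigr do rewrite -expectZ.
  rewrite -expect_sum /laplace /laplace1 -!expectZ -mulN1r -expectZ -expectD.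
  apply: eq_expect => A.
  transitivity ((\sum_(p | edge p) edgevar (ends beta p) * Cp p) * e A -
     2 * lam * ((\sum_(p | edge p) edgevar (ends beta p) * Bp A p ^+ 2) * e A)).
    by rewrite sum_Cp sum_Bp /e; ring.
  by rewrite !mulr_suml mulr_sumr -sumrB; apply: eq_bigr => p _; ring.
rewrite (_ : _ - _ = (k%:R * laplace lam - 2 * lam * laplace1 lam) - laplace1 lam); last by ring.
rewrite M2 M1 distrC -sumrB; apply: le_trans (ler_norm_sum _ _ _) _.
rewrite -sum_Cp mulr_suml mulr_sumr; apply: ler_sum => p ep.
rewrite -mulrBr normrM (gtr0_norm (edgevar_gt0 _)).
rewrite [leRHS](_ : _ = edgevar (ends beta p) * (8 * (1 + lam) * (Cp p * zeta))); last by ring.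
rewrite ler_pM2l ?edgevar_gt0//.
rewrite -[- expect _]mulN1r -expectZ -expectD; apply: expect_norm_le => A.
by rewrite mulN1r; exact: stein_edge.
Qed.

Lemma is_derive_laplace (lam : R) : is_derive lam 1 laplace (- laplace1 lam).
Proof.
pose F (A : graph n) (l : R) := bm_weight beta A * expR (- (l * qstat A)).
have D A : is_derive lam 1 (F A) (- (bm_weight beta A * (qstat A * expR (- (lam * qstat A))))).
  by apply: is_derive_eq; rewrite /GRing.scale/=; ring.
have : forall s : seq (graph n), is_derive lam 1 (fun l => \sum_(A <- s) F A l)
    (\sum_(A <- s) - (bm_weight beta A * (qstat A * expR (- (lam * qstat A))))).
  elim=> [|A s IH].
    rewrite big_nil (_ : (fun l => _) = cst 0); last by apply/funext => l; rewrite big_nil.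
    exact: is_derive_cst.
  rewrite big_cons (_ : (fun l => _) = (F A \+ (fun l => \sum_(A <- s) F A l))).
    exact: is_deriveD.
  by apply/funext => l; rewrite big_cons.
by move=> /(_ (index_enum _)); rewrite sumrN.
Qed.

(** Integrating factor: G = (1 + 2 lam)^(k/2) F has G(0) = 1, and its derivative is (1 + 2 lam)^(k/2
    - 1) times the defect in [stein_identity]. *)
Lemma laplace_close lam : 0 <= lam ->
  `|laplace lam - (1 + 2 * lam) `^ (- (k%:R / 2))| <= lam * (8 * (1 + lam) * (k%:R * zeta)).
Proof.
move=> lam0; set K := 8 * (1 + lam) * (k%:R * zeta).
have K0 : 0 <= K by rewrite !mulr_ge0// addr_ge0.
pose G (l : R) := (1 + 2 * l) `^ (k%:R / 2) * laplace l.
pose dG (l : R) := (1 + 2 * l) `^ (k%:R / 2 - 1) * (k%:R * laplace l - (1 + 2 * l) * laplace1 l).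
have pw (l : R) : 0 < 1 + 2 * l -> (1 + 2 * l) `^ (k%:R / 2) =
    (1 + 2 * l) * (1 + 2 * l) `^ (k%:R / 2 - 1).
  move=> l1; rewrite -{2}[1 + 2 * l]powRr1 ?(ltW l1)// -powRD; last first.
    by rewrite (gt_eqF l1) implybT.
  by congr (_ `^ _); ring.
have DG (l : R) : 0 < 1 + 2 * l -> is_derive l 1 G (dG l).
  move=> l1; have D1 := is_derive1_powR (k%:R / 2) l1.
  have Din : is_derive l (1 : R) (fun l : R => 1 + 2 * l) 2.
    by apply: is_derive_eq; rewrite /GRing.scale/=; ring.
  have D2 := @is_derive1_comp R (@powR R ^~ (k%:R / 2)) (fun l => 1 + 2 * l) l _ _ D1 Din.
  have D3 := is_deriveM D2 (is_derive_laplace l).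
  apply: (is_derive_eq D3); rewrite /GRing.scale/= /dG (pw l l1); by field.
have G0 : G 0 = 1.
  rewrite /G mulr0 addr0 powR1 mul1r /laplace.
  rewrite (@eq_expect _ _ _ _ (fun=> 1)) ?expect_cst// => A.
  by rewrite mul0r oppr0 expR0.
have l1 : 0 < 1 + 2 * lam by lra.
have P0 := powR_gt0 (k%:R / 2) l1.
have [->|lamn] := eqVneq lam 0.
  rewrite mulr0 addr0 powR1 mul0r; move: G0; rewrite /G mulr0 addr0 powR1 mul1r => ->.
  by rewrite subrr normr0.
have lamp : 0 < lam by rewrite lt_neqAle eq_sym lamn.
have [||c] := @MVT R G dG 0 lam lamp.
- by move=> x; rewrite in_itv/= => /andP[x0 _]; apply: DG; lra.
- apply: continuous_in_subspaceT => x; rewrite inE/= in_itv/= => /andP[x0 _].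
  by apply/differentiable_continuous/derivable1_diffP; case: (DG x _) => //; lra.
rewrite in_itv/= => /andP[c0 cl]; rewrite G0 subr0 => E.
have c1 : 0 < 1 + 2 * c by lra.
have B : `|dG c| <= (1 + 2 * lam) `^ (k%:R / 2) * K.
  rewrite normrM ger0_norm ?powR_ge0//; apply: ler_pM; rewrite ?powR_ge0//.
    apply: (@le_trans _ _ ((1 + 2 * c) `^ (k%:R / 2))).
      by rewrite (pw c c1) ler_peMl ?powR_ge0//; lra.
    by apply: ge0_ler_powR; rewrite ?nnegrE ?divr_ge0//; lra.
  apply: le_trans (stein_identity (ltW c0)) _.
  by rewrite ler_wpM2r ?mulr_ge0// ler_pM2l// lerD2l ltW.
rewrite powRN -(ler_pM2l P0) -{1}(gtr0_norm P0) -normrM mulrBr mulfV ?gt_eqF//.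
rewrite -/(G lam) E normrM (gtr0_norm lamp) mulrC [leRHS]mulrCA ler_pM2l//.
Qed.

End Stein.

(** * Deterministic bounds on the likelihood ratio when residuals are small *)

Section RatioBounds.
Context {R : realType} {n : nat} (A : graph n) (beta : 'I_n -> R).
Variables (E : rel 'I_n) (F : pred 'I_n) (k : nat) (h : nat -> 'I_n -> R).
Variables (b Xi H1 m : R).
Notation V := (info beta).
Notation N := (@tied R n E F).
Let tau : R := @sup_radius R n b Xi.
Let eta : R := 2 * tau ^+ 2 * n%:R * H1.
Let om : R := k%:R * ((Xi * H1 + eta) * m).
Hypothesis b_gt0 : 0 < b.
Hypothesis n_ge3 : (2 < n)%N.
Hypothesis edgevar_ge : forall p, edge p -> b^-1 <= edgevar (ends beta p).
Hypothesis Xi_gt0 : 0 < Xi.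
Hypothesis residual_le : forall i, `|residual A beta i| <= Xi.
Hypothesis tau_le : tau <= 4^-1.
Hypothesis h_on : forall a b, (a < k)%N -> (b < k)%N -> V (h a) (h b) = (a == b)%:R.
Hypothesis h_perp : forall a y, (a < k)%N -> N y -> V (h a) y = 0.
Hypothesis h_proj : forall z, N (orthoproj V h k z).
Hypothesis h_l1 : forall a, (a < k)%N -> \sum_i `|h a i| <= H1.
Hypothesis h_sup : forall a i, (a < k)%N -> `|h a i| <= m.

(** Expanding the square of s + (z - s), the cross term is at most 2 |s| e <= e (s^2 + 1). *)
Lemma sqr_perturb (s z e : R) : 0 <= e -> `|s - z| <= e ->
  z ^+ 2 <= (1 + e) * s ^+ 2 + (e ^+ 2 + e).
Proof.
rewrite ler_norml => e0 /andP[l1 l2].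
by have := sqr_ge0 (s - 1); have := sqr_ge0 (s + 1); nra.
Qed.

Lemma ratio_bounds : exists g g0 SS,
  [/\ is_maximizer A [set: 'I_n -> R] g,
      is_maximizer A [set g | N (fun i => g i - beta i)] g0,
      (2 - expR (2 * (tau + om))) * SS <= 2 * (loglik A g - loglik A g0)
        <= expR (2 * tau) * SS,
      qstat beta k h A <= (1 + eta) * SS + k%:R * (eta ^+ 2 + eta) &
      0 <= SS <= (1 + eta) * qstat beta k h A + k%:R * (eta ^+ 2 + eta)].
Proof.
have tau2 : tau < 2^-1 by apply: le_lt_trans tau_le _; lra.
have [x0 [Nx0 x0b x0s]] := constrained_mle E F b_gt0 n_ge3 edgevar_ge Xi_gt0 residual_le tau2.
(* No ties and no zeros: the unconstrained maximizer comes from the same construction on the whole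
   space. *)
have [x1 [_ x1b x1s]] := constrained_mle (fun _ _ => false) pred0 b_gt0 n_ge3 edgevar_ge
  Xi_gt0 residual_le tau2.
have {}x1s z : score A (fun i => beta i + x1 i) z = 0 by apply: x1s; split.
have V_pos := info_pos b_gt0 n_ge3 edgevar_ge.
pose s (a : 'I_k) := score A (fun i => beta i + x0 i) (h a).
have n0 : 0 <= n%:R :> R by [].
have H10 a : (a < k)%N -> 0 <= H1 by move=> /h_l1; apply: le_trans; apply: sumr_ge0.
have eta0 a : (a < k)%N -> 0 <= eta.
  by move=> /H10 ?; rewrite /eta mulr_ge0// mulr_ge0// mulr_ge0// sqr_ge0.
have sz (a : 'I_k) : `|s a - zstat beta h A a| <= eta.
  have P := score_perturbation A h_perp Nx0 x0b (ltn_ord a) tau_le; apply: le_trans P _.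
  by apply: ler_wpM2l; [rewrite mulr_ge0// mulr_ge0// sqr_ge0|exact: h_l1].
(* The score at [beta] is a pairing with the residuals: sup norm times l1 norm. This bound ends up
   in [om], the size of the competitor of [loglik_ratio_ge]. *)
have zb (a : 'I_k) : `|zstat beta h A a| <= Xi * H1.
  rewrite /zstat score_residual; apply: le_trans (ler_norm_sum _ _ _) _.
  apply: (@le_trans _ _ (Xi * \sum_i `|h a i|)); last by rewrite ler_pM2l// h_l1.
  by rewrite mulr_sumr; apply: ler_sum => i _; rewrite normrM mulrC ler_wpM2r.
have sb (a : 'I_k) : `|s a| <= Xi * H1 + eta.
  rewrite -[s a](subrK (zstat beta h A a)) addrC.
  by apply: le_trans (ler_normD _ _) _; rewrite lerD.
have omb i : `|\sum_(a < k) s a * h a i| <= om.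
  apply: le_trans (ler_norm_sum _ _ _) _.
  rewrite /om mulr_natl -[X in _ *+ X](card_ord k) -sumr_const.
  apply: ler_sum => a _; rewrite normrM; apply: ler_pM => //; exact: h_sup.
exists (fun i => beta i + x1 i), (fun i => beta i + x0 i), (\sum_a s a ^+ 2).
split.
- by split => // g _; apply: score0_max; exact: x1s.
- split => /=.
    by rewrite (_ : (fun i => _) = x0)//; apply/funext => i; ring.
  move=> g Ng; apply: score0_max; apply: x0s.
  have := tied_lin (-1) Ng Nx0; rewrite (_ : (fun i => _) = (fun i => g i - (beta i + x0 i)))//.
  by apply/funext => i; ring.
- apply/andP; split.
    exact: (loglik_ratio_ge h_on x1s x0b omb).
  exact: (loglik_ratio_le V_pos h_on h_proj x0s x0b x1b).
- rewrite mulr_sumr mulr_natl -[X in _ *+ X](card_ord k) -sumr_const -big_split/=.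
  by apply: ler_sum => a _; apply: sqr_perturb => //; exact: eta0 (ltn_ord a).
- apply/andP; split; first by apply: sumr_ge0 => a _; exact: sqr_ge0.
  rewrite mulr_sumr mulr_natl -[X in _ *+ X](card_ord k) -sumr_const -big_split/=.
  apply: ler_sum => a _; apply: sqr_perturb; first exact: eta0 (ltn_ord a).
  by rewrite distrC.
Qed.

End RatioBounds.

(** * Rates *)

Section Rates.
Context {R : realType}.

Lemma b_n_ge n (beta : 'I_n -> R) i j : j != i -> bterm (beta i + beta j) <= b_n beta.
Proof.
move=> ji; apply: le_trans (le_bigmax _ _ i).
exact: (le_bigmax_cond _ (fun j => bterm (beta i + beta j))).
Qed.

Lemma edgevar_ge_b_n n (beta : 'I_n -> R) p : edge p ->
  (b_n beta)^-1 <= edgevar (ends beta p).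
Proof.
case: p => i j; rewrite /edge /ends/= => ij.
have ji : j != i by rewrite -val_eqE/= gtn_eqF.
have H := b_n_ge beta ji; rewrite lef_pV2 ?posrE ?bterm_gt0//.
exact: lt_le_trans (bterm_gt0 _) H.
Qed.

Lemma b_n_ge4 n (beta : 'I_n -> R) : (1 < n)%N -> 4 <= b_n beta.
Proof.
move=> n1; have n0 : (0 < n)%N by apply: ltnW.
have ji : Ordinal n1 != Ordinal n0 by [].
by apply: le_trans (b_n_ge beta ji); exact: bterm_ge4.
Qed.

Lemma c_n_le n (beta : 'I_n -> R) : c_n beta <= b_n beta.
Proof. exact: bigmin_le_id. Qed.

Lemma c_n_ge4 n (beta : 'I_n -> R) : (1 < n)%N -> 4 <= c_n beta.
Proof.
move=> n1; have b4 := b_n_ge4 beta n1.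
have M (x y : R) : 4 <= x -> 4 <= y -> 4 <= Num.min x y by move=> ? ?; rewrite le_min; apply/andP.
apply: (big_ind (fun x => 4 <= x)) => // i _.
by apply: (big_ind (fun x => 4 <= x)) => // j _; exact: bterm_ge4.
Qed.

Variable beta : forall n, 'I_n -> R.
Hypothesis rate : (fun n : nat => (b_n (@beta n) ^+ 3 / c_n (@beta n)) /
                  (n%:R `^ (1 / 6 : R) / ln (n%:R : R))) @ \oo --> (0 : R).

(** The order of the bound on [eta_rate], the largest of the error rates; the others are reduced to
    it. *)
Definition smallness n : R := b_n (@beta n) ^+ 4 * ln n%:R / Num.sqrt n%:R.

Lemma near_ln_ge1 : \forall n \near \oo, 1 <= ln (n%:R : R).
Proof.
near=> n.
have H : expR 1 <= n%:R :> R by near: n; exact: nbhs_infty_ger.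
rewrite -[leLHS](expRK 1) ler_ln ?posrE ?expR_gt0//.
exact: lt_le_trans (expR_gt0 _) H.
Unshelve. all: by end_near. Qed.

Lemma smallness_ge0 n : 0 <= smallness n.
Proof.
rewrite divr_ge0 ?sqrtr_ge0// mulr_ge0 ?exprn_even_ge0//.
have [->|n0] := eqVneq n 0%N; first by rewrite ln0.
by rewrite ln_ge0// ler1n lt0n.
Qed.

(** As c_n <= b_n, the hypothesis gives b^2 L / t -> 0 with t = n^(1/6) and L = log n. Its square
    b^4 L^2 / t^2 dominates b^4 L / t^3, because t and L are at least 1, and sqrt n = t^3. *)
Lemma smallness_cvg0 : smallness n @[n --> \oo] --> 0.
Proof.
pose kap := (fun n : nat => (b_n (@beta n) ^+ 3 / c_n (@beta n)) /
                  (n%:R `^ (1 / 6 : R) / ln (n%:R : R))).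
have rate2 : kap n ^+ 2 @[n --> \oo] --> 0.
  rewrite -[X in _ --> X](expr0n R 2).
  exact: (cvg_comp kap (fun x => x ^+ 2) rate (@exprn_continuous R 2 0)).
apply: (squeeze_cvgr (f := fun=> 0) (h := fun n => kap n ^+ 2)) rate2; last exact: cvg_cst.
near=> n; rewrite smallness_ge0/=.
have n1 : (1 < n)%N by near: n; exists 2.
have L1 : 1 <= ln (n%:R : R) by near: n; exact: near_ln_ge1.
have b4 := b_n_ge4 (@beta n) n1; have c4 := c_n_ge4 (@beta n) n1.
have cb := c_n_le (@beta n).
rewrite /smallness /kap; set b := b_n _ in b4 cb *; set c := c_n _ in c4 cb *.
set L := ln _ in L1 *; set t := n%:R `^ (1 / 6).
have nR : 0 < n%:R :> R by rewrite ltr0n; apply: ltnW.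
have t1 : 1 <= t.
  rewrite /t -[leLHS](powRr0 n%:R); apply: ler_powR; first by rewrite ler1n ltnW.
  by rewrite divr_ge0.
have sE : Num.sqrt n%:R = t ^+ 3 :> R.
  rewrite -powR12_sqrt ?(ltW nR)// /t -powR_mulrn ?powR_ge0// -powRrM; congr (_ `^ _).
  by field.
rewrite sE.
have t0 : 0 < t by apply: lt_le_trans t1.
have c0 : 0 < c by lra.
have b0 : 0 < b by lra.
apply: (@le_trans _ _ ((b ^+ 2 / (t / L)) ^+ 2)); last first.
  have q0 : 0 <= (t / L)^-1 by rewrite invr_ge0 divr_ge0 ?(ltW t0)//; lra.
  have bc : b ^+ 2 <= b ^+ 3 / c.
    rewrite ler_pdivlMr// (_ : b ^+ 3 = b ^+ 2 * b); last by ring.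
    by rewrite ler_wpM2l// sqr_ge0.
  have B := ler_wpM2r q0 bc; have B0 : 0 <= b ^+ 2 / (t / L) by rewrite mulr_ge0// sqr_ge0.
  by rewrite lerXn2r ?nnegrE//; exact: le_trans B.
rewrite (_ : b ^+ 4 * L / t ^+ 3 = b ^+ 4 * L * t^-1 / t ^+ 2); last by field; rewrite gt_eqF.
rewrite (_ : (b ^+ 2 / (t / L)) ^+ 2 = b ^+ 4 * L * L / t ^+ 2); last first.
  by field; rewrite !gt_eqF//; lra.
rewrite ler_wpM2r ?invr_ge0 ?sqr_ge0// ler_wpM2l//.
  by rewrite mulr_ge0 ?exprn_ge0//; lra.
by apply: le_trans L1; rewrite invf_le1.
Unshelve. all: by end_near. Qed.

(** In [residual_tail] the best [s] is Xi / (2 n), with exponent - Xi^2 / (4 n) = - 2 log n; against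
    the factor 2 n this leaves probability 2 / n. *)
Definition Xi_rate n : R := Num.sqrt (8 * n%:R * ln n%:R).
Definition sup_rate n : R := Num.sqrt (b_n (@beta n) / (n%:R - 2)).
Definition l1_rate r n : R := (1 + b_n (@beta n)) * r%:R * sup_rate n.
Definition tau_rate n : R := @sup_radius R n (b_n (@beta n)) (Xi_rate n).
Definition eta_rate r n : R := 2 * tau_rate n ^+ 2 * n%:R * l1_rate r n.
Definition om_rate r k n : R :=
  k%:R * ((Xi_rate n * l1_rate r n + eta_rate r n) * sup_rate n).
Definition zeta_rate k n : R := Num.sqrt (k%:R * (4 * (b_n (@beta n) / (n%:R - 2)))).

(** 1800 is 5^2 times 8 times 3^2: from [sup_radius], from [Xi_rate] and from 1 / (n - 2) <= 3 /
    n. *)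
Let c1 : R := 1800 * expR 1 ^+ 2.

Lemma rate_bounds r k n : (2 < n)%N -> 1 <= ln (n%:R : R) ->
  [/\ tau_rate n ^+ 2 <= c1 * smallness n,
      eta_rate r n <= 8 * c1 * r%:R * smallness n,
      sup_rate n ^+ 2 <= 3 * smallness n,
      (Xi_rate n * l1_rate r n * sup_rate n) ^+ 2 <= 288 * r%:R ^+ 2 * smallness n &
      zeta_rate k n ^+ 2 <= 12 * k%:R * smallness n].
Proof.
move=> n2 L1; have n1 : (1 < n)%N by apply: ltnW.
have b4 := b_n_ge4 (@beta n) n1.
have Xi2 : Xi_rate n ^+ 2 = 8 * n%:R * ln n%:R.
  by rewrite sqr_sqrtr// !mulr_ge0//; lra.
have N3 : 3 <= n%:R :> R by rewrite (ler_nat R 3).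
rewrite /tau_rate /eta_rate /l1_rate /tau_rate /zeta_rate /sup_radius /smallness.
set b := b_n _ in b4 *; set L := ln _ in L1 Xi2 *; set N : R := n%:R in N3 Xi2 *.
set Xi := Xi_rate n in Xi2 *; set s := Num.sqrt N; set m := sup_rate n.
have N0 : 0 < N by lra.
have N20 : 0 < N - 2 by lra.
have b0 : 0 < b by lra.
have s2 : s ^+ 2 = N by rewrite sqr_sqrtr// ltW.
have s0 : 0 < s by rewrite sqrtr_gt0.
have s1 : 1 <= s by rewrite -(@ler_pXn2r _ 2) ?nnegrE// ?(ltW s0)// s2 expr1n; lra.
have m2 : m ^+ 2 = b / (N - 2) by rewrite sqr_sqrtr// divr_ge0// ltW.
have m0 : 0 <= m by exact: sqrtr_ge0.
set w := b ^+ 4 * L / s.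
have L0 : 0 < L by lra.
have w0 : 0 < w by rewrite divr_gt0// mulr_gt0// exprn_gt0.
have iN2 : (N - 2)^-1 <= 3 / N by rewrite -div1r ler_pdivrMr// mulrAC ler_pdivlMr//; lra.
have m3 : m ^+ 2 <= 3 * b / N.
  by rewrite m2 [leRHS](_ : _ = b * (3 / N)) ?ler_pM2l//; ring.
have b1 : 1 <= b by lra.
have e1 j : 1 <= b ^+ j by rewrite exprn_ege1.
have b3L : 1 <= b ^+ 3 * L by apply: mulr_ege1.
have b2s : 1 <= b ^+ 2 * s by apply: mulr_ege1.
have bN : b / N <= w.
  rewrite ler_pdivrMr// /w -s2 (_ : _ * s ^+ 2 = b * (b ^+ 3 * L * s)); last first.
    by field; rewrite gt_eqF.
  by rewrite ler_peMr ?(ltW b0)//; apply: mulr_ege1.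
have b2N : b ^+ 2 * L / N <= w.
  rewrite ler_pdivrMr// /w -s2 (_ : _ * s ^+ 2 = (b ^+ 2 * L) * (b ^+ 2 * s)); last first.
    by field; rewrite gt_eqF.
  by rewrite ler_peMr// mulr_ge0 ?(ltW L0)// sqr_ge0.
have b4N : b ^+ 4 * L / N <= w.
  rewrite ler_pdivrMr// /w -s2 (_ : _ * s ^+ 2 = (b ^+ 4 * L) * s); last first.
    by field; rewrite gt_eqF.
  by rewrite ler_peMr// mulr_ge0 ?(ltW L0)// (le_trans ler01).
have tau2 : (5 * expR 1 * b * Xi / (N - 2)) ^+ 2 <= c1 * (b ^+ 2 * L / N).
  rewrite (_ : _ ^+ 2 = 25 * expR 1 ^+ 2 * b ^+ 2 * Xi ^+ 2 * (N - 2)^-1 ^+ 2); last by ring.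
  rewrite Xi2 /c1 [leRHS](_ : _ = 25 * expR 1 ^+ 2 * b ^+ 2 * (8 * N * L) * (3 / N) ^+ 2).
    rewrite ler_wpM2l ?lerXn2r ?nnegrE ?invr_ge0 ?divr_ge0 ?(ltW N20) ?(ltW N0)//.
    by rewrite !mulr_ge0 ?exprn_ge0 ?expR_ge0 ?(ltW L0) ?(ltW b0) ?(ltW N0).
  by field; rewrite gt_eqF.
have c10 : 0 <= c1 by apply: mulr_ge0; [exact: ler0n|exact/exprn_ge0/expR_ge0].
have mb : m <= 2 * b / s.
  rewrite -(@ler_pXn2r _ 2) ?nnegrE ?divr_ge0 ?mulr_ge0 ?(ltW b0) ?(ltW s0)//.
  apply: le_trans m3 _; rewrite expr_div_n s2 ler_wpM2r ?invr_ge0 ?(ltW N0)//; nra.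
have r0 : 0 <= r%:R :> R by [].
split.
- by apply: le_trans tau2 _; rewrite ler_wpM2l.
- rewrite (_ : 8 * c1 * r%:R * w =
     (2 * (c1 * (b ^+ 2 * L / N)) * N) * (2 * b * r%:R * (2 * b / s))); last first.
    by rewrite /w; field; rewrite !gt_eqF.
  have t0 := sqr_ge0 (5 * expR 1 * b * Xi / (N - 2)).
  apply: ler_pM.
  + by rewrite mulr_ge0 ?(ltW N0)// mulr_ge0.
  + by rewrite mulr_ge0// mulr_ge0// addr_ge0// ltW.
  + by rewrite ler_wpM2r ?(ltW N0)// ler_pM2l.
  + apply: ler_pM => //; first by rewrite mulr_ge0// addr_ge0// ltW.
    by rewrite ler_wpM2r//; lra.
- by apply: le_trans m3 _; rewrite -mulrA ler_pM2l.
- rewrite (_ : _ ^+ 2 = r%:R ^+ 2 * ((1 + b) ^+ 2 * Xi ^+ 2 * (m ^+ 2) ^+ 2)); last by ring.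
  rewrite [leRHS](_ : _ = r%:R ^+ 2 * (288 * w)); last by ring.
  rewrite ler_wpM2l ?sqr_ge0//.
  (* 288 is 2^2 times 8 times 3^2: from 1 + b <= 2 b, from the square of [Xi], and from m^2 <= 3 b /
     n. *)
  apply: (@le_trans _ _ ((2 * b) ^+ 2 * Xi ^+ 2 * (3 * b / N) ^+ 2)).
    have bb : (1 + b) ^+ 2 <= (2 * b) ^+ 2 by rewrite lerXn2r ?nnegrE//; lra.
    have mm : (m ^+ 2) ^+ 2 <= (3 * b / N) ^+ 2.
      rewrite lerXn2r ?nnegrE ?sqr_ge0//.
      by apply: divr_ge0; [apply: mulr_ge0 => //; exact: ltW|exact: ltW].
    apply: ler_pM => //; [|exact: sqr_ge0|by apply: ler_wpM2r => //; exact: sqr_ge0].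
    by apply: mulr_ge0; exact: sqr_ge0.
  rewrite Xi2 [leLHS](_ : _ = 288 * (b ^+ 4 * L / N)).
    by apply: ler_wpM2l => //; exact: ler0n.
  by field; rewrite gt_eqF.
- rewrite sqr_sqrtr; last by rewrite mulr_ge0// mulr_ge0// divr_ge0// ltW.
  rewrite -m2 [leRHS](_ : _ = k%:R * (4 * (3 * w))); last by ring.
  rewrite ler_wpM2l// ler_pM2l//; apply: le_trans m3 _.
  by rewrite -mulrA ler_pM2l.
Qed.

Lemma cvg0_of_sqr (u : nat -> R) (C : R) : (\forall n \near \oo, 0 <= u n) ->
  (\forall n \near \oo, u n ^+ 2 <= C * smallness n) -> u n @[n --> \oo] --> 0.
Proof.
move=> u0 uC.
have S : Num.sqrt (C * smallness n) @[n --> \oo] --> 0.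
  have CS : C * smallness n @[n --> \oo] --> 0.
    rewrite -[X in _ --> X](mulr0 C); apply: cvgM; first exact: cvg_cst.
    exact: smallness_cvg0.
  have := cvg_comp (fun n => C * smallness n) (@Num.sqrt R) CS (@sqrt_continuous R 0).
  by rewrite sqrtr0.
apply: (squeeze_cvgr (f := fun=> 0)) S; last exact: cvg_cst.
near=> n; apply/andP; split; first by near: n.
have un : 0 <= u n by near: n.
rewrite -(ger0_norm un) -sqrtr_sqr ler_wsqrtr//.
by near: n.
Unshelve. all: by end_near. Qed.

Lemma sup_rate_ge0 n : 0 <= sup_rate n. Proof. exact: sqrtr_ge0. Qed.

Lemma tau_rate_ge0 n : (2 < n)%N -> 0 <= tau_rate n.
Proof.
move=> n2; have b4 := b_n_ge4 (@beta n) (ltnW n2).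
have N3 : 3 <= n%:R :> R by rewrite (ler_nat R 3).
rewrite divr_ge0 ?mulr_ge0 ?expR_ge0 ?sqrtr_ge0//; lra.
Qed.

Lemma l1_rate_ge0 r n : (2 < n)%N -> 0 <= l1_rate r n.
Proof.
move=> n2; have b4 := b_n_ge4 (@beta n) (ltnW n2).
by rewrite mulr_ge0 ?sup_rate_ge0// mulr_ge0// addr_ge0//; lra.
Qed.

Lemma eta_rate_ge0 r n : (2 < n)%N -> 0 <= eta_rate r n.
Proof.
by move=> n2; rewrite mulr_ge0 ?l1_rate_ge0// mulr_ge0// mulr_ge0// sqr_ge0.
Qed.

Lemma tau_rate_cvg0 : tau_rate n @[n --> \oo] --> 0.
Proof.
apply: (@cvg0_of_sqr _ c1); near=> n.
  by apply: tau_rate_ge0; near: n; exists 3.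
have [||//] := @rate_bounds 0 0 n; first by near: n; exists 3.
by near: n; exact: near_ln_ge1.
Unshelve. all: by end_near. Qed.

Lemma zeta_rate_cvg0 k : zeta_rate k n @[n --> \oo] --> 0.
Proof.
apply: (@cvg0_of_sqr _ (12 * k%:R)); near=> n; first exact: sqrtr_ge0.
have [||//] := @rate_bounds 0 k n; first by near: n; exists 3.
by near: n; exact: near_ln_ge1.
Unshelve. all: by end_near. Qed.

Lemma eta_rate_cvg0 r : eta_rate r n @[n --> \oo] --> 0.
Proof.
have S : 8 * c1 * r%:R * smallness n @[n --> \oo] --> 0.
  rewrite -[X in _ --> X](mulr0 (8 * c1 * r%:R)); apply: cvgM; first exact: cvg_cst.
  exact: smallness_cvg0.
apply: (squeeze_cvgr (f := fun=> 0)) S; last exact: cvg_cst.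
near=> n; apply/andP; split; first by apply: eta_rate_ge0; near: n; exists 3.
have [||//] := @rate_bounds r 0 n; first by near: n; exists 3.
by near: n; exact: near_ln_ge1.
Unshelve. all: by end_near. Qed.

Lemma om_rate_cvg0 r k : om_rate r k n @[n --> \oo] --> 0.
Proof.
have S1 : Xi_rate n * l1_rate r n * sup_rate n @[n --> \oo] --> 0.
  apply: (@cvg0_of_sqr _ (288 * r%:R ^+ 2)); near=> n.
    apply: mulr_ge0; last exact: sqrtr_ge0.
    apply: mulr_ge0; first exact: sqrtr_ge0.
    by apply: l1_rate_ge0; near: n; exists 3.
  have [||//] := @rate_bounds r 0 n; first by near: n; exists 3.
  by near: n; exact: near_ln_ge1.
have S2 : sup_rate n @[n --> \oo] --> 0.
  apply: (@cvg0_of_sqr _ 3); near=> n; first exact: sup_rate_ge0.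
  have [||//] := @rate_bounds r 0 n; first by near: n; exists 3.
  by near: n; exact: near_ln_ge1.
rewrite -[X in _ --> X](mulr0 k%:R); apply: cvgM; first exact: cvg_cst.
rewrite -[X in _ --> X](addr0 0); under eq_fun do rewrite mulrDl.
apply: cvgD => //; rewrite -[X in _ --> X](mulr0 0).
by apply: cvgM => //; exact: eta_rate_cvg0.
Unshelve. all: by end_near. Qed.

End Rates.

Section NearLe.
Context {R : realType}.

Lemma cvg_near_le (u : nat -> R) (l c : R) : u n @[n --> \oo] --> l -> l < c ->
  \forall n \near \oo, u n <= c.
Proof.
move=> /cvgrPdist_le H lc; have c0 : 0 < c - l by rewrite subr_gt0.
apply: filterS (H _ c0) => n; rewrite ler_norml => /andP[+ _].
by rewrite opprB => ?; lra.
Qed.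

End NearLe.

(** * Convergence of the likelihood ratio *)

Section Wilks.
Context {R : realType} (beta : forall n, 'I_n -> R) (r k n0 : nat).
Variables (E : forall n, rel 'I_n) (F : forall n, pred 'I_n) (f : forall n, nat -> 'I_n -> R).
Hypothesis rate : (fun n : nat => (b_n (@beta n) ^+ 3 / c_n (@beta n)) /
                  (n%:R `^ (1 / 6 : R) / ln (n%:R : R))) @ \oo --> (0 : R).
Hypothesis k_gt0 : (0 < k)%N.
Hypothesis tied_null : forall n, (n0 <= n)%N -> forall x : 'I_n -> R,
  tied (@E n) (@F n) x <-> nullsp (@f n) k x.
Hypothesis f_indep : forall n a, (n0 <= n)%N -> (a < k)%N ->
  exists2 z, nullsp (@f n) a z & dot (@f n a) z != 0.
Hypothesis tied_zero : forall n (y : 'I_n -> R),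
  (forall i : 'I_n, (i < r)%N -> y i = 0) -> tied (@E n) (@F n) y.

Let S0 n : set ('I_n -> R) := [set g | tied (@E n) (@F n) (fun i => g i - @beta n i)].

(** The size conditions sit inside the existential, so that contrasts can be chosen for every [n];
    for small [n] they are a dummy. *)
Lemma exists_contrasts n : exists h : nat -> 'I_n -> R, (2 < n)%N -> (n0 <= n)%N ->
  [/\ forall a b, (a < k)%N -> (b < k)%N -> info (@beta n) (h a) (h b) = (a == b)%:R,
      forall a y, (a < k)%N -> tied (@E n) (@F n) y -> info (@beta n) (h a) y = 0,
      forall z, tied (@E n) (@F n) (orthoproj (info (@beta n)) h k z),
      forall a, (a < k)%N -> \sum_i `|h a i| <= l1_rate beta r n &
      forall a i, (a < k)%N -> `|h a i| <= sup_rate beta n].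
Proof.
have [n2|n2] := ltnP 2 n; last by exists (fun _ _ => 0).
have [nn0|nn0] := leqP n0 n; last by exists (fun _ _ => 0).
have b4 := b_n_ge4 (@beta n) (ltnW n2).
have b0 : 0 < b_n (@beta n) by lra.
have eb p := @edgevar_ge_b_n R n (@beta n) p.
have [h [h1 h2 h3]] := orthonormal_complement (@info_sym R n (@beta n))
  (@info_lin R n (@beta n)) (info_pos b0 n2 eb) (info_riesz b0 n2 eb)
  (fun a ak => f_indep nn0 ak).
exists h => _ _.
have h2' a y : (a < k)%N -> tied (@E n) (@F n) y -> info (@beta n) (h a) y = 0.
  by move=> ak /(tied_null nn0); exact: h2.
split => //.
- by move=> z; apply/(tied_null nn0); exact: h3.
(* Vectors vanishing on the first [r] nodes satisfy the constraints, hence are orthogonal to [h a];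
   this localizes [h a]. *)
- move=> a ak; apply: (l1_bound b0 n2 eb); first by rewrite h1// eqxx.
  by move=> y /tied_zero; exact: h2'.
- move=> a i ak; rewrite -(@ler_pXn2r _ 2) ?nnegrE ?sqrtr_ge0//.
  rewrite real_normK ?num_real// sqr_sqrtr.
    by have := info_sup b0 n2 eb (h a) i; rewrite h1// eqxx mulr1.
  rewrite divr_ge0 ?(ltW b0)// subr_ge0 (ler_nat R 2) ltnW//.
Qed.

Definition contrasts n : nat -> 'I_n -> R := projT1 (cid (exists_contrasts n)).

Let contrastsP n := projT2 (cid (exists_contrasts n)) : (2 < n)%N -> (n0 <= n)%N -> _.

Let Q n (A : graph n) : R := qstat (@beta n) k (@contrasts n) A.

Let good n (A : graph n) : Prop := forall i, `|residual A (@beta n) i| <= Xi_rate n.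

Lemma good_prob : \forall n \near \oo,
  bm_prob (@beta n) (fun A => ~ good A) <= 2 / n%:R.
Proof.
near=> n.
have n2 : (2 < n)%N by near: n; exists 3.
have L1 : 1 <= ln (n%:R : R) by near: n; exact: near_ln_ge1.
have w1 : smallness beta n <= 8^-1.
  by near: n; apply: cvg_near_le (smallness_cvg0 rate) _; rewrite invr_gt0.
have N0 : 0 < n%:R :> R by rewrite ltr0n; apply: leq_trans n2.
set L := ln n%:R in L1.
(* Keeps the Chernoff parameter [s] below 1/2; smallness <= 1/8 gives 8 L <= sqrt n <= n. *)
have L8 : 8 * L <= n%:R.
  move: w1; rewrite /smallness -/L; set s := Num.sqrt _.
  have s2 : s ^+ 2 = n%:R by rewrite sqr_sqrtr// ltW.
  have s1 : 1 <= s.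
    rewrite -(@ler_pXn2r _ 2) ?nnegrE ?sqrtr_ge0// s2 expr1n.
    by rewrite ler1n; apply: leq_trans n2.
  have s0 : 0 < s by lra.
  rewrite ler_pdivrMr// => H.
  have b4 := b_n_ge4 (@beta n) (ltnW n2).
  have : 1 <= b_n (@beta n) ^+ 4 by rewrite exprn_ege1//; lra.
  rewrite -s2; nra.
pose s : R := Xi_rate n / (2 * n%:R).
have X0 : 0 <= Xi_rate n :> R by exact: sqrtr_ge0.
have L0 : 0 <= L by lra.
have X2 : Xi_rate n ^+ 2 = 8 * n%:R * L by rewrite sqr_sqrtr// mulr_ge0// mulr_ge0.
have s01 : 0 <= s <= 2^-1.
  rewrite /s divr_ge0 ?mulr_ge0// ler_pdivrMr ?mulr_gt0// mulrA mulVf// mul1r.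
  rewrite -(@ler_pXn2r _ 2) ?nnegrE// X2; nra.
apply: (@le_trans _ _ (bm_prob (@beta n) (fun A =>
    exists i, Xi_rate n < `|residual A (@beta n) i|))).
  apply: le_bm_prob => A /existsNP[i /negP]; rewrite -ltNge => H; by exists i.
apply: le_trans (residual_tail (@beta n) (Xi_rate n) s01) _.
rewrite (_ : - (s * Xi_rate n) + s ^+ 2 * n%:R = - L + - L).
  rewrite expRD expRN /L lnK ?posrE//.
  by rewrite le_eqVlt; apply/orP; left; apply/eqP; field; rewrite gt_eqF.
rewrite /s (_ : - _ + _ = - (Xi_rate n ^+ 2) / (4 * n%:R)); last by field; rewrite gt_eqF.
by rewrite X2; field; rewrite gt_eqF.
Unshelve. all: by end_near. Qed.

Lemma contrast_sup n p a : (2 < n)%N -> (n0 <= n)%N -> (a < k)%N ->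
  ends (@contrasts n a) p ^+ 2 <= 4 * (b_n (@beta n) / (n%:R - 2)).
Proof.
move=> n2 nn0 ak; have [_ _ _ _ hs] := contrastsP n2 nn0.
have b4 := b_n_ge4 (@beta n) (ltnW n2).
have N3 : 3 <= n%:R :> R by rewrite (ler_nat R 3).
have -> : 4 * (b_n (@beta n) / (n%:R - 2)) = (2 * sup_rate beta n) ^+ 2.
  by rewrite exprMn sqr_sqrtr ?divr_ge0//; [ring|lra|lra].
rewrite -real_normK ?num_real// lerXn2r ?nnegrE ?mulr_ge0 ?sqrtr_ge0//.
by apply: ends_le => i; exact: hs.
Qed.

Lemma laplace_cvg lam : 0 <= lam ->
  (\sum_(A : graph n) bm_weight (@beta n) A * expR (- (lam * Q A))) @[n --> \oo] -->
  ((1 + 2 * lam) `^ (- (k%:R / 2)) : R).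
Proof.
move=> lam0; apply/cvgrPdist_le => e e0.
have C : lam * (8 * (1 + lam) * (k%:R * zeta_rate beta k n)) @[n --> \oo] --> (0 : R).
  rewrite -[X in _ --> X](mulr0 lam); apply: cvgM; first exact: cvg_cst.
  rewrite -[X in _ --> X](mulr0 (8 * (1 + lam))); apply: cvgM; first exact: cvg_cst.
  rewrite -[X in _ --> X](mulr0 k%:R); apply: cvgM; first exact: cvg_cst.
  exact: zeta_rate_cvg0.
near=> n.
have n2 : (2 < n)%N by near: n; exists 3.
have nn0 : (n0 <= n)%N by near: n; exists n0.
have [ho _ _ _ _] := contrastsP n2 nn0.
have b4 := b_n_ge4 (@beta n) (ltnW n2).
have N3 : 3 <= n%:R :> R by rewrite (ler_nat R 3).
have zp p : edge p -> \sum_(a < k) ends (@contrasts n a) p ^+ 2 <= zeta_rate beta k n ^+ 2.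
  move=> _; rewrite sqr_sqrtr; last by rewrite mulr_ge0// mulr_ge0// divr_ge0//; lra.
  rewrite mulr_natl -[X in _ *+ X](card_ord k) -sumr_const; apply: ler_sum => a _.
  exact: contrast_sup.
have := laplace_close ho (sqrtr_ge0 _) zp lam0.
rewrite distrC => /le_trans; apply.
by near: n; exact: cvg_near_le C e0.
Unshelve. all: by end_near. Qed.

Let Lmul n : R := expR (2 * (tau_rate beta n + om_rate beta r k n)).
Let Umul n : R := expR (2 * tau_rate beta n).
Let eta n : R := eta_rate beta r n.

Let ratio_close n (A : graph n) : Prop :=
  exists g g0 SS,
  [/\ is_maximizer A [set: 'I_n -> R] g, is_maximizer A (@S0 n) g0,
      (2 - Lmul n) * SS <= 2 * (loglik A g - loglik A g0) <= Umul n * SS,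
      Q A <= (1 + eta n) * SS + k%:R * (eta n ^+ 2 + eta n) &
      0 <= SS <= (1 + eta n) * Q A + k%:R * (eta n ^+ 2 + eta n)].

Lemma ratio_near : \forall n \near \oo, forall A : graph n, good A -> ratio_close A.
Proof.
near=> n => A gA.
have n2 : (2 < n)%N by near: n; exists 3.
have nn0 : (n0 <= n)%N by near: n; exists n0.
have L1 : 1 <= ln (n%:R : R) by near: n; exact: near_ln_ge1.
have t4 : tau_rate beta n <= 4^-1.
  by near: n; apply: cvg_near_le (tau_rate_cvg0 rate) _; rewrite invr_gt0.
have b4 := b_n_ge4 (@beta n) (ltnW n2).
have b0 : 0 < b_n (@beta n) by lra.
have eb p := @edgevar_ge_b_n R n (@beta n) p.
have X0 : 0 < Xi_rate n :> R.
  rewrite sqrtr_gt0 !mulr_gt0//; last by lra.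
  by rewrite ltr0n; apply: leq_trans n2.
have [h1 h2 h3 h4 h5] := contrastsP n2 nn0.
exact: (ratio_bounds b0 n2 eb X0 gA t4 h1 h2 h3 h4 h5).
Unshelve. all: by end_near. Qed.

(** The event of the theorem speaks of arbitrary maximizers, the bounds of constructed ones; this
    lets one replace the other. *)
Lemma is_maximizer_value n (A : graph n) (S : set ('I_n -> R)) g g' :
  is_maximizer A S g -> is_maximizer A S g' -> loglik A g = loglik A g'.
Proof. by move=> [Sg gm] [Sg' gm']; apply/eqP; rewrite eq_le gm// gm'. Qed.

Let lr_event x n (A : graph n) : Prop :=
  exists g g0, is_maximizer A [set: 'I_n -> R] g /\ is_maximizer A (@S0 n) g0 /\
               2 * (loglik A g - loglik A g0) <= x.

Lemma Lmul_cvg1 : Lmul n @[n --> \oo] --> (1 : R).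
Proof.
have C : 2 * (tau_rate beta n + om_rate beta r k n) @[n --> \oo] --> (0 : R).
  rewrite -[X in _ --> X](mulr0 2); apply: cvgM; first exact: cvg_cst.
  rewrite -[X in _ --> X](addr0 0); apply: cvgD; first exact: tau_rate_cvg0.
  exact: om_rate_cvg0.
have := cvg_comp _ _ C (@continuous_expR R 0); by rewrite expR0.
Qed.

Lemma Umul_cvg1 : Umul n @[n --> \oo] --> (1 : R).
Proof.
have C : 2 * tau_rate beta n @[n --> \oo] --> (0 : R).
  by rewrite -[X in _ --> X](mulr0 2); apply: cvgM; [exact: cvg_cst|exact: tau_rate_cvg0].
have := cvg_comp _ _ C (@continuous_expR R 0); by rewrite expR0.
Qed.

Lemma eta_affine_cvg y :
  (1 + eta n) * y + k%:R * (eta n ^+ 2 + eta n) @[n --> \oo] --> y.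
Proof.
have e0 : eta n @[n --> \oo] --> (0 : R) by exact: eta_rate_cvg0.
have yE : (1 + 0) * y + k%:R * (0 ^+ 2 + 0) = y by rewrite expr0n/= !addr0 mulr0 addr0 mul1r.
rewrite -[X in _ --> X]yE.
apply: cvgD; first by apply: cvgM; [apply: cvgD => //; exact: cvg_cst|exact: cvg_cst].
apply: cvgM; first exact: cvg_cst.
apply: cvgD => //.
exact: (cvg_comp eta (fun x => x ^+ 2) e0 (@exprn_continuous R 2 0)).
Qed.

Lemma lr_event_upper (x z : R) : 0 <= x -> x < z ->
  \forall n \near \oo, forall A : graph n, good A -> lr_event x A -> Q A <= z.
Proof.
move=> x0 xz; have [y xy yz] : exists2 y, x < y & y < z by exists ((x + z) / 2); lra.
have y0 : 0 < y by lra.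
near=> n => A gA [g [g0 [gm [g0m gx]]]].
have [g' [g0' [SS [g'm g0'm /andP[T1 _] QS /andP[S0' _]]]]] : ratio_close A.
  by move: A gA {g g0 gm g0m gx}; near: n; exact: ratio_near.
rewrite (is_maximizer_value gm g'm) (is_maximizer_value g0m g0'm) in gx.
have Sx := le_trans T1 gx.
(* Then (2 - Lmul) SS <= x forces SS <= y when x > 0. *)
have Lm : Lmul n <= 2 - x / y.
  near: n; apply: cvg_near_le Lmul_cvg1 _.
  have : x / y < 1 by rewrite ltr_pdivrMr// mul1r.
  lra.
have Sy : SS <= y.
  (* For x = 0 the factor x / y cannot be cancelled; instead 2 - Lmul >= 1/2 forces SS = 0. *)
  have [x00|xn] := eqVneq x 0; last first.
    have xp : 0 < x / y by rewrite divr_gt0// lt_neqAle eq_sym xn.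
    rewrite -(ler_pM2l xp) divfK ?gt_eqF//; apply: le_trans Sx.
    by rewrite ler_wpM2r//; lra.
  have L32 : Lmul n <= 3 / 2 by near: n; apply: cvg_near_le Lmul_cvg1 _; lra.
  by move: Sx; rewrite x00; nra.
have e1 : 0 <= eta n by apply: eta_rate_ge0; near: n; exists 3.
apply: le_trans QS _; apply: (@le_trans _ _ ((1 + eta n) * y + k%:R * (eta n ^+ 2 + eta n))).
  by rewrite lerD2r ler_wpM2l// addr_ge0.
by near: n; exact: cvg_near_le (@eta_affine_cvg y) yz.
Unshelve. all: by end_near. Qed.

Lemma lr_event_lower (x y : R) : y < x ->
  \forall n \near \oo, forall A : graph n, good A -> Q A <= y -> lr_event x A.
Proof.
move=> yx; near=> n => A gA Qy.
have [g [g0 [SS [gm g0m /andP[_ T2] _ /andP[S0' SQ]]]]] : ratio_close A.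
  by move: A gA {Qy}; near: n; exact: ratio_near.
exists g, g0; split => //; split => //; apply: le_trans T2 _.
have e1 : 0 <= eta n by apply: eta_rate_ge0; near: n; exists 3.
apply: (@le_trans _ _ (Umul n * ((1 + eta n) * y + k%:R * (eta n ^+ 2 + eta n)))).
  rewrite ler_wpM2l ?expR_ge0//; apply: le_trans SQ _.
  by rewrite lerD2r ler_wpM2l// addr_ge0.
near: n; apply: cvg_near_le yx.
rewrite -[X in _ --> X]mul1r; apply: cvgM; first exact: Umul_cvg1.
exact: eta_affine_cvg.
Unshelve. all: by end_near. Qed.

Lemma inv_n_cvg0 : 2 / n%:R @[n --> \oo] --> (0 : R).
Proof.
rewrite -[X in _ --> X](mulr0 2); apply: cvgM; first exact: cvg_cst.
apply/(@gtr0_cvgV0 _ _ _ _ (fun n : nat => n%:R : R)); last exact: cvgr_idn.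
by near=> n; rewrite ltr0n; near: n; exists 1.
Unshelve. all: by end_near. Qed.

Lemma bm_prob_le1 n (e : graph n -> Prop) : bm_prob (@beta n) e <= 1.
Proof.
rewrite bm_probE -[leRHS](expect_cst (@beta n)); apply: expect_le => A.
by case: ifP.
Qed.

Lemma wilks_existence : (fun n : nat => bm_prob (@beta n) (fun A =>
    (exists g, is_maximizer A [set: 'I_n -> R] g) /\ (exists g, is_maximizer A (@S0 n) g)))
  @ \oo --> (1 : R).
Proof.
apply/cvgrPdist_le => e e0; near=> n.
rewrite ger0_norm ?subr_ge0 ?bm_prob_le1// lerBlDr -lerBlDl.
apply: (@le_trans _ _ (bm_prob (@beta n) (@good n))).
  rewrite bm_probC lerB//; apply: (@le_trans _ _ (2 / n%:R)); first by near: n; exact: good_prob.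
  by near: n; exact: cvg_near_le inv_n_cvg0 e0.
apply: le_bm_prob => A gA.
have [g [g0 [SS [gm g0m _ _ _]]]] : ratio_close A.
  by move: A gA; near: n; exact: ratio_near.
by split; [exists g|exists g0].
Unshelve. all: by end_near. Qed.

Lemma wilks_cvg (x : R) :
  (fun n : nat => bm_prob (@beta n) (lr_event x (n := n))) @ \oo --> @chi2_cdf R k x.
Proof.
(* The ratio is nonnegative, since the constrained maximum cannot exceed the global one, so for x <
   0 both sides are 0. *)
have [x0|x0] := ltP x 0.
  rewrite /chi2_cdf (ltW x0); apply: cvg_near_cst; near=> n.
  rewrite /bm_prob big1// => A /asboolP[g [g0 [[_ gm] [_]]]].
  move=> lr; have := le_lt_trans lr x0.
  by rewrite pmulr_rlt0// subr_lt0 ltNge gm.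
have PM := laplace_chi2_portmanteau k_gt0 (fun n A => bm_weight_ge0 (@beta n) A)
  (fun n => bm_weight_sum (@beta n)) (fun n A => qstat_ge0 (@beta n) k (@contrasts n) A)
  laplace_cvg.
have QE n y : \sum_(A : graph n | qstat (@beta n) k (@contrasts n) A <= y) bm_weight (@beta n) A =
    bm_prob (@beta n) (fun A => Q A <= y).
  by apply: eq_bigl => A; rewrite asboolb.
apply/cvgrPdist_le => e e0; have e3 : 0 < e / 3 by rewrite divr_gt0.
have [z xz Cz] := chi2_cdf_right k_gt0 x0 e3.
(* Two gaps are needed: x < z' to pass from the ratio to [Q], and z' < z to pass from [Q] to the
   chi-square CDF. *)
pose z' := (x + z) / 2.
have xz' : x < z' by rewrite /z'; lra.
have z'z : z' < z by rewrite /z'; lra.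
have z'0 : 0 < z' by lra.
have up : \forall n \near \oo, bm_prob (@beta n) (lr_event x (n := n)) <= chi2_cdf k x + e.
  near=> n.
  have P1 : bm_prob (@beta n) (fun A => Q A <= z') <= chi2_cdf k z + e / 3.
    by rewrite -QE; near: n; apply: filterS (PM _ _ _ z'0 z'z e3) => n [].
  have P2 : bm_prob (@beta n) (fun A => ~ good A) <= e / 3.
    apply: (@le_trans _ _ (2 / n%:R)); first by near: n; exact: good_prob.
    by near: n; exact: cvg_near_le inv_n_cvg0 e3.
  apply: (@le_trans _ _ (bm_prob (@beta n) (fun A => Q A <= z') +
      bm_prob (@beta n) (fun A => ~ good A))); last by lra.
  apply: le_trans (bm_prob_or _ _ _); apply: le_bm_prob.
  have H : forall A : graph n, good A -> lr_event x A -> Q A <= z'.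
    by near: n; exact: lr_event_upper.
  by move=> A ev; have [gA|] := pselect (good A); [left; exact: H|right].
have low : \forall n \near \oo, chi2_cdf k x - e <= bm_prob (@beta n) (lr_event x (n := n)).
  (* At x = 0 there is no room for 0 < y < x, but the CDF is 0 and the bound is trivial. *)
  move: x0; rewrite le_eqVlt => /predU1P[<-|x0].
    near=> n; apply: (@le_trans _ _ 0); last exact: bm_prob_ge0.
    by rewrite /chi2_cdf lexx sub0r oppr_le0 ltW.
  have [y /andP[y0 yx] Cy] := chi2_cdf_left k_gt0 x0 e3.
  pose y' := (x + y) / 2.
  have yy' : y < y' by rewrite /y'; lra.
  have y'x : y' < x by rewrite /y'; lra.
  near=> n.
  have P1 : chi2_cdf k y - e / 3 <= bm_prob (@beta n) (fun A => Q A <= y').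
    by rewrite -QE; near: n; apply: filterS (PM _ _ _ y0 yy' e3) => n [].
  have P2 : bm_prob (@beta n) (fun A => ~ good A) <= e / 3.
    apply: (@le_trans _ _ (2 / n%:R)); first by near: n; exact: good_prob.
    by near: n; exact: cvg_near_le inv_n_cvg0 e3.
  have : bm_prob (@beta n) (fun A => Q A <= y') <=
      bm_prob (@beta n) (lr_event x (n := n)) + bm_prob (@beta n) (fun A => ~ good A).
    apply: le_trans (bm_prob_or _ _ _); apply: le_bm_prob.
    have H : forall A : graph n, good A -> Q A <= y' -> lr_event x A.
      by near: n; exact: lr_event_lower.
    by move=> A ev; have [gA|] := pselect (good A); [left; exact: H|right].
  lra.
near=> n; rewrite ler_norml; apply/andP; split.
  have : bm_prob (@beta n) (lr_event x (n := n)) <= chi2_cdf k x + e by near: n.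
  by move=> ?; lra.
have : chi2_cdf k x - e <= bm_prob (@beta n) (lr_event x (n := n)) by near: n.
by move=> ?; lra.
Unshelve. all: by end_near. Qed.

End Wilks.

(** * The two null hypotheses as kernels of explicit contrasts *)

Section NullHypotheses.
Context {R : realType}.

Definition unit_vec n (a : nat) : 'I_n -> R := fun i => (nat_of_ord i == a)%:R.
Arguments unit_vec : clear implicits.

Lemma dot_unit_vec n (x : 'I_n -> R) (i : 'I_n) : dot (unit_vec n i) x = x i.
Proof.
rewrite /dot /unit_vec (bigD1 i)//= eqxx mul1r big1 ?addr0// => j ji.
by rewrite val_eqE (negbTE ji) mul0r.
Qed.

Lemma dotC n (x y : 'I_n -> R) : dot x y = dot y x.
Proof. by apply: eq_bigr => i _; rewrite mulrC. Qed.

Lemma specified_null n r (x : 'I_n -> R) : (r <= n)%N ->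
  tied (fun _ _ => false) (fun i => (i < r)%N) x <-> nullsp (unit_vec n) r x.
Proof.
move=> rn; split => [[_ x0] a ar|x0].
  by rewrite (dot_unit_vec x (Ordinal (leq_trans ar rn))) x0.
by split => // i ir; rewrite -dot_unit_vec; exact: x0.
Qed.

Lemma specified_indep n r a : (r <= n)%N -> (a < r)%N ->
  exists2 z, nullsp (unit_vec n) a z & dot (unit_vec n a) z != 0.
Proof.
move=> rn ar; pose i := Ordinal (leq_trans ar rn).
exists (unit_vec n a) => [b ba|].
  by rewrite dotC (dot_unit_vec _ i) /unit_vec gtn_eqF.
by rewrite (dot_unit_vec _ i) /unit_vec eqxx oner_eq0.
Qed.

(** Node [a.+1] is compared with node 0, so [a < r.-1] gives the r - 1 degrees of freedom. *)
Definition contrast_vec n (a : nat) : 'I_n -> R :=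
  fun i => unit_vec n a.+1 i + -1 * unit_vec n 0 i.
Arguments contrast_vec : clear implicits.

Lemma dot_contrast_vec n (x : 'I_n -> R) a (i j : 'I_n) :
  nat_of_ord i = a.+1 -> nat_of_ord j = 0%N -> dot (contrast_vec n a) x = x i - x j.
Proof.
move=> ia j0; rewrite dotC dot_lin !(dotC x) -ia -{1}j0 !dot_unit_vec.
by rewrite mulN1r.
Qed.

Lemma homogeneous_null n r (x : 'I_n -> R) : (1 < r)%N -> (r <= n)%N ->
  tied (fun i j => (i < r)%N && (j < r)%N) pred0 x <-> nullsp (contrast_vec n) r.-1 x.
Proof.
move=> r1 rn; have n0 : (0 < n)%N by apply: leq_trans rn; apply: ltnW.
pose o := Ordinal n0; split => [[xE _] a ar|x0].
  have ar' : (a.+1 < r)%N by rewrite -ltn_predRL.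
  rewrite (@dot_contrast_vec n x a (Ordinal (leq_trans ar' rn)) o)//.
  by apply/eqP; rewrite subr_eq0; apply/eqP/xE; rewrite /= ar' ltnW.
have xo (i : 'I_n) : (i < r)%N -> x i = x o.
  case: (posnP i) => [i0 _|i0 ir]; first by congr x; apply: val_inj.
  have := x0 i.-1; rewrite (@dot_contrast_vec n x i.-1 i o) ?prednK//.
  move=> /(_ _)/eqP; rewrite subr_eq0 => H; apply/eqP/H.
  by rewrite -ltnS !prednK// ltnW.
by split => // i j /andP[ir jr]; rewrite !xo.
Qed.

Lemma homogeneous_indep n r a : (1 < r)%N -> (r <= n)%N -> (a < r.-1)%N ->
  exists2 z, nullsp (contrast_vec n) a z & dot (contrast_vec n a) z != 0.
Proof.
move=> r1 rn ar; have n0 : (0 < n)%N by apply: leq_trans rn; apply: ltnW.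
have ar' : (a.+1 < r)%N by rewrite -ltn_predRL.
have an := leq_trans ar' rn; pose o := Ordinal n0.
(* Node [a.+1] occurs in no earlier contrast. *)
exists (unit_vec n a.+1) => [b ba|].
  have bn : (b.+1 < n)%N by apply: ltn_trans an.
  rewrite (@dot_contrast_vec n _ b (Ordinal bn) o)// /unit_vec/=.
  by rewrite eqSS ltn_eqF// subrr.
by rewrite (@dot_contrast_vec n _ a (Ordinal an) o)// /unit_vec/= eqxx subr0 oner_eq0.
Qed.

End NullHypotheses.

Theorem theorem2 (R : realType) (r : nat) (beta : forall n : nat, 'I_n -> R) :
  (0 < r)%N ->
  (* b_n^3 / c_n = o(n^(1/6) / log n) *)
  (fun n : nat => (b_n (beta n) ^+ 3 / c_n (beta n)) /
                  (n%:R `^ (1 / 6 : R) / ln (n%:R : R))) @ \oo --> (0 : R) ->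
  (* (a) specified null: beta_i = beta0_i for i = 1..r *)
  (forall beta0 : forall n : nat, 'I_n -> R,
     (forall n (i : 'I_n), (i < r)%N -> beta n i = beta0 n i) ->
     let S0 n : set ('I_n -> R) :=
       [set g | forall i : 'I_n, (i < r)%N -> g i = beta0 n i] in
     (fun n : nat => bm_prob (beta n) (fun A =>
        (exists g, is_maximizer A [set: 'I_n -> R] g) /\ (exists g, is_maximizer A (S0 n) g)))
       @ \oo --> (1 : R)
     /\
     forall x : R,
     (fun n : nat => bm_prob (beta n) (fun A =>
        exists g g0, is_maximizer A [set: 'I_n -> R] g /\ is_maximizer A (S0 n) g0 /\
                     2 * (loglik A g - loglik A g0) <= x))
       @ \oo --> @chi2_cdf R r x)
  /\
  (* (b) homogeneous null: beta_1 = ... = beta_r, r >= 2 *)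
  ((1 < r)%N ->
     (forall n (i j : 'I_n), (i < r)%N -> (j < r)%N -> beta n i = beta n j) ->
     let S0 n : set ('I_n -> R) :=
       [set g | forall i j : 'I_n, (i < r)%N -> (j < r)%N -> g i = g j] in
     (fun n : nat => bm_prob (beta n) (fun A =>
        (exists g, is_maximizer A [set: 'I_n -> R] g) /\ (exists g, is_maximizer A (S0 n) g)))
       @ \oo --> (1 : R)
     /\
     forall x : R,
     (fun n : nat => bm_prob (beta n) (fun A =>
        exists g g0, is_maximizer A [set: 'I_n -> R] g /\ is_maximizer A (S0 n) g0 /\
                     2 * (loglik A g - loglik A g0) <= x))
       @ \oo --> @chi2_cdf R r.-1 x).
Proof.
move=> r0 rate; split.
  move=> beta0 b0 S0.
  (* The true parameter satisfies the null, so recentring at it turns the affine constraint into the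
     linear space [tied]. *)
  have S0E : S0 = (fun n => [set g | tied (fun _ _ => false) (fun i : 'I_n => (i < r)%N)
      (fun i => g i - beta n i)]).
    apply: functional_extensionality_dep => n; apply/seteqP; split => g /=.
      by move=> g0; split => // i ir; rewrite g0// b0// subrr.
    by move=> [_ g0] i ir; apply/eqP; rewrite -b0// -subr_eq0 g0.
  have null n (rn : (r <= n)%N) x := @specified_null R n r x rn.
  have indep n a (rn : (r <= n)%N) ar := @specified_indep R n r a rn ar.
  have zero n (y : 'I_n -> R) : (forall i : 'I_n, (i < r)%N -> y i = 0) ->
      tied (fun _ _ => false) (fun i : 'I_n => (i < r)%N) y by split.
  rewrite S0E; split.
    exact: (wilks_existence rate null indep zero).
  by move=> x; exact: (wilks_cvg rate r0 null indep zero).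
move=> r1 bE S0.
have S0E : S0 = (fun n => [set g | tied (fun i j : 'I_n => (i < r)%N && (j < r)%N) pred0
    (fun i => g i - beta n i)]).
  apply: functional_extensionality_dep => n; apply/seteqP; split => g /=.
    by move=> gE; split => // i j /andP[ir jr]; rewrite (gE i j)// (bE n i j).
  move=> [gE _] i j ir jr; have := gE i j; rewrite ir jr => /(_ isT).
  by rewrite (bE n i j)// => /addIr.
have k0 : (0 < r.-1)%N by rewrite -ltnS prednK.
have null n (rn : (r <= n)%N) x := @homogeneous_null R n r x r1 rn.
have indep n a (rn : (r <= n)%N) ar := @homogeneous_indep R n r a r1 rn ar.
have zero n (y : 'I_n -> R) : (forall i : 'I_n, (i < r)%N -> y i = 0) ->
    tied (fun i j : 'I_n => (i < r)%N && (j < r)%N) pred0 y.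
  by move=> y0; split => // i j /andP[ir jr]; rewrite !y0.
rewrite S0E; split.
  exact: (wilks_existence rate null indep zero).
by move=> x; exact: (wilks_cvg rate k0 null indep zero).
Qed.
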